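(* Let $f_0$ be a probability density on $\mathbb R$ with $\int vf_0\,dv=0$, $\int v^2f_0\,dv=1$, and $f_0\in\mathcal M_\alpha$ where $\alpha=2+\delta$ for some $\delta>0$. Let $\lambda$ be a fixed constant and let the mixing parameters $p>q>0$ satisfy $$\frac{(p-1)^2}{q^2}=\lambda^2 .$$ Let $g(v,t)$ be the weak solution of the scaled Boltzmann equation (SB) (see context) with initial value $f_0$, and let $h_q(v,\tau)=g(v,t)$ with $\tau=q^2t$. Then, as $q\to0$, the densities $h_q(\cdot,\tau)$ converge, up to extraction of a subsequence, to a probability density $h(\cdot,\tau)$, in the sense that for all $\phi\in\mathcal F_s(\mathbb R)$ with $s=2+\delta$, $\int\phi(v)h_q(v,\tau)dv\to\int\phi(v)h(v,\tau)dv$. The limit $h$ is a weak solution, with initial datum $f_0$, of the Fokker–Planck equation $$\frac{\partial h}{\partial\tau}=\frac12\left(\frac{\partial^2}{\partial v^2}\big((1+\lambda^2v^2)h\big)+(1+\lambda^2)\frac{\partial}{\partial v}(vh)\right),$$ that is, for all $\phi\in\mathcal F_s(\mathbb R)$ and $\tau>0$, $$\frac d{d\tau}\int_{\mathbb R}\phi(v)h(v,\tau)\,dv+\frac12(\lambda^2+1)\int_{\mathbb R}\phi'(v)\,v\,h(v,\tau)\,dv=\frac12\int_{\mathbb R}h(v,\tau)(\lambda^2v^2+1)\phi''(v)\,dv .$$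
   Context: $\mathcal M_\alpha$ is the set of Borel probability measures on $\mathbb R$ with finite absolute moment of order $\alpha$, with the topology of weak convergence. Measures are written as densities. For $s>0$ write $s=m+\delta'$ with $m\ge0$ an integer and $0<\delta'\le1$. $\mathcal F_s(\mathbb R)$ is the class of real functions $\phi$ on $\mathbb R$ whose $m$-th derivative is Hölder continuous of order $\delta'$: $\sup_{v\ne w}\frac{|\phi^{(m)}(v)-\phi^{(m)}(w)|}{|v-w|^{\delta'}}<\infty$. A weak solution $f$ of the (unscaled) Boltzmann equation with initial datum $f_0\in\mathcal M_\alpha$, $\alpha>2$, is $f\in C^1([0,\infty),\mathcal M_\alpha)$ (i.e. $t\mapsto\int\phi f(v,t)dv$ is $C^1$ for each test function) such that for all $t>0$ and all smooth $\phi$ (bounded with all derivatives bounded) $$\frac d{dt}\int_{\mathbb R}\phi(v)f(v,t)\,dv=\int_{\mathbb R^2}f(v,t)f(w,t)\big(\phi(pv+qw)-\phi(v)\big)\,dv\,dw,$$ and $\lim_{t\to0}\int\phi f(v,t)dv=\int\phi f_0dv$. When $f_0$ has zero mean and unit second moment, $E(t)=\int v^2f(v,t)dv=\exp\{(p^2+q^2-1)t\}$. The weak solution of the scaled equation (SB) with initial value $f_0$ is $g(v,t)=\sqrt{E(t)}\,f\big(\sqrt{E(t)}\,v,t\big)$, where $f$ is the weak solution of the (unscaled) Boltzmann equation with initial datum $f_0$ and $E(t)=\exp\{(p^2+q^2-1)t\}$. The weak form of (SB) is $$\frac d{dt}\int\phi g\,dv+\tfrac12(p^2+q^2-1)\int\phi'(v)\,v\,g\,dv=\int_{\mathbb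 R^2}g(v)g(w)\big(\phi(pv+qw)-\phi(v)\big)dv\,dw .$$ *)

(* Defs.v *)
From HB Require Import structures.
From mathcomp Require Import all_boot all_order all_algebra.
From mathcomp Require Import all_classical all_reals all_analysis.
From mathcomp Require Import measurable_realfun.
Set Implicit Arguments.
Unset Strict Implicit.
Unset Printing Implicit Defensive.
Import Order.TTheory GRing.Theory Num.Theory.
Import numFieldNormedType.Exports.
Local Open Scope classical_set_scope.
Local Open Scope ring_scope.

Notation borelProb R := (probability (measurableTypeR R) R).

Section Definitions.
Context {R : realType}.
Implicit Types (mu : borelProb R) (F phi : R -> R).

Definition finite_moment (a : R) mu : Prop :=
  (\int[mu]_v (`|v| `^ a)%:E < +oo)%E.

Definition test_function phi : Prop :=
  forall n, (forall v, derivable (derive1n n phi) v 1) /\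
    exists M : R, forall v, `|derive1n n phi v| <= M.

(* The decomposition s = m + d with d in ]0, 1] is unique when s > 0. *)
Definition class_F (s : R) phi : Prop :=
  exists (m : nat) (d : R),
    [/\ s = m%:R + d, 0 < d, d <= 1,
        forall k, (k < m)%N -> forall v, derivable (derive1n k phi) v 1 &
        exists C : R, forall v w,
          `|derive1n m phi v - derive1n m phi w| <= C * `|v - w| `^ d].

(* C^1 on [0, +oo): the derivative at 0 is one-sided. *)
Definition C1_halfline F : Prop :=
  exists dF : R -> R, {within `[0, +oo[, continuous dF} /\
    forall t : R, 0 <= t ->
      (F u - F t) / (u - t) @[u --> within `[0, +oo[ t^'] --> dF t.

(* Only the values of f at times t >= 0 are meaningful. *)
Definition boltzmann_weak_solution (p q alpha : R) (f0 : borelProb R)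
    (f : R -> borelProb R) : Prop :=
  [/\ forall t : R, 0 <= t -> finite_moment alpha (f t),
      forall phi, test_function phi ->
        C1_halfline (fun t => \int[f t]_v phi v),
      forall phi, test_function phi -> forall t : R, 0 < t ->
        is_derive t 1 (fun u : R => \int[f u]_v phi v)
          (\int[(f t \x f t)%E]_z (phi (p * z.1 + q * z.2) - phi z.1)) &
      forall phi, test_function phi ->
        \int[f t]_v phi v @[t --> 0^'+] --> \int[f0]_v phi v].

Definition energy (p q t : R) : R := expR ((p ^+ 2 + q ^+ 2 - 1) * t).

Definition dilation (c : R) (v : measurableTypeR R) : measurableTypeR R := c * v.

Lemma dilation_measurable (c : R) : measurable_fun setT (dilation c).
Proof. exact: mulrl_measurable. Qed.

HB.instance Definition _ (c : R) :=
  isMeasurableFun.Build _ _ _ _ (dilation c) (dilation_measurable c).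

(* If X has density f then X / sqrt E has density sqrt E * f (sqrt E * v). *)
Definition scaled_solution (p q : R) (f : R -> borelProb R) (t : R) :
    borelProb R :=
  distribution (f t) (dilation (Num.sqrt (energy p q t))^-1).

(* The moment condition makes every integral below absolutely convergent, so
   that [Rintegral] never takes a default value. *)
Definition fokker_planck_weak_solution (lambda s : R) (f0 : borelProb R)
    (h : R -> borelProb R) : Prop :=
  [/\ forall tau : R, 0 <= tau -> finite_moment s (h tau),
      forall phi, class_F s phi -> forall tau : R, 0 < tau ->
        derivable (fun u : R => \int[h u]_v phi v) tau 1 /\
        derive1 (fun u : R => \int[h u]_v phi v) tau
          + 2^-1 * (lambda ^+ 2 + 1) * \int[h tau]_v (derive1 phi v * v)
        = 2^-1 * \int[h tau]_v ((lambda ^+ 2 * v ^+ 2 + 1) * derive1n 2 phi v) &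
      forall phi, class_F s phi ->
        \int[h tau]_v phi v @[tau --> 0^'+] --> \int[f0]_v phi v].

End Definitions.

(* Main.v *)
(* Polynomials in a sigmoid are smooth with bounded derivatives, so the equation
   tested against them extends, by dominated limits and Dynkin's lemma, to all
   bounded Borel functions.  Gronwall's inequality then applies to truncations of
   [v^2 (1 + v^2)^b / (r^2 + v^2)], with [2 b = 2 + delta]: the truncations are
   removed, the equation holds for all functions of growth [(1 + v^2)^b], and after
   the scaling these tails grow at a rate that does not depend on [q].  Hence the
   moments of order [2 + delta] are uniformly integrable on bounded time intervals.

   With [k = p - 1] a collision moves [v] to [v + (k v + q w)] where
   [k^2 = lambda^2 q^2].  As the mean is 0 and the energy 1, a second order Taylor
   expansion turns [q^-2] times the collision term into half the integral of
   [(1 + lambda^2 v^2) phi''], with an error that tends to 0 uniformly in time by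
   the uniform integrability; the first order part of the collision term combines
   with the drift of the scaling into [- (1 + lambda^2) / 2 v phi'].

   Helly's theorem at rational times and rational points, equicontinuity in time
   and uniform integrability give a limit along a subsequence, for every time and
   every continuous function of growth [(1 + v^2)^b].  The mean value form of the
   equation passes to this limit. *)
From HB Require Import structures.
Require Import Defs.
From mathcomp Require Import all_boot all_order all_algebra.
From mathcomp Require Import all_classical all_reals all_analysis.
From mathcomp Require Import measurable_realfun ring lra.
Import Order.TTheory GRing.Theory Num.Theory.
Import numFieldNormedType.Exports.
Local Open Scope classical_set_scope.
Local Open Scope ring_scope.
Set Implicit Arguments.
Unset Strict Implicit.
Unset Printing Implicit Defensive.

(** * Integrals against a probability measure *)

(** Functions in F_s grow up to the order 2 + delta of the only moment assumed, so a bound on that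
    moment would not give convergence of their integrals: its tails have to be propagated. The
    weight [tail r] has a doubling constant, and a ratio of second derivative to [theta r], that are
    bounded independently of r; so Gronwall's inequality multiplies all tails of [f0] by the same
    factor. Gronwall is used twice. For fixed p and q the collision term is bounded crudely, and the
    rate, of order one in t = tau / q^2, is useless as q tends to 0; but this estimate is what
    permits unbounded test functions. Only with these are mean zero, unit energy and the drift
    available, whose cancellations give the second estimate, with a rate free of q in the time tau.
    Integrals of functions such as the generator applied to phi are not known to be Lipschitz in
    time. They are reached from smooth tests by compactness: sequences of measures with controlled
    tails that agree asymptotically on the tests agree on all continuous functions of growth [W]. *)

Definition intg {d} {T : measurableType d} {R : realType}
    (P : probability T R) (f : T -> R) : Prop :=
  P.-integrable setT (EFin \o f).

Section Expectation.
Context {d} {T : measurableType d} {R : realType} (P : probability T R).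
Implicit Types f g : T -> R.

Lemma intg_measurable f : intg P f -> measurable_fun setT f.
Proof. by move=> /(measurable_int P) /measurable_EFinP. Qed.

Lemma intg_le f g : measurable_fun setT f -> intg P g ->
  (forall x, `|f x| <= g x) -> intg P f.
Proof.
move=> mf ig fg; apply: (le_integrable measurableT _ _ ig).
  exact/measurable_EFinP.
by move=> x _ /=; rewrite lee_fin (le_trans (fg x)) ?ler_norm.
Qed.

Lemma intg_cst (c : R) : intg P (fun=> c).
Proof.
apply: (finite_measure_integrable_cst P c); exact: measurableT.
Qed.

Lemma intg_bounded f (M : R) : measurable_fun setT f ->
  (forall x, `|f x| <= M) -> intg P f.
Proof. move=> mf fM; exact: (intg_le mf (intg_cst M)). Qed.

Lemma intgD f g : intg P f -> intg P g -> intg P (fun x => f x + g x).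
Proof. by move=> jf jg; exact: (integrableD measurableT jf jg). Qed.

Lemma intgZ (c : R) f : intg P f -> intg P (fun x => c * f x).
Proof. by move=> jf; exact: (integrableZl measurableT c jf). Qed.

Lemma intgB f g : intg P f -> intg P g -> intg P (fun x => f x - g x).
Proof. by move=> jf jg; exact: (integrableB measurableT jf jg). Qed.

Lemma intg_norm f : intg P f -> intg P (fun x => `|f x|).
Proof. exact: integrable_norm. Qed.

Lemma expD f g : intg P f -> intg P g ->
  \int[P]_x (f x + g x) = \int[P]_x f x + \int[P]_x g x.
Proof. exact: RintegralD. Qed.

Lemma expB f g : intg P f -> intg P g ->
  \int[P]_x (f x - g x) = \int[P]_x f x - \int[P]_x g x.
Proof. exact: RintegralB. Qed.

Lemma expZ c f : intg P f -> \int[P]_x (c * f x) = c * \int[P]_x f x.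
Proof. exact: RintegralZl. Qed.

Lemma exp_cst (c : R) : \int[P]_x c = c.
Proof.
by rewrite Rintegral_cst//= probability_setT mulr1.
Qed.

Lemma exp_le f g : intg P f -> intg P g -> (forall x, f x <= g x) ->
  \int[P]_x f x <= \int[P]_x g x.
Proof. by move=> jf jg fg; apply: le_Rintegral. Qed.

Lemma exp_norm f g : intg P f -> intg P g -> (forall x, `|f x| <= g x) ->
  `|\int[P]_x f x| <= \int[P]_x g x.
Proof.
move=> jf jg fg; apply: (le_trans (le_normr_Rintegral _ jf)) => //.
by apply: exp_le => //; exact: intg_norm.
Qed.

Lemma exp_bounded f (M : R) : measurable_fun setT f ->
  (forall x, `|f x| <= M) -> `|\int[P]_x f x| <= M.
Proof.
move=> mf fM; rewrite -[leRHS]exp_cst; apply: exp_norm => //.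
- exact: intg_bounded fM.
- exact: intg_cst.
Qed.

Lemma exp_ge0 f : (forall x, 0 <= f x) -> 0 <= \int[P]_x f x.
Proof. by move=> f0; exact: Rintegral_ge0. Qed.

Lemma exp_dominated (f_ : nat -> T -> R) f g :
  (forall n, measurable_fun setT (f_ n)) -> intg P g ->
  (forall n x, `|f_ n x| <= g x) -> (forall x, f_ ^~ x @ \oo --> f x) ->
  intg P f /\ \int[P]_x f_ n x @[n --> \oo] --> \int[P]_x f x.
Proof.
move=> mf_ ig fg ff.
have mf : measurable_fun setT f.
  by apply: (measurable_fun_cvg (h := f_)) => // x _; exact: ff.
have [] := @dominated_convergence _ T R P _ measurableT
  (fun n => EFin \o f_ n) (EFin \o f) (EFin \o g).
- by move=> n; exact/measurable_EFinP.
- exact/measurable_EFinP.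
- by apply: aeW => x _; apply: cvg_EFin; [exact: nearW|exact: ff].
- exact: ig.
- by apply: aeW => x n _ /=; rewrite lee_fin.
move=> jf _ H; split => //.
apply: fine_cvg; rewrite fineK; last exact: integrable_fin_num.
exact: H.
Qed.

End Expectation.

Arguments intg_bounded {d T R P f} M _ _.
Arguments exp_bounded {d T R P f M} _ _.

Lemma exp_distribution {d d'} {T : measurableType d} {T' : measurableType d'}
    {R : realType} (P : probability T R) (X : {mfun T >-> T'}) (f : T' -> R) :
  measurable_fun setT f -> intg P (f \o X) ->
  \int[distribution P X]_y f y = \int[P]_x f (X x).
Proof.
move=> mf jf; congr fine; rewrite integral_distribution//.
exact/measurable_EFinP.
Qed.

(** * Fubini's theorem for real-valued integrals *)

Section Product.
Context {d d'} {T : measurableType d} {T' : measurableType d'} {R : realType}.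
Variables (P : probability T R) (Q : probability T' R).

Lemma intg_fst (f : T -> R) : intg P f -> intg (P \x Q)%E (fun z => f z.1).
Proof.
move=> jf; have mf := intg_measurable jf.
have mF : measurable_fun setT (fun z : T * T' => (f z.1)%:E).
  by apply/measurable_EFinP; exact: measurableT_comp.
apply/(integrable12ltyP _ _ mF) => /=.
under eq_integral do rewrite integral_cst//= probability_setT mule1.
by case/integrableP : jf.
Qed.

Lemma intg_snd (g : T' -> R) : intg Q g -> intg (P \x Q)%E (fun z => g z.2).
Proof.
move=> jf; have mf := intg_measurable jf.
have mF : measurable_fun setT (fun z : T * T' => (g z.2)%:E).
  by apply/measurable_EFinP; exact: measurableT_comp.
apply/(integrable21ltyP _ _ mF) => /=.
under eq_integral do rewrite integral_cst//= probability_setT mule1.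
by case/integrableP : jf.
Qed.

(** Every section, and not just almost every one, is taken integrable, so that each inner
    [Rintegral] is the true extended integral and never a default value. *)
Lemma exp_fubini (F : T * T' -> R) : intg (P \x Q)%E F ->
  (forall x, intg Q (fun y => F (x, y))) ->
  \int[(P \x Q)%E]_z F z = \int[P]_x \int[Q]_y F (x, y).
Proof.
move=> jF jF1; rewrite /Rintegral; congr fine.
rewrite -integral12_prod_meas1//; apply: eq_integral => x _.
by rewrite fineK//; apply: integrable_fin_num => //; exact: jF1.
Qed.

Lemma exp_fubini2 (F : T * T' -> R) : intg (P \x Q)%E F ->
  (forall y, intg P (fun x => F (x, y))) ->
  \int[(P \x Q)%E]_z F z = \int[Q]_y \int[P]_x F (x, y).
Proof.
move=> jF jF1; rewrite /Rintegral; congr fine.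
rewrite -integral21_prod_meas1//; apply: eq_integral => x _.
by rewrite fineK//; apply: integrable_fin_num => //; exact: jF1.
Qed.

Lemma measurable_exp1 (F : T * T' -> R) : intg (P \x Q)%E F ->
  (forall x, intg Q (fun y => F (x, y))) ->
  measurable_fun setT (fun x => \int[Q]_y F (x, y)).
Proof.
move=> jF jF1; apply/measurable_EFinP.
apply: (eq_measurable_fun _ _ (measurable_fubini_F jF)) => x _ /=.
by rewrite fineK//; apply: integrable_fin_num => //; exact: jF1.
Qed.

Lemma measurable_exp2 (F : T * T' -> R) : intg (P \x Q)%E F ->
  (forall y, intg P (fun x => F (x, y))) ->
  measurable_fun setT (fun y => \int[P]_x F (x, y)).
Proof.
move=> jF jF1; apply/measurable_EFinP.
apply: (eq_measurable_fun _ _ (measurable_fubini_G jF)) => y _ /=.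
by rewrite fineK//; apply: integrable_fin_num => //; exact: jF1.
Qed.

Lemma exp_fst (f : T -> R) : intg P f ->
  \int[(P \x Q)%E]_z f z.1 = \int[P]_x f x.
Proof.
move=> jf; rewrite exp_fubini//; [|exact: intg_fst|by move=> x; exact: (intg_cst Q (f x))].
by apply: eq_Rintegral => x _; exact: (exp_cst Q (f x)).
Qed.

Lemma exp_snd (g : T' -> R) : intg Q g ->
  \int[(P \x Q)%E]_z g z.2 = \int[Q]_x g x.
Proof.
move=> jf; rewrite exp_fubini2//; [|exact: intg_snd|by move=> x; exact: (intg_cst P (g x))].
by apply: eq_Rintegral => x _; exact: (exp_cst P (g x)).
Qed.

Lemma intg_prod (f : T -> R) (g : T' -> R) : intg P f -> intg Q g ->
  intg (P \x Q)%E (fun z => f z.1 * g z.2).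
Proof.
move=> jf jg; have mf := intg_measurable jf; have mg := intg_measurable jg.
have mF : measurable_fun setT (fun z : T * T' => (f z.1 * g z.2)%:E).
  apply/measurable_EFinP; apply: measurable_funM; exact: measurableT_comp.
apply/(integrable12ltyP _ _ mF) => /=.
under eq_integral.
  move=> x _; under eq_integral do rewrite normrM EFinM.
  rewrite ge0_integralZl//; last first.
    by apply/measurable_EFinP; exact: measurableT_comp.
  over.
have -> : (fun x => `|f x|%:E * \int[Q]_y (`|g y|)%:E)%E =
    (fun x => `|f x|%:E * (fine (\int[Q]_y (`|g y|)%:E))%:E)%E.
  apply/funext => x; rewrite fineK//.
  by apply: integrable_fin_num => //; exact: (intg_norm jg).
rewrite ge0_integralZr//; last 2 first.
- by apply/measurable_EFinP; exact: measurableT_comp.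
- by rewrite lee_fin fine_ge0// integral_ge0.
apply: lte_mul_pinfty.
- by apply: integral_ge0 => x _; rewrite lee_fin.
- apply: integrable_fin_num => //; exact: (intg_norm jf).
- exact: ltry.
Qed.

Lemma exp_prod (f : T -> R) (g : T' -> R) : intg P f -> intg Q g ->
  \int[(P \x Q)%E]_z (f z.1 * g z.2) = \int[P]_x f x * \int[Q]_x g x.
Proof.
move=> jf jg; rewrite exp_fubini; last 2 first.
- exact: intg_prod.
- by move=> x; exact: (intgZ (f x) jg).
under eq_Rintegral do rewrite /= expZ//.
by rewrite RintegralZr.
Qed.

End Product.

(** * Calculus on the line and half-line *)

Section Calculus.
Context {R : realType}.
Implicit Types F G : R -> R.

Lemma cvg_norm_le (u : nat -> R) (l M : R) : u @ \oo --> l ->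
  (exists N, forall n, (N <= n)%N -> `|u n| <= M) -> `|l| <= M.
Proof.
move=> ul [N HN]; apply: (ler_cvg_to (cvg_norm ul) (cvg_cst M)).
by exists N => // n /= Nn; exact: HN.
Qed.

(** The division-free form of differentiability: an inequality between increments, which survives
    pointwise limits of [F]. Each later limit passage for derivatives ends here. *)
Lemma is_derive_approx F (t g : R) :
  (forall e : R, 0 < e -> exists2 d : R, 0 < d &
    forall u, `|u - t| < d -> `|F u - F t - (u - t) * g| <= e * `|u - t|) ->
  is_derive t 1 F g.
Proof.
move=> H.
suff cv : h^-1 *: ((F \o shift t) (h *: (1 : R)) - F t) @[h --> 0^'] --> g.
  by split; [exact: cvgP cv|exact: cvg_lim cv].
apply/cvgrPdist_le => e e0; have [d d0 Hd] := H e e0.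
near=> h.
have h0 : h != 0 by near: h; exact: nbhs_dnbhs_neq.
have hd : `|h| < d by near: h; apply: dnbhs0_lt.
rewrite /= /GRing.scale /= mulr1.
have := Hd (h + t); rewrite addrK => /(_ hd) H1.
have -> : g - h^-1 * (F (h + t) - F t) = - h^-1 * (F (h + t) - F t - h * g).
  by field.
rewrite normrM normrN normfV ler_pdivrMl ?normr_gt0// mulrC.
by rewrite [leRHS]mulrC in H1 *; rewrite mulrC (le_trans _ H1) // mulrC.
Unshelve. all: by end_near. Qed.

Lemma is_derive_approxP F (t g : R) : is_derive t 1 F g ->
  forall e : R, 0 < e -> exists2 d : R, 0 < d &
    forall u, `|u - t| < d -> `|F u - F t - (u - t) * g| <= e * `|u - t|.
Proof.
move=> dF e e0.
have cv : h^-1 *: ((F \o shift t) (h *: (1 : R)) - F t) @[h --> 0^'] --> g.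
  by case: dF => dF <-; exact: dF.
move/cvgrPdist_le : cv => /(_ e e0) /nbhs_ballP[d /= d0 Hd]; exists d => //.
move=> u ud; have [->|ut] := eqVneq u t.
  by rewrite !subrr mul0r subrr !normr0 mulr0.
have ut0 : u - t != 0 by rewrite subr_eq0.
have /= := Hd (u - t); rewrite /ball /= sub0r normrN => /(_ ud ut0).
rewrite /GRing.scale /= mulr1 subrK.
have -> : F u - F t - (u - t) * g = - (u - t) * (g - (u - t)^-1 * (F u - F t)).
  by field.
by move=> H; rewrite normrM normrN mulrC; apply: ler_wpM2r.
Qed.

Lemma is_derive_cts F (t g : R) : is_derive t 1 F g -> {for t, continuous F}.
Proof.
by move=> [dF _]; apply: differentiable_continuous; exact/derivable1_diffP.
Qed.

Lemma continuous_der F G : (forall t : R, is_derive t 1 F (G t)) -> continuous F.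
Proof. by move=> dF t; exact: is_derive_cts (dF t). Qed.

(** Derivatives in time are known for positive times only; the right limit at 0 supplies the
    continuity that the mean value theorem needs when a = 0. *)
Lemma mvt_half F G (a b : R) :
  (forall t : R, 0 < t -> is_derive t 1 F (G t)) ->
  F t @[t --> 0^'+] --> F 0 -> 0 <= a -> a < b ->
  exists2 c : R, a < c < b & F b - F a = G c * (b - a).
Proof.
move=> dF F0 a0 ab.
have H x : 0 < x -> {for x, continuous F}.
  by move=> x0; exact: is_derive_cts (dF x x0).
have [||c cab E] := @MVT R F G a b ab.
- by move=> x; rewrite in_itv/= => /andP[ax _]; apply: dF; exact: le_lt_trans ax.
- apply/(continuous_within_itvP F ab); split.
  + by move=> x; rewrite in_itv/= => /andP[ax _]; apply: H; exact: le_lt_trans ax.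
  + move: a0; rewrite le_eqVlt => /predU1P[<- //|a0].
    exact: (cvg_at_right_filter (H _ a0)).
  + exact: (cvg_at_left_filter (H _ (le_lt_trans a0 ab))).
- by exists c => //; rewrite in_itv/= in cab.
Qed.

Lemma lipschitz_half F G (M : R) :
  (forall t : R, 0 < t -> is_derive t 1 F (G t)) ->
  F t @[t --> 0^'+] --> F 0 -> (forall t : R, 0 < t -> `|G t| <= M) ->
  forall s t : R, 0 <= s -> 0 <= t -> `|F t - F s| <= M * `|t - s|.
Proof.
move=> dF F0 GM.
have K a b : 0 <= a -> a < b -> `|F b - F a| <= M * `|b - a|.
  move=> a0 ab; have [c /andP[ac _] ->] := mvt_half dF F0 a0 ab.
  by rewrite normrM ler_wpM2r// GM// (le_lt_trans a0 ac).
move=> s t s0 t0; have [st|ts|->] := ltgtP s t.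
- exact: K.
- by rewrite distrC [`|t - s|]distrC; exact: K.
- by rewrite !subrr normr0 mulr0.
Qed.

Lemma gronwall F G (C : R) :
  (forall t : R, 0 < t -> is_derive t 1 F (G t)) ->
  F t @[t --> 0^'+] --> F 0 -> (forall t : R, 0 < t -> G t <= C * F t) ->
  forall t : R, 0 <= t -> F t <= expR (C * t) * F 0.
Proof.
move=> dF F0 GC t; rewrite le_eqVlt => /predU1P[<-|t0].
  by rewrite mulr0 expR0 mul1r.
(* The mean value theorem for [H], whose derivative is nonpositive, stands in for integration, as
   [G] is only a pointwise derivative. The sign of [C] is free, which [mean_zero] and [energy_eq]
   use. *)
pose H (u : R) := expR (- C * u) * F u.
have dH (u : R) : 0 < u -> is_derive u 1 H (expR (- C * u) * (G u - C * F u)).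
  move=> u0; have du := dF u u0.
  have d1 : is_derive u 1 (fun u => expR (- C * u)) (expR (- C * u) * - C).
    apply: (@is_derive1_comp _ expR (fun u => - C * u)).
    have -> : (fun u => - C * u) = ((- C) \*: (@id R)) by apply/funext.
    apply: is_derive_eq; by rewrite /GRing.scale /= mulr1.
  have := is_deriveM d1 du => d2; apply: (is_derive_eq d2).
  rewrite /GRing.scale /=; ring.
have H0 : H u @[u --> 0^'+] --> H 0.
  apply: cvgM => //; apply: cvg_at_right_filter.
  apply: continuous_comp; last exact: continuous_expR.
  exact: mulrl_continuous.
have [c /andP[c0 _] E] := mvt_half dH H0 (lexx 0) t0.
have : H t <= H 0.
  rewrite -subr_le0 E subr0 mulr_le0_ge0 ?(ltW t0)//.
  by rewrite mulr_ge0_le0 ?expR_ge0// subr_le0 GC.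
rewrite /H mulr0 expR0 mul1r => Hle.
have -> : F t = expR (C * t) * (expR (- C * t) * F t).
  by rewrite mulrA -expRD mulNr subrr expR0 mul1r.
by apply: ler_wpM2l => //; exact: expR_ge0.
Qed.

(** Giving the intermediate point by a ratio in [0, 1] covers both orders of a and b, and their
    equality, at once. *)
Lemma mvt_th F G (a b : R) : (forall x : R, is_derive x 1 F (G x)) ->
  exists2 th : R, 0 <= th <= 1 & F b - F a = G (a + th * (b - a)) * (b - a).
Proof.
move=> dF; have cF := continuous_der dF.
have K x y : x < y -> exists2 th : R, 0 <= th <= 1 &
    F y - F x = G (x + th * (y - x)) * (y - x).
  move=> xy; have [|c cxy ->] := @MVT R F G x y xy (fun z _ => dF z).
    exact: continuous_subspaceT.
  move: cxy; rewrite in_itv/= => /andP[xc cy].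
  have yx : 0 < y - x by rewrite subr_gt0.
  exists ((c - x) / (y - x)).
    rewrite divr_ge0 ?(ltW yx) ?subr_ge0 ?(ltW xc)//=.
    by rewrite ler_pdivrMr// mul1r lerB// ltW.
  by rewrite divfK ?gt_eqF// [x + _]addrC subrK.
have [ab|ba|->] := ltgtP a b.
- exact: K.
- have [th /andP[th0 th1] E] := K _ _ ba; exists (1 - th).
    by rewrite subr_ge0 th1 lerBlDr lerDl.
  rewrite -opprB E -mulrN opprB; congr (G _ * _); ring.
- by exists 0; rewrite ?lexx ?ler01// !subrr mulr0.
Qed.

(* The limit of the derivatives need not be continuous. *)
Lemma is_derive_unif_lim (F_ G_ : nat -> R -> R) F G (t r : R) : 0 < r ->
  (forall n (u : R), `|u - t| < r -> is_derive u 1 (F_ n) (G_ n u)) ->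
  (forall u : R, `|u - t| < r -> F_ ^~ u @ \oo --> F u) ->
  (forall e : R, 0 < e -> exists N, forall n (u : R), (N <= n)%N -> `|u - t| < r ->
     `|G_ n u - G u| <= e) ->
  is_derive t 1 F (G t).
Proof.
move=> r0 dF FF GG; apply: is_derive_approx => e e0.
have e4 : 0 < e / 4 by rewrite divr_gt0.
have [N HN] := GG _ e4.
have tt : `|t - t| < r by rewrite subrr normr0.
have [d d0 Hd] := is_derive_approxP (dF N t tt) e4.
exists (Num.min d r); first by rewrite lt_min d0.
move=> u; rewrite lt_min => /andP[ud ur].
(* Both [G_ n] and [G_ N] are within e / 4 of [G], so the derivative of [F_ n - F_ N] is at most e /
   2; the mean value theorem bounds its increments. *)
have Hn n : (N <= n)%N -> `|(F_ n u - F_ n t) - (F_ N u - F_ N t)| <=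
    (e / 2) * `|u - t|.
  move=> Nn.
  have K a b : a < b -> `|a - t| < r -> `|b - t| < r ->
    `|(F_ n b - F_ n a) - (F_ N b - F_ N a)| <= (e / 2) * `|b - a|.
    move=> ab ar br.
    have inr x : a <= x <= b -> `|x - t| < r.
      move=> /andP[ax xb]; move: ar br; rewrite !ltr_norml => /andP[? ?] /andP[? ?].
      by apply/andP; split; lra.
    have dd x : a <= x <= b -> is_derive x 1 (F_ n - F_ N) (G_ n x - G_ N x).
      by move=> xab; apply: is_deriveB; apply: dF; exact: inr.
    have [||c cab E] := @MVT R (F_ n - F_ N) (fun x => G_ n x - G_ N x) a b ab.
    - by move=> x; rewrite in_itv/= => /andP[? ?]; apply: dd; rewrite !ltW.
    - apply: continuous_in_subspaceT => x; rewrite inE/= in_itv/= => xab.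
      exact: is_derive_cts (dd x xab).
    - have -> : (F_ n b - F_ n a) - (F_ N b - F_ N a) =
        (F_ n - F_ N) b - (F_ n - F_ N) a by rewrite !fctE; ring.
      rewrite E normrM ler_wpM2r//.
      move: cab; rewrite in_itv/= => /andP[ac cb].
      have cr : `|c - t| < r by apply: inr; rewrite !ltW.
      have := HN n c Nn cr; have := HN N c (leqnn _) cr.
      rewrite !ler_norml => /andP[? ?] /andP[? ?]; apply/andP; split; lra.
  have [ut|tu|->] := ltgtP u t.
  - have := K u t ut ur tt; rewrite distrC [`|t - u|]distrC.
    by rewrite !opprB => H; apply: le_trans H; rewrite le_eqVlt; apply/orP; left;
      apply/eqP; congr `| _ |; ring.
  - exact: K.
  - by rewrite !subrr normr0 mulr0.
have Hlim : `|(F u - F t) - (F_ N u - F_ N t)| <= (e / 2) * `|u - t|.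
  apply: (cvg_norm_le (u := fun n => (F_ n u - F_ n t) - (F_ N u - F_ N t))).
    by apply: cvgB; [apply: cvgB; apply: FF|exact: cvg_cst].
  by exists N.
have H1 := Hd u ud.
have H2 : `|(u - t) * (G_ N t - G t)| <= e / 4 * `|u - t|.
  by rewrite normrM mulrC ler_wpM2r// HN.
have -> : F u - F t - (u - t) * G t = ((F u - F t) - (F_ N u - F_ N t)) +
  (F_ N u - F_ N t - (u - t) * G_ N t) + (u - t) * (G_ N t - G t) by ring.
apply: (le_trans (ler_normD _ _)).
apply: (le_trans (lerD (ler_normD _ _) (lexx _))).
apply: (le_trans (lerD (lerD Hlim H1) H2)).
by rewrite -!mulrDl ler_wpM2r//; lra.
Qed.

End Calculus.

(** * The Boltzmann equation against bounded Borel functions *)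

Section Sigmoid.
Context {R : realType}.

Definition sigmoid (x : R) : R := (1 + expR x)^-1.

(** [sigmoid] solves the autonomous equation s' = s^2 - s, so these functions are closed under
    differentiation; being bounded, they have all derivatives bounded. *)
Definition sigpoly (Q : {poly R}) (a b : R) (v : R) : R := Q.[sigmoid (a * v + b)].

Lemma sigmoid_itv (x : R) : 0 <= sigmoid x <= 1.
Proof.
have e0 := expR_gt0 x; rewrite /sigmoid invr_ge0 addr_ge0 ?(ltW e0)//=.
by rewrite invf_le1 ?addr_gt0// lerDl ltW.
Qed.

Lemma is_derive_sigmoid (x : R) :
  is_derive x 1 sigmoid (sigmoid x ^+ 2 - sigmoid x).
Proof.
have e0 : 1 + expR x != 0 by rewrite gt_eqF// addr_gt0// expR_gt0.
have d1 : is_derive x 1 (cst (1 : R) + expR) (expR x).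
  by apply: is_derive_eq; rewrite add0r.
have d2 := @is_deriveV R (cst (1 : R) + expR) x _ 1 e0 d1.
apply: (is_derive_eq d2); rewrite /sigmoid /GRing.scale /= fctE /=.
by field.
Qed.

Lemma is_derive_affine (a b v : R) : is_derive v 1 (fun v : R => a * v + b) a.
Proof.
have -> : (fun v : R => a * v + b) = (a \*: (@id R)) + cst b by apply/funext.
by apply: is_derive_eq; rewrite addr0 /GRing.scale /= mulr1.
Qed.

Lemma is_derive_sigpoly Q a b (v : R) : is_derive v 1 (sigpoly Q a b)
  (sigpoly (a *: (Q^`() * ('X ^+ 2 - 'X))) a b v).
Proof.
have d1 := is_derive_affine a b v.
have d2 := @is_derive1_comp R sigmoid _ v _ _ (is_derive_sigmoid (a * v + b)) d1.
have d3 := @is_derive1_comp R (horner Q) _ v _ _ (is_derive_poly Q _) d2.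
apply: (is_derive_eq d3) => /=.
rewrite /sigpoly hornerZ hornerM hornerD hornerN hornerXn hornerX; ring.
Qed.

Lemma derive1_eq (F G : R -> R) : (forall x : R, is_derive x 1 F (G x)) ->
  derive1 F = G.
Proof.
move=> dF; apply/funext => x; rewrite derive1E; have dx := dF x.
exact: derive_val.
Qed.

Lemma derive1n_sigpoly n Q a b :
  exists Q', derive1n n (sigpoly Q a b) = sigpoly Q' a b.
Proof.
elim: n => [|n [Q' IH]]; first by exists Q.
exists (a *: (Q'^`() * ('X ^+ 2 - 'X))).
by rewrite derive1nS IH; apply: derive1_eq => x; exact: is_derive_sigpoly.
Qed.

Lemma sigpoly_bounded Q a b : exists M : R, forall v, `|sigpoly Q a b v| <= M.
Proof.
exists (\sum_(i < size Q) `|Q`_i|) => v; rewrite /sigpoly horner_coef.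
apply: (le_trans (ler_norm_sum _ _ _)); apply: ler_sum => i _.
have /andP[s0 s1] := sigmoid_itv (a * v + b).
by rewrite normrM ler_piMr// normrX exprn_ile1// ger0_norm.
Qed.

Lemma test_function_sigpoly Q a b : test_function (sigpoly Q a b).
Proof.
move=> n; have [Q' ->] := derive1n_sigpoly n Q a b; split.
- by move=> v; have := is_derive_sigpoly Q' a b v => -[].
- exact: sigpoly_bounded.
Qed.

(** The argument is k^2 (v - x) + k. The quadratic term decides the limit for v different from x,
    and the shift k sends the value at v = x to 0, which gives the open ray. *)
Lemma sigmoid_cvg_ray (x v : R) :
  sigmoid (k%:R ^+ 2 * v + (k%:R - k%:R ^+ 2 * x)) @[k --> \oo] -->
    (\1_(`]-oo, x[%classic : set R) v : R).
Proof.
have cvgS : (k.+1%:R^-1 : R) @[k --> \oo] --> (0 : R) by exact: cvg_harmonic.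
rewrite indicE mem_setE in_itv/=; have [vx|xv] := ltP v x.
- apply/cvgrPdist_le => e e0.
  have vx0 : 0 < x - v by rewrite subr_gt0.
  have H : \forall k \near \oo, 2 <= k%:R * (x - v).
    near=> k; rewrite -ler_pdivrMr//; near: k; exact: nbhs_infty_ger.
  near=> k.
  have k2 : 2 <= k%:R * (x - v) by near: k.
  have ke : k.+1%:R^-1 <= e.
    near: k; have := cvgr_norm_le _ cvgS; rewrite normr0 => /(_ _ e e0).
    by apply: filterS => k; rewrite ger0_norm ?invr_ge0.
  set y := (X in sigmoid X).
  have yk : y <= - k%:R.
    have -> : y = - k%:R - k%:R * (k%:R * (x - v) - 2) by rewrite /y; ring.
    by rewrite gerBl mulr_ge0// subr_ge0.
  have ey : expR y <= k.+1%:R^-1.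
    apply: (@le_trans _ _ (expR (- k%:R))); first by rewrite ler_expR.
    rewrite expRN lef_pV2 ?posrE ?expR_gt0//.
    by apply: le_trans (expR_ge1Dx _); rewrite -natr1 addrC.
  have e1 := expR_gt0 y.
  have -> : 1%:R - sigmoid y = expR y * sigmoid y.
    by rewrite /sigmoid; field; rewrite gt_eqF// addr_gt0.
  have /andP[s0 s1] := sigmoid_itv y.
  rewrite ger0_norm ?mulr_ge0 ?(ltW e1)//.
  by apply: le_trans ke; apply: le_trans ey; rewrite ler_piMr// ltW.
- apply/cvgrPdist_le => e e0; near=> k.
  have ke : k.+1%:R^-1 <= e.
    near: k; have := cvgr_norm_le _ cvgS; rewrite normr0 => /(_ _ e e0).
    by apply: filterS => k; rewrite ger0_norm ?invr_ge0.
  set y := (X in sigmoid X).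
  have yk : k%:R <= y.
    have -> : y = k%:R + k%:R ^+ 2 * (v - x) by rewrite /y; ring.
    by rewrite lerDl mulr_ge0// subr_ge0.
  have /andP[s0 s1] := sigmoid_itv y.
  rewrite sub0r normrN ger0_norm//; apply: le_trans ke.
  rewrite /sigmoid lef_pV2 ?posrE ?addr_gt0 ?expR_gt0//.
  apply: (@le_trans _ _ (1 + y)); first by rewrite -natr1 addrC lerD2l.
  by apply: (le_trans (expR_ge1Dx _)); rewrite lerDr.
Unshelve. all: by end_near. Qed.

End Sigmoid.

(** * Borel functions on the line and the gain term *)

Section BorelFun.
Context {R : realType}.
Local Notation RM := (measurableTypeR R).

Definition mR (phi : R -> R) : Prop := measurable_fun (setT : set RM) (phi : RM -> R).

Lemma mR_affine (phi : R -> R) (a b : R) : mR phi -> mR (fun v => phi (a * v + b)).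
Proof.
move=> mphi; apply: (@measurableT_comp _ _ _ RM RM R phi setT (fun v : RM => a * v + b) mphi).
apply: measurable_funD; last exact: measurable_cst.
exact: mulrl_measurable.
Qed.

Lemma mR_affineC (phi : R -> R) (a b : R) : mR phi -> mR (fun v => phi (b + a * v)).
Proof.
move=> mphi; have -> : (fun v => phi (b + a * v)) = (fun v => phi (a * v + b)).
  by apply/funext => v; rewrite addrC.
exact: mR_affine.
Qed.

Lemma mR_continuous (phi : R -> R) : continuous phi -> mR phi.
Proof. exact: continuous_measurable_fun. Qed.

Lemma measurable_mix (phi : R -> R) (p q : R) : mR phi ->
  measurable_fun (setT : set (RM * RM)) (fun z : RM * RM => phi (p * z.1 + q * z.2)).
Proof.
move=> mphi; apply: (@measurableT_comp _ _ _ _ RM R phi setT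
  (fun z : RM * RM => p * z.1 + q * z.2) mphi).
by apply: measurable_funD; apply: measurable_funM => //; exact: measurable_cst.
Qed.

Lemma measurable_fst (phi : R -> R) : mR phi ->
  measurable_fun (setT : set (RM * RM)) (fun z : RM * RM => phi z.1).
Proof. by move=> mphi; exact: (@measurableT_comp _ _ _ _ RM R phi setT fst mphi). Qed.

Definition gain (p q : R) (mu : borelProb R) (phi : R -> R) : R :=
  \int[(mu \x mu)%E]_z (phi (p * z.1 + q * z.2) - phi z.1).

Lemma gain_le (p q : R) (mu : borelProb R) (phi : R -> R) (M : R) :
  mR phi -> (forall v, `|phi v| <= M) -> `|gain p q mu phi| <= 2 * M.
Proof.
move=> mphi phiM; apply: (@exp_bounded _ _ _ (mu \x mu)%E _ _).
  apply: measurable_funB; [exact: measurable_mix|exact: measurable_fst].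
by move=> z; apply: (le_trans (ler_normB _ _)); have := phiM z.1;
  have := phiM (p * z.1 + q * z.2); lra.
Qed.

End BorelFun.

Section Boltzmann.
Context {R : realType} (p q : R) (f0 : borelProb R) (f : R -> borelProb R).
Local Notation RM := (measurableTypeR R).

(** The initial condition is split in two: continuity at 0 along [f], which the calculus lemmas take
    in the form [F 0], and agreement of [f 0] with [f0]. *)
Definition boltz (phi : R -> R) : Prop :=
  [/\ forall t : R, 0 < t ->
        is_derive t 1 (fun u : R => \int[f u]_v phi v) (gain p q (f t) phi),
      \int[f t]_v phi v @[t --> 0^'+] --> \int[f 0]_v phi v &
      \int[f 0]_v phi v = \int[f0]_v phi v].

(* Stability under affine changes of variable is what lets the Lipschitz bound
   in time be applied under the collision integral. *)
Definition solves (phi : R -> R) : Prop :=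
  [/\ mR phi, exists M : R, forall v, `|phi v| <= M &
      forall a b, boltz (fun v => phi (a * v + b))].

Lemma solves_boltz phi : solves phi -> boltz phi.
Proof.
move=> [_ _ H]; have := H 1 0.
by have -> : (fun v => phi (1 * v + 0)) = phi
  by apply/funext => v; rewrite mul1r addr0.
Qed.

Lemma solves_affine phi a b : solves phi -> solves (fun v => phi (a * v + b)).
Proof.
move=> [m [M HM] H]; split; [exact: mR_affine|by exists M|move=> c d].
have -> : (fun v => phi (a * (c * v + d) + b)) =
    (fun v => phi ((a * c) * v + (a * d + b))).
  by apply/funext => v; congr phi; ring.
exact: H.
Qed.

Lemma solves_lip phi (M s t : R) : solves phi -> (forall v, `|phi v| <= M) ->
  0 <= s -> 0 <= t ->
  `|\int[f t]_v phi v - \int[f s]_v phi v| <= 2 * M * `|t - s|.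
Proof.
move=> sphi phiM s0 t0; have [d c _] := solves_boltz sphi.
apply: (lipschitz_half d c) => // u u0.
by apply: gain_le => //; case: sphi.
Qed.

(** The gain is quadratic in the measure, so one factor is moved at a time. With the other velocity
    frozen, the integrand is an affine change of variable of phi and [solves_lip] applies. The 6 is
    2 for each factor and 2 for the loss term. *)
Lemma gain_lip phi (M s t : R) : solves phi -> (forall v, `|phi v| <= M) ->
  0 <= s -> 0 <= t ->
  `|gain p q (f t) phi - gain p q (f s) phi| <= 6 * M * `|t - s|.
Proof.
move=> sphi phiM s0 t0; have [mphi _ _] := sphi.
pose K (a b : R) := \int[(f a \x f b)%E]_z phi (p * z.1 + q * z.2).
have mK : measurable_fun setT (fun z : RM * RM => phi (p * z.1 + q * z.2)).
  exact: measurable_mix.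
have iK a b : intg (f a \x f b)%E (fun z : RM * RM => phi (p * z.1 + q * z.2)).
  by apply: (intg_bounded M).
have iphi a : intg (f a) phi by apply: (intg_bounded M).
have i1 a w : intg (f a) (fun v : RM => phi (p * v + q * w)).
  by apply: (intg_bounded M) => //; exact: mR_affine.
have i2 a v : intg (f a) (fun w : RM => phi (p * v + q * w)).
  apply: (intg_bounded M) => //.
  exact: mR_affineC.
have gE a : gain p q (f a) phi = K a a - \int[f a]_v phi v.
  rewrite /gain expB; [|exact: iK|exact: intg_fst].
  by rewrite exp_fst.
have KE a b : K a b = \int[f b]_w \int[f a]_v phi (p * v + q * w).
  by rewrite /K exp_fubini2; [|exact: iK|move=> w; exact: i1].
have KE' a b : K a b = \int[f a]_v \int[f b]_w phi (p * v + q * w).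
  by rewrite /K exp_fubini; [|exact: iK|move=> v; exact: i2].
have iK1 a b : intg (f b) (fun w : RM => \int[f a]_v phi (p * v + q * w)).
  apply: (intg_bounded M).
    by have := measurable_exp2 (iK a b); apply => w; exact: i1.
  by move=> w; apply: exp_bounded => //; exact: mR_affine.
have iK2 a b : intg (f a) (fun v : RM => \int[f b]_w phi (p * v + q * w)).
  apply: (intg_bounded M).
    by have := measurable_exp1 (iK a b); apply => v; exact: i2.
  move=> v; apply: exp_bounded => //.
  exact: mR_affineC.
have H1 : `|K t t - K s t| <= 2 * M * `|t - s|.
  rewrite !KE -expB//; apply: exp_bounded.
    by apply: (intg_measurable (P := f t)); apply: intgB.
  by move=> w; apply: (solves_lip (phi := fun v => phi (p * v + q * w))) => //;
    exact: solves_affine.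
have H2 : `|K s t - K s s| <= 2 * M * `|t - s|.
  rewrite !KE' -expB//; apply: exp_bounded.
    by apply: (intg_measurable (P := f s)); apply: intgB.
  move=> v; have E a : \int[f a]_w phi (p * v + q * w) =
      \int[f a]_w phi (q * w + p * v).
    by apply: eq_Rintegral => w _; rewrite addrC.
  rewrite !E.
  apply: (solves_lip (phi := fun w => phi (q * w + p * v))) => //.
  exact: solves_affine.
have H3 := solves_lip sphi phiM s0 t0.
rewrite !gE; have -> : K t t - \int[f t]_v phi v - (K s s - \int[f s]_v phi v) =
  (K t t - K s t) + (K s t - K s s) - (\int[f t]_v phi v - \int[f s]_v phi v) by ring.
apply: (le_trans (ler_normB _ _)).
apply: (le_trans (lerD (ler_normD _ _) (lexx _))).
apply: (le_trans (lerD (lerD H1 H2) H3)); rewrite -!mulrDl ler_wpM2r//.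
have := phiM 0; have := normr_ge0 (phi 0); lra.
Qed.

(** A Lipschitz gain makes the first order expansion in time accurate to second order, with a
    constant that depends on phi only through its bound [M]. No derivative appears, so the
    inequality passes to bounded pointwise limits. *)
Lemma solves_quad phi (M s t : R) : solves phi -> (forall v, `|phi v| <= M) ->
  0 < s -> 0 < t ->
  `|\int[f t]_v phi v - \int[f s]_v phi v - (t - s) * gain p q (f s) phi|
    <= 6 * M * `|t - s| ^+ 2.
Proof.
move=> sphi phiM s0 t0; have [d c _] := solves_boltz sphi.
pose D (u : R) := \int[f u]_v phi v - (u - s) * gain p q (f s) phi.
have M0 : 0 <= M by rewrite (le_trans (normr_ge0 (phi 0))).
have dD (u : R) : 0 < u -> is_derive u 1 D (gain p q (f u) phi - gain p q (f s) phi).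
  move=> u0; have du := d u u0.
  have := is_derive_affine (gain p q (f s) phi) (- s * gain p q (f s) phi) u.
  move=> da; have := is_deriveB du da.
  set D' := (X in is_derive _ _ X _ -> _); have -> // : D' = D.
  apply/funext => x; rewrite /D; set g := gain _ _ _ _.
  transitivity (\int[f x]_v phi v - (g * x + - s * g)); [by []|ring].
have K a b : a < b -> 0 < a -> 0 < b ->
    (forall u, a < u < b -> `|u - s| <= `|t - s|) ->
    `|D b - D a| <= 6 * M * `|t - s| * `|b - a|.
  move=> ab a0 b0 abs.
  have [||c' cab ->] := @MVT R D (fun u => gain p q (f u) phi - gain p q (f s) phi) _ _ ab.
  - move=> x; rewrite in_itv/= => /andP[ax _]; apply: dD; exact: lt_trans ax.
  - apply: continuous_in_subspaceT => x; rewrite inE/= in_itv/= => /andP[ax _].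
    exact: is_derive_cts (dD x (lt_le_trans a0 ax)).
  - rewrite normrM ler_wpM2r//; move: cab; rewrite in_itv/= => cab.
    apply: (le_trans (gain_lip sphi phiM (ltW s0) _)).
      by case/andP : cab => ac _; rewrite ltW// (lt_trans a0 ac).
    by rewrite ler_wpM2l ?mulr_ge0//; exact: abs.
have E : \int[f t]_v phi v - \int[f s]_v phi v - (t - s) * gain p q (f s) phi = D t - D s.
  rewrite /D; ring.
rewrite E expr2 mulrA; have [st|ts|->] := ltgtP s t.
- apply: K => // u /andP[su ut].
  by rewrite !ger0_norm ?subr_ge0 ?(ltW su) ?(ltW st)// lerB// ltW.
- rewrite distrC [X in _ * X]distrC; apply: K => // u /andP[su ut].
  rewrite distrC [leRHS]distrC !ger0_norm ?subr_ge0 ?(ltW ut) ?(ltW ts)//.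
  by rewrite lerB// ltW.
- by rewrite !subrr normr0 mulr0.
Qed.

(** Dominated convergence carries over the bounds [solves_quad] and [solves_lip], which depend on
    [M] alone; the first gives back the derivative of the limit, the second its continuity at 0. *)
Lemma solves_lim (phi_ : nat -> R -> R) phi (M : R) :
  (forall n, solves (phi_ n)) -> (forall n v, `|phi_ n v| <= M) ->
  (forall v, phi_ ^~ v @ \oo --> phi v) -> solves phi.
Proof.
move=> sphi phiM phil.
have phiM' v : `|phi v| <= M.
  by apply: cvg_norm_le (phil v) _; exists 0%N => n _; exact: phiM.
have mphi : mR phi.
  apply: (measurable_fun_cvg (h := phi_)); first by move=> n; case: (sphi n).
  by move=> x _; exact: phil.
split => //; first by exists M.
move=> a b; set ps := fun v => _; pose ps_ n := fun v => phi_ n (a * v + b).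
have sps n : solves (ps_ n) by exact: solves_affine.
have psM n v : `|ps_ n v| <= M by exact: phiM.
have psl v : ps_ ^~ v @ \oo --> ps v by exact: phil.
have mps : mR ps by exact: mR_affine.
have mps_ n : mR (ps_ n) by case: (sps n).
have El (mu : borelProb R) : \int[mu]_v ps_ n v @[n --> \oo] --> \int[mu]_v ps v.
  by have [] := exp_dominated (P := mu) (f_ := ps_) (f := ps) (g := fun=> M) mps_
    (intg_cst _ _) psM psl.
have Gl (mu : borelProb R) : gain p q mu (ps_ n) @[n --> \oo] --> gain p q mu ps.
  pose h n := fun z : RM * RM => ps_ n (p * z.1 + q * z.2) - ps_ n z.1.
  have [] := exp_dominated (P := (mu \x mu)%E) (f_ := h)
    (f := fun z : RM * RM => ps (p * z.1 + q * z.2) - ps z.1) (g := fun=> 2 * M).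
  - by move=> n; apply: measurable_funB; [exact: measurable_mix|exact: measurable_fst].
  - exact: intg_cst.
  - move=> n z; apply: (le_trans (ler_normB _ _)).
    by have := psM n z.1; have := psM n (p * z.1 + q * z.2); lra.
  - by move=> z; apply: cvgB; exact: psl.
  - by [].
split.
- move=> t t0; apply: is_derive_approx => e e0.
  have M0 : 0 <= M by rewrite (le_trans (normr_ge0 (phi 0))).
  exists (Num.min t (e / (6 * M + 1))).
    by rewrite lt_min t0 divr_gt0// ltr_wpDl// mulr_ge0.
  move=> u; rewrite lt_min => /andP[ut ue].
  have u0 : 0 < u by move: ut; rewrite ltr_norml => /andP[? _]; lra.
  apply: (@le_trans _ _ (6 * M * `|u - t| ^+ 2)).
    apply: (cvg_norm_le (u := fun n => \int[f u]_v ps_ n v - \int[f t]_v ps_ n v -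
      (u - t) * gain p q (f t) (ps_ n))).
      apply: cvgB; first by apply: cvgB; exact: El.
      by apply: cvgMr; exact: Gl.
    by exists 0%N => n _; exact: solves_quad.
  rewrite expr2 mulrA ler_wpM2r//.
  move: ue; rewrite ltr_pdivlMr ?ltr_wpDl ?mulr_ge0// => ue.
  by apply: le_trans (ltW ue); rewrite mulrC ler_wpM2l// lerDl.
- have L (t : R) : 0 <= t ->
    `|\int[f t]_v ps v - \int[f 0]_v ps v| <= 2 * M * `|t|.
    move=> t0; apply: (cvg_norm_le (u := fun n => \int[f t]_v ps_ n v - \int[f 0]_v ps_ n v)).
      by apply: cvgB; exact: El.
    by exists 0%N => n _; rewrite -[t in leRHS]subr0; exact: solves_lip.
  apply/cvgrPdist_le => e e0.
  have M0 : 0 <= M by rewrite (le_trans (normr_ge0 (phi 0))).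
  near=> t.
  have t0 : 0 < t by [].
  rewrite distrC; apply: (le_trans (L _ (ltW t0))).
  rewrite gtr0_norm//; apply: (@le_trans _ _ ((2 * M + 1) * t)).
    by rewrite ler_wpM2r ?(ltW t0)// lerDl.
  rewrite mulrC -ler_pdivlMr ?ltr_wpDl ?mulr_ge0//.
  by near: t; apply: nbhs_right_le; rewrite divr_gt0// ltr_wpDl// mulr_ge0.
- apply: (cvg_unique _ (El (f 0))) => //.
  have -> : (fun n => \int[f 0]_v ps_ n v) = (fun n => \int[f0]_v ps_ n v).
    by apply/funext => n; have [_ _ ->] := solves_boltz (sps n).
  exact: El.
Unshelve. all: by end_near. Qed.

Lemma solves_lin (c : R) phi psi : solves phi -> solves psi ->
  solves (fun v => c * phi v + psi v).
Proof.
move=> [m1 [M1 b1] H1] [m2 [M2 b2] H2]; split.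
- by apply: measurable_funD => //; apply: measurable_funM => //; exact: measurable_cst.
- exists (`|c| * M1 + M2) => v; apply: (le_trans (ler_normD _ _)).
  by rewrite lerD// normrM ler_wpM2l.
move=> a b.
pose f1 v := phi (a * v + b); pose f2 v := psi (a * v + b).
have mf1 : mR f1 by exact: mR_affine.
have mf2 : mR f2 by exact: mR_affine.
have i1 (mu : borelProb R) : intg mu f1.
  by apply: (intg_bounded M1) => // v; exact: b1.
have i2 (mu : borelProb R) : intg mu f2.
  by apply: (intg_bounded M2) => // v; exact: b2.
have E (mu : borelProb R) : \int[mu]_v (c * f1 v + f2 v) =
    c * \int[mu]_v f1 v + \int[mu]_v f2 v.
  by rewrite expD ?expZ//; exact: intgZ.
have Ge (mu : borelProb R) : gain p q mu (fun v => c * f1 v + f2 v) =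
    c * gain p q mu f1 + gain p q mu f2.
  have ig g M : mR g -> (forall v, `|g v| <= M) ->
      intg (mu \x mu)%E (fun z : RM * RM => g (p * z.1 + q * z.2) - g z.1).
    move=> mg gM; apply: (intg_bounded (2 * M)).
      by apply: measurable_funB; [exact: measurable_mix|exact: measurable_fst].
    move=> z; apply: (le_trans (ler_normB _ _)).
    by have := gM z.1; have := gM (p * z.1 + q * z.2); lra.
  rewrite /gain -expZ; last by apply: (ig _ M1) => // v; exact: b1.
  have j1 := ig _ M1 mf1 (fun v => b1 (a * v + b)).
  have j2 := ig _ M2 mf2 (fun v => b2 (a * v + b)).
  rewrite -expD; [|exact: intgZ|exact: j2].
  by apply: eq_Rintegral => z _; ring.
have [d1 c1 e1] := H1 a b; have [d2 c2 e2] := H2 a b; split.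
- move=> t t0; have D1 := d1 t t0; have D2 := d2 t t0.
  rewrite Ge; have := is_deriveD (is_deriveZ c D1) D2.
  by under [X in _ -> is_derive _ _ X _]eq_fun do rewrite E.
- rewrite E; under eq_fun do rewrite E.
  by apply: cvgD => //; apply: cvgMr.
- by rewrite !E -/f1 -/f2 e1 e2.
Qed.

End Boltzmann.

(** * Probability measures are determined by smooth bounded tests *)

Section Determination.
Context {R : realType}.
Local Notation RM := (measurableTypeR R).

Lemma ray_setI : setI_closed (@RGenInftyO.G R).
Proof.
move=> _ _ [x ->] [y ->]; exists (Num.min x y).
apply/seteqP; split => z /=; rewrite !in_itv/= lt_min.
- by move=> [-> ->].
- by move=> /andP[].
Qed.

(** Sigmoids converge boundedly to indicators of open rays, a generating class stable under
    intersection. The two measures thus coincide, and so do the integrals of any phi whatsoever. *)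
Lemma test_function_unique (mu nu : borelProb R) :
  (forall phi, test_function phi -> \int[mu]_v phi v = \int[nu]_v phi v) ->
  forall phi : R -> R, \int[mu]_v phi v = \int[nu]_v phi v.
Proof.
move=> H phi.
have eR x : mu (`]-oo, x[%classic : set R) = nu (`]-oo, x[%classic : set R).
  pose s k := sigpoly ('X : {poly R}) (k%:R ^+ 2) (k%:R - k%:R ^+ 2 * x).
  have lim (la : borelProb R) : \int[la]_v s k v @[k --> \oo] -->
      \int[la]_v (\1_(`]-oo, x[%classic : set R) v : R).
    have [] := exp_dominated (P := la) (f_ := s)
      (f := fun v => \1_(`]-oo, x[%classic : set R) v : R) (g := fun=> 1).
    - move=> k; apply: mR_continuous.
      exact: continuous_der (is_derive_sigpoly _ _ _).
    - exact: intg_cst.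
    - move=> k v; rewrite /s /sigpoly hornerX.
      by have /andP[s0 s1] := sigmoid_itv (k%:R ^+ 2 * v + (k%:R - k%:R ^+ 2 * x));
        rewrite ger0_norm.
    - by move=> v; rewrite /s /sigpoly; under eq_fun do rewrite hornerX;
        exact: sigmoid_cvg_ray.
    - by [].
  have E (la : borelProb R) : \int[la]_v (\1_(`]-oo, x[%classic : set R) v : R) =
      fine (la `]-oo, x[%classic).
    by rewrite /Rintegral integral_indic// setIT.
  have : \int[mu]_v (\1_(`]-oo, x[%classic : set R) v : R) =
      \int[nu]_v (\1_(`]-oo, x[%classic : set R) v : R).
    apply: (cvg_unique _ (lim mu)) => //.
    have -> : (fun k => \int[mu]_v s k v) = (fun k => \int[nu]_v s k v).
      by apply/funext => k; apply: H; exact: test_function_sigpoly.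
    exact: lim.
  rewrite !E => Ef.
  by rewrite -[LHS]fineK ?fin_num_measure// -[RHS]fineK ?fin_num_measure// Ef.
congr fine; apply: eq_measure_integral => A mA _.
apply: (@measure_unique _ R RM (@RGenInftyO.G R) (fun n => `]-oo, n%:R[%classic)).
- exact: RGenInftyO.measurableE.
- exact: ray_setI.
- by move=> n; exists n%:R.
- apply/seteqP; split => // x _; exists (Num.truncn `|x|).+1 => //=.
  rewrite in_itv/=; apply: (le_lt_trans (ler_norm x)); exact: truncnS_gt.
- by move=> _ [x ->]; exact: eR.
- by move=> k; rewrite -ge0_fin_numE// fin_num_measure.
- exact: mA.
Qed.

End Determination.

Import HBNNSimple.

(** * Extension of the equation to bounded Borel functions *)

Section AllBounded.
Context {R : realType} (p q : R) (f0 : borelProb R) (f : R -> borelProb R).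
Local Notation RM := (measurableTypeR R).
Local Notation solves := (solves p q f0 f).

(** The one-sided derivative at 0 in [C1_halfline] yields continuity there: the difference quotient
    times u tends to 0. Uniqueness of limits then identifies the integrals against [f 0] and
    [f0]. *)
Lemma boltz_test (al : R) phi : boltzmann_weak_solution p q al f0 f ->
  test_function phi -> boltz p q f0 f phi.
Proof.
move=> [_ C1 dB init] tphi; have c0 := init _ tphi.
have d (t : R) : 0 < t ->
  is_derive t 1 (fun u : R => \int[f u]_v phi v) (gain p q (f t) phi) := dB _ tphi t.
suff F0 : \int[f t]_v phi v @[t --> 0^'+] --> \int[f 0]_v phi v.
  split => //; exact: (cvg_unique _ F0 c0).
have [dF [_ /(_ 0 (lexx _))]] := C1 _ tphi.
set F := fun t => \int[f t]_v phi v; move=> H.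
have H' : (F u - F 0) / (u - 0) @[u --> 0^'+] --> dF 0.
  apply: cvg_trans H; apply: cvg_app => A HA.
  have HA' : \forall u \near nbhs (0 : R), u != 0 -> `[0, +oo[%classic u -> A u := HA.
  have : \forall u \near nbhs (0 : R), 0 < u -> A u; last by [].
  apply: filterS HA' => u uA u0; apply: uA; first by rewrite gt_eqF.
  by rewrite /= in_itv/= ltW.
have : (F u - F 0) / (u - 0) * u @[u --> 0^'+] --> dF 0 * 0.
  apply: cvgM H' _; apply: cvg_at_right_filter; exact: cvg_id.
rewrite mulr0 => H0.
have H1 : F u - F 0 @[u --> 0^'+] --> (0 : R).
  apply: cvg_trans H0; apply: near_eq_cvg; near=> u.
  by rewrite subr0 divfK// gt_eqF.
have H2 : F u - F 0 + F 0 @[u --> 0^'+] --> 0 + F 0.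
  by apply: cvgD; [exact: H1|exact: cvg_cst].
rewrite add0r in H2; apply: cvg_trans H2; apply: near_eq_cvg; near=> u.
by rewrite subrK.
Unshelve. all: by end_near. Qed.

Hypothesis boltz_tests : forall phi, test_function phi -> boltz p q f0 f phi.

Lemma solves_sigpoly Q a b : solves (sigpoly Q a b).
Proof.
split.
- apply: mR_continuous; exact: continuous_der (is_derive_sigpoly _ _ _).
- exact: sigpoly_bounded.
- move=> c d; apply: boltz_tests.
  have -> : (fun v => sigpoly Q a b (c * v + d)) = sigpoly Q (a * c) (a * d + b).
    by apply/funext => v; rewrite /sigpoly; congr (_.[sigmoid _]); ring.
  exact: test_function_sigpoly.
Qed.

Lemma solves_cst (c : R) : solves (fun=> c).
Proof.
have := solves_sigpoly c%:P 0 0; congr solves.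
by apply/funext => v; rewrite /sigpoly hornerC.
Qed.

Definition ind (A : set RM) (v : RM) : R := \1_A v.

Lemma solves_indic (A : set RM) : measurable A -> solves (ind A).
Proof.
have lin (c : R) phi psi : solves phi -> solves psi ->
  solves (fun v => c * phi v + psi v) := @solves_lin _ _ _ _ _ _ _ _.
move=> mA.
apply: (@dynkin_induction _ RM (@RGenInftyO.G R) (fun A => solves (ind A))).
- exact: RGenInftyO.measurableE.
- exact: ray_setI.
- have := solves_cst 1; congr solves; apply/funext => v.
  by rewrite /ind indicE in_setT.
- move=> _ [x ->].
  apply: (@solves_lim _ _ _ _ _
    (fun k => sigpoly ('X : {poly R}) (k%:R ^+ 2) (k%:R - k%:R ^+ 2 * x)) _ 1).
  + by move=> k; exact: solves_sigpoly.
  + move=> k v; rewrite /sigpoly hornerX.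
    by have /andP[s0 s1] := sigmoid_itv (k%:R ^+ 2 * v + (k%:R - k%:R ^+ 2 * x));
      rewrite ger0_norm.
  + by move=> v; rewrite /sigpoly; under eq_fun do rewrite hornerX;
      exact: sigmoid_cvg_ray.
- move=> S mS PS; have := lin (-1) _ _ PS (solves_cst 1); congr solves.
  apply/funext => v; rewrite /ind !indicE in_setC.
  by case: (v \in S) => /=; ring.
- move=> F mF tF PF.
  pose s n : RM -> R := fun v => \sum_(k < n) ind (F k) v.
  have ss n : solves (s n).
    elim: n => [|n IH].
      have := solves_cst 0; congr solves; apply/funext => v.
      by rewrite /s big_ord0.
    have := lin 1 _ _ (PF n) IH; congr solves; apply/funext => v.
    by rewrite /s big_ord_recr /= mul1r addrC.
  (* Disjointness makes the partial sums 0 or 1 at every point; this is the uniform bound that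
     [solves_lim] asks for. *)
  have sin k0 v n : F k0 v -> s n v = (k0 < n)%N%:R.
    move=> Fv; rewrite /s; elim: n => [|n IH]; first by rewrite big_ord0.
    rewrite big_ord_recr /= IH /ind indicE.
    have -> : (v \in F n) = (n == k0).
      apply/idP/eqP => [|->]; last exact: mem_set.
      by rewrite inE => Fn; apply: (tF n k0) => //; exists v.
    rewrite (ltnS k0 n) (leq_eqVlt k0 n) (eq_sym k0 n); have [->|_] := eqVneq n k0.
      by rewrite ltnn add0r.
    by rewrite addr0.
  have sout v n : ~ (\bigcup_k F k) v -> s n v = 0.
    move=> Fv; rewrite /s big1// => k _; rewrite /ind indicE memNset// => Fk.
    by apply: Fv; exists k.
  apply: (@solves_lim _ _ _ _ _ s _ 1 ss).
  + move=> n v; have [[k _ Fk]|Fv] := pselect ((\bigcup_k F k) v).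
      by rewrite (sin k)//; case: (_ < _)%N; rewrite ?normr1 ?normr0.
    by rewrite sout// normr0.
  + move=> v; rewrite /ind indicE.
    have [[k _ Fk]|Fv] := pselect ((\bigcup_k F k) v).
      rewrite mem_set; last by exists k.
      apply: cvg_near_cst; exists k.+1 => // n /= kn.
      by rewrite (sin k)// kn.
    by rewrite memNset//; apply: cvg_near_cst; exists 0%N => // n _; exact: sout.
- exact: (eq_ind _ (fun S : set_system R => S A) mA _ (@RGenInftyO.measurableE R)).
Qed.

(** The approximating simple functions increase to phi, hence share its bound [M]. *)
Lemma solves_ge0 (phi : R -> R) (M : R) : mR phi -> (forall v, 0 <= phi v <= M) ->
  solves phi.
Proof.
move=> mphi phiM.
have mE : measurable_fun (setT : set RM) (EFin \o (phi : RM -> R)).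
  exact/measurable_EFinP.
pose s n : RM -> R := nnsfun_approx measurableT mE n.
have e0 (x : RM) : setT x -> (0 <= (EFin \o phi) x)%E.
  by move=> _; rewrite lee_fin; case/andP : (phiM x).
have ss n : solves (s n).
  have [N [c E]] : exists N (c : nat -> R), forall x,
      s n x = \sum_(i < N) (c i * ind (s n @^-1` [set c i]) x).
    by eexists; eexists => x; exact: fimfunEord.
  rewrite (funext E); elim: N {E} => [|N IH].
    have := solves_cst 0; congr solves; apply/funext => v.
    by rewrite big_ord0.
  have mc : measurable (s n @^-1` [set c N]) by exact: measurable_sfunP.
  have := solves_lin (c N) (solves_indic mc) IH; congr solves; apply/funext => v.
  by rewrite big_ord_recr /= addrC.
apply: (@solves_lim _ _ _ _ _ s _ M ss).
- move=> n v; have /andP[p0 pM] := phiM v.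
  have s0 : 0 <= s n v by exact: fun_ge0.
  rewrite ger0_norm//; apply: le_trans pM; rewrite -lee_fin.
  by rewrite /s nnsfun_approxE; exact: le_approx.
- move=> v; have /fine_cvg := cvg_nnsfun_approx measurableT mE e0 (x := v) I.
  exact.
Qed.

Lemma solves_bounded (phi : R -> R) (M : R) : mR phi ->
  (forall v, `|phi v| <= M) -> solves phi.
Proof.
move=> mphi phiM.
have H : solves (fun v => phi v + M).
  apply: (@solves_ge0 _ (2 * M)); first exact: measurable_funD.
  by move=> v; have := phiM v; rewrite ler_norml => /andP[? ?]; apply/andP; split; lra.
have := solves_lin 1 H (solves_cst (- M)); congr solves.
by apply/funext => v; ring.
Qed.

End AllBounded.

(** * Weights and growth of tails *)

Section Derivatives.
Context {R : realType}.
Implicit Types f g : R -> R.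

Lemma dMul f g (x a b : R) : is_derive x 1 f a -> is_derive x 1 g b ->
  is_derive x 1 (fun v => f v * g v) (f x * b + g x * a).
Proof. by move=> df dg; exact: (is_deriveM df dg). Qed.

Lemma dAdd f g (x a b : R) : is_derive x 1 f a -> is_derive x 1 g b ->
  is_derive x 1 (fun v => f v + g v) (a + b).
Proof. by move=> df dg; exact: (is_deriveD df dg). Qed.

Lemma dScale f (x a c : R) : is_derive x 1 f a ->
  is_derive x 1 (fun v => c * f v) (c * a).
Proof. by move=> df; exact: (is_deriveZ c df). Qed.

Lemma dInv f (x a : R) : is_derive x 1 f a -> f x != 0 ->
  is_derive x 1 (fun v => (f v)^-1) (- (f x) ^- 2 * a).
Proof. by move=> df f0; exact: (is_deriveV f0 df). Qed.

Lemma dId (x : R) : is_derive x 1 (fun v : R => v) 1.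
Proof. exact: is_derive_id. Qed.

Lemma dSqr (x : R) : is_derive x 1 (fun v : R => v ^+ 2) (2 * x).
Proof. by refine (is_derive_eq (dMul (dId x) (dId x)) _); ring. Qed.

Lemma dCst (c x : R) : is_derive x 1 (fun=> c) 0.
Proof. exact: is_derive_cst. Qed.

End Derivatives.

Section Weights.
Context {R : realType} (b : R).
Hypothesis b1 : 1 < b.

Let b0 : 0 <= b. Proof. exact: le_trans ler01 (ltW b1). Qed.

Definition W (v : R) : R := (1 + v ^+ 2) `^ b.

(** For r = 1 this is (1 + v^2)^(b - 1), the size of the second derivative of a function of growth
    [W]; a larger r damps it at velocities small compared with r. *)
Definition theta (r v : R) : R := W v / (r ^+ 2 + v ^+ 2).

(* Comparable to [W] for [|v| >= r], and small for [|v|] much less than [r], so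
   that its integral measures the tail at [r] of the moment of order [2 b]. *)
Definition tail (r v : R) : R := v ^+ 2 * theta r v.

Lemma tailE r v : tail r v = v ^+ 2 * theta r v.
Proof. by []. Qed.

Lemma tail_normE r v : `|v| ^+ 2 * theta r `|v| = tail r v.
Proof. by rewrite /tail /theta /W real_normK ?num_real. Qed.

Lemma W_gt0 v : 0 < W v.
Proof. by rewrite powR_gt0// ltr_pwDl// sqr_ge0. Qed.

Lemma W_ge1 v : 1 <= W v.
Proof.
rewrite -(powRr0 (1 + v ^+ 2)); apply: ler_powR => //.
by rewrite lerDl sqr_ge0.
Qed.

Lemma W_mono (x y : R) : `|x| <= `|y| -> W x <= W y.
Proof.
move=> xy; apply: ge0_ler_powR => //; rewrite ?nnegrE ?addr_ge0 ?sqr_ge0//.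
by rewrite lerD2l -[leLHS]real_normK ?num_real// -[leRHS]real_normK ?num_real// lerXn2r.
Qed.

(** The doubling constant c^(2 b) of [W]. *)
Definition dbl (c : R) : R := (c ^+ 2) `^ b.

Lemma dbl_ge0 c : 0 <= dbl c. Proof. exact: powR_ge0. Qed.

Lemma sqr_le (x y : R) : `|x| <= `|y| -> x ^+ 2 <= y ^+ 2.
Proof.
move=> xy; rewrite -[leLHS]real_normK ?num_real// -[leRHS]real_normK ?num_real//.
by rewrite lerXn2r.
Qed.

Lemma W_dbl (c x y : R) : 1 <= c -> `|x| <= c * `|y| -> W x <= dbl c * W y.
Proof.
move=> c1 xy; have c0 : 0 <= c by exact: le_trans ler01 c1.
have c21 : 1 <= c ^+ 2 by rewrite exprn_ege1.
rewrite /dbl -powRM ?sqr_ge0// ?addr_ge0 ?sqr_ge0//.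
apply: ge0_ler_powR => //; rewrite ?nnegrE ?mulr_ge0 ?addr_ge0 ?sqr_ge0//.
have : x ^+ 2 <= (c * y) ^+ 2 by apply: sqr_le; rewrite normrM ger0_norm.
by rewrite exprMn mulrDr mulr1 => H; apply: lerD.
Qed.

Lemma den_gt0 (r v : R) : 1 <= r -> 0 < r ^+ 2 + v ^+ 2.
Proof.
by move=> r1; rewrite ltr_pwDl ?sqr_ge0// exprn_gt0// (lt_le_trans ltr01).
Qed.

Lemma theta_gt0 r v : 1 <= r -> 0 < theta r v.
Proof. by move=> r1; rewrite divr_gt0 ?W_gt0// den_gt0. Qed.

(** [theta r v] is the product of (1 + v^2)^(b - 1) and (1 + v^2) / (r^2 + v^2), both nondecreasing
    in |v| because b > 1 and r >= 1. *)
Lemma theta_mono (r x y : R) : 1 <= r -> `|x| <= `|y| -> theta r x <= theta r y.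
Proof.
move=> r1 /sqr_le xy.
have A (v : R) : 0 < 1 + v ^+ 2 by rewrite ltr_pwDl// sqr_ge0.
have WE v : W v = (1 + v ^+ 2) `^ (b - 1) * (1 + v ^+ 2).
  by rewrite mulrC mulr_powRB1 ?(ltW (A v))// (lt_trans ltr01).
rewrite /theta !WE -!mulrA; apply: ler_pM => //; rewrite ?powR_ge0//.
- by rewrite divr_ge0 ?(ltW (A _))// ltW// den_gt0.
- apply: ge0_ler_powR; rewrite ?nnegrE ?subr_ge0 ?(ltW b1) ?(ltW (A _))//.
  by rewrite lerD2l.
- rewrite ler_pdivrMr ?den_gt0// mulrAC ler_pdivlMr ?den_gt0//.
  have : 0 <= (r ^+ 2 - 1) * (y ^+ 2 - x ^+ 2).
    by rewrite mulr_ge0 ?subr_ge0// exprn_ege1.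
  by move=> H; lra.
Qed.

(** The constant is the one of [W], whatever r: passing from y to c y only enlarges the
    denominator. *)
Lemma theta_dbl (r c x y : R) : 1 <= r -> 1 <= c -> `|x| <= c * `|y| ->
  theta r x <= dbl c * theta r y.
Proof.
move=> r1 c1 xy; have c0 : 0 <= c by exact: le_trans ler01 c1.
apply: (@le_trans _ _ (theta r (c * y))).
  by apply: theta_mono => //; rewrite normrM ger0_norm.
rewrite /theta mulrA; apply: ler_pM; rewrite ?(ltW (W_gt0 _))//.
- by rewrite invr_ge0 ltW// den_gt0.
- by apply: W_dbl => //; rewrite normrM ger0_norm.
- rewrite lef_pV2 ?posrE ?den_gt0// lerD2l; apply: sqr_le.
  by rewrite normrM ger0_norm// ler_peMl.
Qed.

Lemma tail_ge0 r v : 1 <= r -> 0 <= tail r v.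
Proof. by move=> r1; rewrite mulr_ge0 ?sqr_ge0// ltW// theta_gt0. Qed.

Lemma tail_dbl (r c x y : R) : 1 <= r -> 1 <= c -> `|x| <= c * `|y| ->
  tail r x <= c ^+ 2 * dbl c * tail r y.
Proof.
move=> r1 c1 xy; have c0 : 0 <= c by exact: le_trans ler01 c1.
have -> : c ^+ 2 * dbl c * tail r y = (c * y) ^+ 2 * (dbl c * theta r y).
  by rewrite /tail; ring.
apply: ler_pM; rewrite ?sqr_ge0 ?theta_dbl//; first by rewrite ltW// theta_gt0.
by apply: sqr_le; rewrite normrM ger0_norm.
Qed.

Lemma tail_dbl_max (r c x v w : R) : 1 <= r -> 1 <= c ->
  `|x| <= c * Num.max `|v| `|w| ->
  tail r x <= c ^+ 2 * dbl c * (tail r v + tail r w).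
Proof.
move=> r1 c1; have c0 : 0 <= c by exact: le_trans ler01 c1.
have K : 0 <= c ^+ 2 * dbl c by rewrite mulr_ge0 ?sqr_ge0 ?dbl_ge0.
have [vw|wv] := leP `|v| `|w| => H.
- by apply: (le_trans (tail_dbl r1 c1 H)); rewrite ler_wpM2l// lerDr tail_ge0.
- by apply: (le_trans (tail_dbl r1 c1 H)); rewrite ler_wpM2l// lerDl tail_ge0.
Qed.

Lemma W_dbl_max (c x v w : R) : 1 <= c ->
  `|x| <= c * Num.max `|v| `|w| -> W x <= dbl c * (W v + W w).
Proof.
move=> c1; have [vw|wv] := leP `|v| `|w| => H.
- apply: (le_trans (W_dbl c1 H)); rewrite ler_wpM2l ?dbl_ge0//.
  by rewrite lerDr ltW// W_gt0.
- apply: (le_trans (W_dbl c1 H)); rewrite ler_wpM2l ?dbl_ge0//.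
  by rewrite lerDl ltW// W_gt0.
Qed.

Lemma tail_le_W r v : 1 <= r -> tail r v <= W v.
Proof.
move=> r1; rewrite /tail /theta mulrCA ler_piMr ?(ltW (W_gt0 v))//.
by rewrite ler_pdivrMr ?den_gt0// mul1r lerDr sqr_ge0.
Qed.

(** The ratio v^2 / (r^2 + v^2) is at least 1/2 once |v| >= r. *)
Lemma W_le_tail r v : 1 <= r -> r <= `|v| -> W v <= 2 * tail r v.
Proof.
move=> r1 rv; have -> : 2 * tail r v = W v * (2 * v ^+ 2 / (r ^+ 2 + v ^+ 2)).
  by rewrite /tail /theta; ring.
rewrite ler_peMr ?(ltW (W_gt0 v))// ler_pdivlMr ?den_gt0// mul1r.
have : r ^+ 2 <= v ^+ 2.
  by apply: sqr_le; rewrite ger0_norm// (le_trans ler01).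
lra.
Qed.

Lemma W_le v : W v <= 2 `^ b + 2 * tail 1 v.
Proof.
have [v1|v1] := leP `|v| 1.
- apply: (@le_trans _ _ (2 `^ b)); last by rewrite lerDl mulr_ge0// tail_ge0.
  apply: ge0_ler_powR => //; rewrite ?nnegrE ?addr_ge0 ?sqr_ge0//.
  have : v ^+ 2 <= 1 ^+ 2 by apply: sqr_le; rewrite normr1.
  rewrite expr1n; lra.
- by apply: (le_trans (W_le_tail (lexx 1) (ltW v1))); rewrite lerDr powR_ge0.
Qed.

Lemma theta_le1 r v : 1 <= r -> theta r v <= theta 1 v.
Proof.
move=> r1; rewrite /theta ler_wpM2l ?(ltW (W_gt0 v))// lef_pV2 ?posrE ?den_gt0//.
by rewrite lerD2r expr1n exprn_ege1.
Qed.

Lemma W_theta1 v : W v = (1 + v ^+ 2) * theta 1 v.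
Proof.
by rewrite /theta expr1n mulrCA divff ?mulr1// gt_eqF// ltr_pwDl// sqr_ge0.
Qed.

Lemma theta1_ge1 v : 1 <= theta 1 v.
Proof.
rewrite /theta expr1n; have A : 0 < 1 + v ^+ 2 by rewrite ltr_pwDl// sqr_ge0.
rewrite ler_pdivlMr// mul1r; apply: le1r_powR (ltW b1) => //.
by rewrite lerDl sqr_ge0.
Qed.

Lemma tail_cvg0 v : tail k.+1%:R v @[k --> \oo] --> (0 : R).
Proof.
have H : (v ^+ 2 * W v) * k.+1%:R^-1 @[k --> \oo] --> (v ^+ 2 * W v) * 0.
  by apply: cvgMr; exact: cvg_harmonic.
rewrite mulr0 in H.
apply: (squeeze_cvgr _ (cvg_cst 0) H); near=> k.
have k1 : 1 <= k.+1%:R :> R by rewrite ler1n.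
rewrite tail_ge0//= /tail /theta mulrA ler_wpM2l//.
  by rewrite mulr_ge0 ?sqr_ge0 ?(ltW (W_gt0 v)).
rewrite lef_pV2 ?posrE ?den_gt0//.
apply: (@le_trans _ _ (k.+1%:R ^+ 2)); last by rewrite lerDl sqr_ge0.
by rewrite expr2 ler_peMr.
Unshelve. all: by end_near. Qed.

Lemma dW (v : R) : is_derive v 1 W (2 * b * v * W v / (1 + v ^+ 2)).
Proof.
have A : 0 < 1 + v ^+ 2 by rewrite ltr_pwDl// sqr_ge0.
have d1 : is_derive v 1 (fun v : R => 1 + v ^+ 2) (2 * v).
  by refine (is_derive_eq (dAdd (dCst 1 v) (dSqr v)) _); rewrite add0r.
have d2 := @is_derive1_comp R (fun x : R => x `^ b) _ v _ _ (is_derive1_powR b A) d1.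
apply: (is_derive_eq d2); rewrite /W -(mulr_powRB1 (ltW A) (lt_trans ltr01 b1)).
by field; rewrite gt_eqF.
Qed.

(** The logarithmic slope v (tail r)' / tail r: the summands come from v^2, from [W] and from the
    denominator of [theta]. *)
Definition brk (r v : R) : R :=
  2 + 2 * b * v ^+ 2 / (1 + v ^+ 2) - 2 * v ^+ 2 / (r ^+ 2 + v ^+ 2).

Definition tail1 (r v : R) : R := v * theta r v * brk r v.

Definition tail2 (r v : R) : R := theta r v *
  ((1 + (2 * b * v ^+ 2 / (1 + v ^+ 2) - 2 * v ^+ 2 / (r ^+ 2 + v ^+ 2))) * brk r v
   + (4 * b * (v ^+ 2 / (1 + v ^+ 2)) * (1 - v ^+ 2 / (1 + v ^+ 2))
      - 4 * (v ^+ 2 / (r ^+ 2 + v ^+ 2)) * (1 - v ^+ 2 / (r ^+ 2 + v ^+ 2)))).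

Lemma dtheta (r v : R) : 1 <= r -> is_derive v 1 (theta r)
  (theta r v * (2 * b * v / (1 + v ^+ 2) - 2 * v / (r ^+ 2 + v ^+ 2))).
Proof.
move=> r1; have A : 1 + v ^+ 2 != 0 by rewrite gt_eqF// ltr_pwDl// sqr_ge0.
have D : r ^+ 2 + v ^+ 2 != 0 by rewrite gt_eqF// den_gt0.
have d1 : is_derive v 1 (fun v : R => r ^+ 2 + v ^+ 2) (2 * v).
  by refine (is_derive_eq (dAdd (dCst _ v) (dSqr v)) _); rewrite add0r.
refine (is_derive_eq (dMul (dW v) (dInv d1 D)) _).
by rewrite /theta; field; rewrite A D.
Qed.

Lemma dtail (r v : R) : 1 <= r -> is_derive v 1 (tail r) (tail1 r v).
Proof.
move=> r1; have A : 1 + v ^+ 2 != 0 by rewrite gt_eqF// ltr_pwDl// sqr_ge0.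
have D : r ^+ 2 + v ^+ 2 != 0 by rewrite gt_eqF// den_gt0.
refine (is_derive_eq (dMul (dSqr v) (dtheta v r1)) _).
by rewrite /tail1 /brk; field; rewrite A D.
Qed.

Lemma dtail1 (r v : R) : 1 <= r -> is_derive v 1 (tail1 r) (tail2 r v).
Proof.
move=> r1; have A : 1 + v ^+ 2 != 0 by rewrite gt_eqF// ltr_pwDl// sqr_ge0.
have D : r ^+ 2 + v ^+ 2 != 0 by rewrite gt_eqF// den_gt0.
have d1 c : is_derive v 1 (fun v : R => c + v ^+ 2) (2 * v).
  by refine (is_derive_eq (dAdd (dCst _ v) (dSqr v)) _); rewrite add0r.
have dq c e : e + v ^+ 2 != 0 ->
    is_derive v 1 (fun v : R => c * v ^+ 2 / (e + v ^+ 2))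
      (2 * c * v / (e + v ^+ 2) - 2 * c * v ^+ 3 / (e + v ^+ 2) ^+ 2).
  move=> E; refine (is_derive_eq (dMul (dScale c (dSqr v)) (dInv (d1 e) E)) _).
  by field.
have dN : is_derive v 1 (fun v : R => -1 * (2 * v ^+ 2 / (r ^+ 2 + v ^+ 2))) _ :=
  dScale (-1) (dq 2 _ D).
have db := dAdd (dAdd (dCst 2 v) (dq (2 * b) 1 A)) dN.
have dt := dMul (dMul (dId v) (dtheta v r1)) db.
have E : tail1 r = (fun v => v * theta r v * (2 + 2 * b * v ^+ 2 / (1 + v ^+ 2) +
    -1 * (2 * v ^+ 2 / (r ^+ 2 + v ^+ 2)))).
  by apply/funext => x; rewrite /tail1 /brk mulN1r.
rewrite E; apply: is_derive_eq dt _.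
by rewrite /tail2 /brk; field; rewrite A D.
Qed.

Lemma frac_itv (e v : R) : 0 < e -> 0 <= v ^+ 2 / (e + v ^+ 2) <= 1.
Proof.
move=> e0; have E : 0 < e + v ^+ 2 by rewrite ltr_pwDl ?sqr_ge0.
rewrite divr_ge0 ?sqr_ge0 ?(ltW E)//= ler_pdivrMr// mul1r lerDr.
exact: ltW.
Qed.

(** The 2 contributed by v^2 absorbs the loss from the denominator. The resulting sign makes
    [tail r] nondecreasing in |v|, so that the drift of the scaling can only help. *)
Lemma brk_itv (r v : R) : 1 <= r -> 0 <= brk r v <= 2 + 2 * b.
Proof.
move=> r1; have r0 : 0 < r ^+ 2 by rewrite exprn_gt0// (lt_le_trans ltr01).
have /andP[x0 x1] := frac_itv v (ltr01 : 0 < (1 : R)).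
have /andP[y0 y1] := frac_itv v r0.
rewrite /brk -[2 * b * _ / _]mulrA -[2 * v ^+ 2 / _]mulrA.
have : 0 <= b * (v ^+ 2 / (1 + v ^+ 2)) <= b by rewrite mulr_ge0//= ler_piMr.
by move=> /andP[? ?]; apply/andP; split; lra.
Qed.

Lemma tail1_sign (r v : R) : 1 <= r -> 0 <= v * tail1 r v.
Proof.
move=> r1; have /andP[? _] := brk_itv v r1.
have -> : v * tail1 r v = tail r v * brk r v by rewrite /tail1 /tail; ring.
by rewrite mulr_ge0 ?tail_ge0.
Qed.

(** A termwise bound of the second factor of [tail2], where both fractions lie in [0, 1]; this
    removes r. *)
Definition tail2_cst : R := (1 + (2 * b + 2)) * (2 + 2 * b) + (4 * b + 4).

Lemma tail2_le (r v : R) : 1 <= r -> `|tail2 r v| <= tail2_cst * theta r v.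
Proof.
move=> r1; have r0 : 0 < r ^+ 2 by rewrite exprn_gt0// (lt_le_trans ltr01).
have t0 := theta_gt0 v r1.
rewrite normrM (gtr0_norm t0) mulrC ler_wpM2r ?(ltW t0)//.
have /andP[B0 B1] := brk_itv v r1.
rewrite -[2 * b * _ / _]mulrA -[2 * v ^+ 2 / _]mulrA.
have /andP[] := frac_itv v (ltr01 : 0 < (1 : R)); set x := _ / _ => x0 x1.
have /andP[] := frac_itv v r0; set y := _ / _ => y0 y1.
have /andP[bx0 bx1] : 0 <= b * x <= b by rewrite mulr_ge0//= ler_piMr.
have bb : 0 <= 2 * b * x <= 2 * b by apply/andP; split; lra.
have xx : 0 <= b * x * (1 - x) <= b.
  rewrite mulr_ge0 ?subr_ge0//=; apply: le_trans bx1.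
  by rewrite ler_piMr// gerBl.
have yy : 0 <= y * (1 - y) <= 1.
  rewrite mulr_ge0 ?subr_ge0//=; apply: le_trans y1.
  by rewrite ler_piMr// gerBl.
apply: (le_trans (ler_normD _ _)); rewrite /tail2_cst; apply: lerD.
- rewrite normrM (ger0_norm B0); apply: ler_pM => //.
  rewrite ler_norml; case/andP : bb => ? ?; apply/andP; split; lra.
- rewrite -[4 * b * x * _]mulrA -[4 * b * (x * _)]mulrA [b * (x * _)]mulrA -[4 * y * _]mulrA.
  case/andP : xx => ? ?; case/andP : yy => ? ?.
  by rewrite ler_norml; apply/andP; split; lra.
Qed.

End Weights.

(** * Integrability of functions of growth [W] *)

Section Domination.
Context {R : realType} (b : R).
Hypothesis b1 : 1 < b.
Local Notation RM := (measurableTypeR R).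
Local Notation W := (W b).
Local Notation tail := (tail b).
Local Notation dbl := (dbl b).

Lemma mR_W : mR W.
Proof. by apply: mR_continuous; exact: continuous_der (dW b1). Qed.

Lemma mR_tail r : 1 <= r -> mR (tail r).
Proof. by move=> r1; apply: mR_continuous; apply: continuous_der => v; exact: dtail. Qed.

Lemma intg_tail (mu : borelProb R) r : 1 <= r -> intg mu W -> intg mu (tail r).
Proof.
move=> r1 iW; apply: intg_le iW _; first exact: mR_tail.
by move=> v; rewrite ger0_norm ?tail_ge0// tail_le_W.
Qed.

Lemma intg_dom (mu : borelProb R) phi (C : R) : mR phi ->
  (forall v, `|phi v| <= C * W v) -> intg mu W -> intg mu phi.
Proof. by move=> m H iW; exact: intg_le m (intgZ C iW) H. Qed.

Definition dom2 (F : RM * RM -> R) : Prop :=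
  measurable_fun setT F /\ exists C, forall z, `|F z| <= C * (W z.1 + W z.2).

Lemma intg_dom2 (mu nu : borelProb R) F : dom2 F -> intg mu W -> intg nu W ->
  intg (mu \x nu)%E F.
Proof.
move=> [mF [C HF]] iW iW'.
have i : intg (mu \x nu)%E (fun z : RM * RM => C * (W z.1 + W z.2)).
  by apply: intgZ; apply: intgD; [exact: intg_fst|exact: intg_snd].
exact: intg_le mF i HF.
Qed.

Lemma norm_mix (p q x y : R) : 0 <= p -> 0 <= q ->
  `|p * x + q * y| <= (p + q) * Num.max `|x| `|y|.
Proof.
move=> p0 q0; apply: (le_trans (ler_normD _ _)); rewrite !normrM (ger0_norm p0) (ger0_norm q0).
by rewrite mulrDl lerD// ler_wpM2l// le_max lexx// orbT.
Qed.

(** The sum p + q already bounds a collision by the larger velocity; adding 1 makes the factor at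
    least 1, as the doubling inequalities require. *)
Definition mixc (p q : R) : R := 1 + (p + q).

Lemma mixc_ge1 p q : 0 <= p -> 0 <= q -> 1 <= mixc p q.
Proof. by move=> p0 q0; rewrite lerDl addr_ge0. Qed.

Lemma norm_mixc (p q x y : R) : 0 <= p -> 0 <= q ->
  `|p * x + q * y| <= mixc p q * Num.max `|x| `|y|.
Proof.
move=> p0 q0; apply: (le_trans (norm_mix _ _ p0 q0)).
by rewrite /mixc [leRHS]mulrDl lerDr mul1r le_max normr_ge0.
Qed.

Lemma dom2_mix (p q C : R) phi : 0 <= p -> 0 <= q -> mR phi ->
  (forall v, `|phi v| <= C * W v) -> dom2 (fun z => phi (p * z.1 + q * z.2)).
Proof.
move=> p0 q0 mphi H; split; first exact: measurable_mix.
have C0 : 0 <= C.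
  by have := le_trans (normr_ge0 _) (H 0); rewrite pmulr_lge0// W_gt0.
exists (C * dbl (mixc p q)) => z; apply: (le_trans (H _)); rewrite -mulrA ler_wpM2l//.
by apply: W_dbl_max => //; [exact: mixc_ge1|exact: norm_mixc].
Qed.

Lemma dom2_fst (C : R) phi : mR phi -> (forall v, `|phi v| <= C * W v) ->
  dom2 (fun z => phi z.1).
Proof.
move=> mphi H; split; first exact: measurable_fst.
have C0 : 0 <= C.
  by have := le_trans (normr_ge0 _) (H 0); rewrite pmulr_lge0// W_gt0.
exists C => z; apply: (le_trans (H _)); rewrite ler_wpM2l// lerDl ltW// W_gt0//.
Qed.

Lemma dom2B F G : dom2 F -> dom2 G -> dom2 (fun z => F z - G z).
Proof.
move=> [mF [C HF]] [mG [D HG]]; split; first exact: measurable_funB.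
exists (C + D) => z; apply: (le_trans (ler_normB _ _)).
by rewrite mulrDl lerD.
Qed.

End Domination.

(** * The equation for functions of growth [W], at fixed p and q *)

Section FixedParameters.
Context {R : realType} (b p q : R) (f0 : borelProb R) (f : R -> borelProb R).
Hypothesis b1 : 1 < b.
Hypothesis p0 : 0 <= p.
Hypothesis q0 : 0 <= q.
Local Notation RM := (measurableTypeR R).
Local Notation W := (W b).
Local Notation tail := (tail b).
Local Notation dbl := (dbl b).
Hypothesis iW0 : intg f0 W.
Hypothesis iWf : forall t : R, 0 <= t -> intg (f t) W.
Hypothesis tests : forall phi, test_function phi -> boltz p q f0 f phi.

(** The doubling constant of every [tail r] under a collision, the same for all r. *)
Let K : R := mixc p q ^+ 2 * dbl (mixc p q).

Let K_ge1 : 1 <= K.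
Proof.
have c1 := mixc_ge1 p0 q0; have c21 : 1 <= mixc p q ^+ 2 by rewrite exprn_ege1.
rewrite /K -[leLHS]mulr1; apply: ler_pM => //.
rewrite -[leLHS](powRr0 (mixc p q ^+ 2)); apply: ler_powR => //.
exact: le_trans ler01 (ltW b1).
Qed.

Let K_ge0 : 0 <= K. Proof. exact: le_trans ler01 K_ge1. Qed.

Lemma tail_mix r x y : 1 <= r ->
  tail r (p * x + q * y) <= K * (tail r x + tail r y).
Proof.
move=> r1; apply: tail_dbl_max => //; first exact: mixc_ge1.
exact: norm_mixc.
Qed.

(* Gronwall is applied to [min (tail r) N], which is bounded and still doubling. *)
Lemma tail_growth r t : 1 <= r -> 0 <= t ->
  \int[f t]_v tail r v <= expR ((2 * K) * t) * \int[f0]_v tail r v.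
Proof.
move=> r1 t0; pose z (N : nat) v := Num.min (tail r v) N%:R.
have mz N : mR (z N).
  by apply: measurable_minr; [exact: mR_tail|exact: measurable_cst].
have z0 N v : 0 <= z N v by rewrite le_min tail_ge0//= ler0n.
have zN N v : `|z N v| <= N%:R by rewrite ger0_norm// ge_min lexx orbT.
have zt N v : z N v <= tail r v by rewrite ge_min lexx.
have zK N x y : z N (p * x + q * y) <= K * (z N x + z N y).
  have N0 : 0 <= N%:R :> R by [].
  have A := tail_mix x y r1; have := tail_ge0 b x r1; have := tail_ge0 b y r1.
  rewrite /z; move: (tail r _) A => X A ty tx.
  have K0 := K_ge0; have K1 := K_ge1.
  have B : N%:R <= K * N%:R by rewrite ler_peMl.
  (* If one of the two tails exceeds N, the right side is at least K N, hence at least N, because K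
     >= 1. *)
  have [h1|h1] := leP (tail r x) N%:R; have [h2|h2] := leP (tail r y) N%:R.
  - by rewrite ge_min A.
  - rewrite ge_min; apply/orP; right; apply: (le_trans B).
    by rewrite ler_wpM2l// lerDr.
  - rewrite ge_min; apply/orP; right; apply: (le_trans B).
    by rewrite ler_wpM2l// lerDl.
  - rewrite ge_min; apply/orP; right; apply: (le_trans B).
    by rewrite ler_wpM2l// lerDl.
have HN N : \int[f t]_v z N v <= expR ((2 * K) * t) * \int[f0]_v tail r v.
  have sz : solves p q f0 f (z N) by apply: (solves_bounded tests (mz N) (zN N)).
  have [d c e] := solves_boltz sz.
  have iz (mu : borelProb R) : intg mu (z N).
    by apply: (intg_bounded N%:R); [exact: mz|exact: zN].
  apply: (le_trans (gronwall (C := 2 * K) d c _ t0)).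
    move=> s s0; rewrite /gain.
    have im : intg (f s \x f s)%E (fun w : RM * RM => z N (p * w.1 + q * w.2)).
      by apply: (intg_bounded N%:R) => //; exact: measurable_mix.
    rewrite expB//; last exact: intg_fst.
    have h : \int[(f s \x f s)%E]_w z N (p * w.1 + q * w.2) <=
        \int[(f s \x f s)%E]_w (K * (z N w.1 + z N w.2)).
      apply: exp_le; [exact: im| |by move=> w; exact: zK].
      by apply: intgZ; apply: intgD; [exact: intg_fst|exact: intg_snd].
    rewrite expZ in h; last by apply: intgD; [exact: intg_fst|exact: intg_snd].
    rewrite expD in h; [|exact: intg_fst|exact: intg_snd].
    rewrite exp_fst// exp_snd// in h.
    rewrite exp_fst//; apply: (@le_trans _ _ (K * (\int[f s]_v z N v + \int[f s]_v z N v))).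
      by rewrite lerBlDr; apply: (le_trans h); rewrite lerDl exp_ge0.
    by rewrite le_eqVlt; apply/orP; left; apply/eqP; ring.
  rewrite e ler_wpM2l ?expR_ge0//; apply: exp_le => //; exact: intg_tail.
have zW N v : `|z N v| <= W v.
  by rewrite ger0_norm ?z0//; exact: le_trans (zt N v) (tail_le_W b v r1).
have zl v : z ^~ v @ \oo --> tail r v.
  apply: cvg_near_cst; exists (Num.truncn (tail r v)).+1 => // N /= vN.
  apply/min_idPl; apply: (le_trans (ltW (truncnS_gt _))).
  by rewrite ler_nat.
have [_ lim] := exp_dominated (P := f t) mz (iWf t0) zW zl.
by apply: (ler_cvg_to lim (cvg_cst _)); exists 0%N => // N _; exact: HN.
Qed.

Section Growth.
Variables (phi : R -> R) (C : R).
Hypothesis mphi : mR phi.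
Hypothesis phiC : forall v, `|phi v| <= C * W v.

Let C0 : 0 <= C.
Proof. by have := le_trans (normr_ge0 _) (phiC 0); rewrite pmulr_lge0// W_gt0. Qed.

Let cut (k : nat) v := if `|v| < k.+1%:R then phi v else 0.

Let mcut k : mR (cut k).
Proof.
have E : cut k = fun v => phi v * ind `]- k.+1%:R, k.+1%:R[%classic v.
  apply/funext => v; rewrite /cut /ind indicE mem_setE in_itv/= -ltr_norml.
  by case: ifP => _; rewrite ?mulr1 ?mulr0.
rewrite E; apply: measurable_funM => //; exact: measurable_indic.
Qed.

Let cutB k v : `|phi v - cut k v| <= 2 * C * tail k.+1%:R v.
Proof.
have k1 : 1 <= k.+1%:R :> R by rewrite ler1n.
rewrite /cut; case: ltP => [_|kv].
  by rewrite subrr normr0 mulr_ge0 ?tail_ge0// mulr_ge0.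
rewrite subr0; apply: (le_trans (phiC v)); rewrite mulrAC mulrC.
by rewrite mulrC [leRHS]mulrC ler_wpM2l// W_le_tail.
Qed.

Let cut_bounded k v : `|cut k v| <= C * W k.+1%:R.
Proof.
rewrite /cut; case: ltP => [kv|_].
  apply: (le_trans (phiC v)); rewrite ler_wpM2l// W_mono//.
  by rewrite [leRHS]ger0_norm ?ltW.
by rewrite normr0 mulr_ge0// ltW// W_gt0.
Qed.

Let eps k := \int[f0]_v tail k.+1%:R v.

Let eps0 : eps @ \oo --> (0 : R).
Proof.
have [|//|] := exp_dominated (P := f0) (f_ := fun k => tail k.+1%:R)
    (f := fun=> 0) (g := W) _ iW0 _ (tail_cvg0 b).
- by move=> k; apply: mR_tail => //; rewrite ler1n.
- by move=> k v; rewrite ger0_norm ?tail_ge0 ?ler1n// tail_le_W ?ler1n.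
- by rewrite exp_cst.
Qed.

Let Fk k u : 0 <= u -> `|\int[f u]_v cut k v - \int[f u]_v phi v| <=
  2 * C * expR ((2 * K) * u) * eps k.
Proof.
move=> u0; have k1 : 1 <= k.+1%:R :> R by rewrite ler1n.
have iphi : intg (f u) phi by exact: intg_dom phiC (iWf u0).
have icut : intg (f u) (cut k) by exact: intg_bounded (mcut k) (cut_bounded k).
have it : intg (f u) (tail k.+1%:R) by exact: intg_tail (iWf u0).
rewrite distrC -expB//; apply: (@le_trans _ _ (\int[f u]_v (2 * C * tail k.+1%:R v))).
  by apply: exp_norm => //; [exact: intgB|exact: intgZ].
rewrite expZ// -[leRHS]mulrA; apply: ler_wpM2l; first exact: mulr_ge0.
exact: tail_growth.
Qed.

Let Gk k u : 0 <= u -> `|gain p q (f u) (cut k) - gain p q (f u) phi| <=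
  2 * C * (2 * K + 1) * expR ((2 * K) * u) * eps k.
Proof.
move=> u0; have k1 : 1 <= k.+1%:R :> R by rewrite ler1n.
have cutC v : `|cut k v| <= C * W v.
  rewrite /cut; case: ltP => _ //; by rewrite normr0 mulr_ge0// ltW// W_gt0.
have iWu := iWf u0.
have d1 : dom2 b (fun z => phi (p * z.1 + q * z.2) - phi z.1).
  by apply: dom2B; [exact: dom2_mix phiC|exact: dom2_fst phiC].
have d2 : dom2 b (fun z => cut k (p * z.1 + q * z.2) - cut k z.1).
  by apply: dom2B; [exact: dom2_mix cutC|exact: dom2_fst cutC].
have it : intg (f u) (tail k.+1%:R) by exact: intg_tail (iWf u0).
have i1 : intg (f u \x f u)%E (fun z : RM * RM => tail k.+1%:R z.1) by exact: intg_fst.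
have i2 : intg (f u \x f u)%E (fun z : RM * RM => tail k.+1%:R z.2) by exact: intg_snd.
have i3 : intg (f u \x f u)%E (fun z : RM * RM =>
    K * (tail k.+1%:R z.1 + tail k.+1%:R z.2) + tail k.+1%:R z.1).
  by apply: intgD => //; apply: intgZ; apply: intgD.
rewrite distrC /gain -expB; [|exact: intg_dom2 d1 _ _|exact: intg_dom2 d2 _ _].
apply: (@le_trans _ _ (\int[(f u \x f u)%E]_z
    (2 * C * (K * (tail k.+1%:R z.1 + tail k.+1%:R z.2) + tail k.+1%:R z.1)))).
  apply: exp_norm.
  - by apply: intgB; [exact: intg_dom2 d1 _ _|exact: intg_dom2 d2 _ _].
  - exact: intgZ.
  - move=> z; set x := p * z.1 + q * z.2.
    have -> : phi x - phi z.1 - (cut k x - cut k z.1) =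
      (phi x - cut k x) - (phi z.1 - cut k z.1) by ring.
    apply: (le_trans (ler_normB _ _)); rewrite mulrDr; apply: lerD => //.
    apply: (le_trans (cutB _ _)); apply: ler_wpM2l; first exact: mulr_ge0.
    exact: tail_mix.
rewrite expZ// expD//; last by apply: intgZ; apply: intgD.
rewrite expZ; last exact: intgD.
rewrite expD// exp_fst// exp_snd//.
have := tail_growth k1 u0; rewrite -/(eps k) => T.
have -> : 2 * C * (2 * K + 1) * expR ((2 * K) * u) * eps k =
  2 * C * ((2 * K + 1) * (expR ((2 * K) * u) * eps k)) by ring.
apply: ler_wpM2l; first exact: mulr_ge0.
set I := \int[f u]_v _ in T *; apply: (@le_trans _ _ ((2 * K + 1) * I)).
  by rewrite le_eqVlt; apply/orP; left; apply/eqP; ring.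
by apply: ler_wpM2l => //; rewrite addr_ge0// mulr_ge0.
Qed.

Let small (D T e : R) : 0 <= D -> 0 < e ->
  exists N, forall k u, (N <= k)%N -> u <= T -> D * expR ((2 * K) * u) * eps k <= e.
Proof.
move=> D0 e0.
have H : D * expR ((2 * K) * T) * eps k @[k --> \oo] --> D * expR ((2 * K) * T) * 0.
  by apply: cvgMr.
rewrite mulr0 in H; have := cvgr_norm_le _ H; rewrite normr0.
move=> /(_ _ e e0) [N _ HN]; exists N => k u Nk uT.
apply: le_trans (HN k Nk); apply: le_trans (ler_norm _).
have e1 : 0 <= eps k by apply: exp_ge0 => v; rewrite tail_ge0// ler1n.
rewrite ler_wpM2r// ler_wpM2l// ler_expR ler_wpM2l// mulr_ge0//.
Qed.

(** The truncations [cut k] are bounded, hence solve the equation. [Fk] and [Gk] bound the errors in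
    the integral and in the gain by a tail of [f0], uniformly on bounded time intervals, so the
    derivatives pass to the limit. *)
Lemma boltz_growth : boltz p q f0 f phi.
Proof.
have scut k : solves p q f0 f (cut k).
  exact: (solves_bounded tests (mcut k) (cut_bounded k)).
have Flim u : 0 <= u -> \int[f u]_v cut k v @[k --> \oo] --> \int[f u]_v phi v.
  move=> u0; apply/cvgrPdist_le => e e0.
  have [N HN] := small u (mulr_ge0 (ler0n R 2) C0) e0.
  exists N => // k Nk; rewrite distrC.
  by apply: (le_trans (Fk k u0)); exact: HN.
split.
- move=> t t0.
  apply: (@is_derive_unif_lim _ (fun k u => \int[f u]_v cut k v)
    (fun k u => gain p q (f u) (cut k)) (fun u => \int[f u]_v phi v)
    (fun u => gain p q (f u) phi) t t t0).
  + move=> k u ut; have u0 : 0 < u by move: ut; rewrite ltr_norml => /andP[? _]; lra.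
    by have [d _ _] := solves_boltz (scut k); exact: d.
  + move=> u ut; have u0 : 0 < u by move: ut; rewrite ltr_norml => /andP[? _]; lra.
    by apply: Flim; exact: ltW.
  + move=> e e0.
    have D0 : 0 <= 2 * C * (2 * K + 1) by rewrite !mulr_ge0// addr_ge0// mulr_ge0.
    (* The condition |u - t| < t confines u to times between 0 and 2 t. *)
    have [N HN] := small (2 * t) D0 e0; exists N => k u Nk ut.
    have [u0 u2] : 0 < u /\ u <= 2 * t.
      by move: ut; rewrite ltr_norml => /andP[? ?]; split; lra.
    by apply: (le_trans (Gk k (ltW u0))); exact: HN.
- apply/cvgrPdist_le => e e0; have e3 : 0 < e / 3 by rewrite divr_gt0.
  have [N HN] := small 1 (mulr_ge0 (ler0n R 2) C0) e3.
  have [_ c _] := solves_boltz (scut N).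
  have c1 : \forall t \near (0 : R)^'+,
      `|\int[f 0]_v cut N v - \int[f t]_v cut N v| <= e / 3.
    by move/cvgrPdist_le : c; apply.
  have c2 : \forall t \near (0 : R)^'+, 0 < t by exact: nbhs_right_gt.
  have c3 : \forall t \near (0 : R)^'+, t <= 1 by exact: nbhs_right_le.
  suff : \forall t \near (0 : R)^'+,
      `|\int[f 0]_v phi v - \int[f t]_v phi v| <= e by [].
  apply: filterS3 c1 c2 c3 => t H3 /ltW t0 t1.
  have H1 := le_trans (Fk N t0) (HN N t (leqnn _) t1).
  have H2 := le_trans (Fk N (lexx 0)) (HN N 0 (leqnn _) ler01).
  move: H1 H2 H3; rewrite !ler_norml => /andP[? ?] /andP[? ?] /andP[? ?].
  by apply/andP; split; lra.
- apply: (cvg_unique _ (Flim 0 (lexx 0))) => //.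
  have -> : (fun k => \int[f 0]_v cut k v) = (fun k => \int[f0]_v cut k v).
    by apply/funext => k; have [_ _ ->] := solves_boltz (scut k).
  have [] := exp_dominated (P := f0) (f_ := cut) (f := phi) (g := fun v => C * W v) mcut.
  + exact: intgZ.
  + move=> k v; rewrite /cut; case: ltP => _ //; by rewrite normr0 mulr_ge0// ltW// W_gt0.
  + move=> v; apply: cvg_near_cst; exists (Num.truncn `|v|) => // k /= vk; rewrite /cut ifT//.
    by apply: (lt_le_trans (truncnS_gt _)); rewrite ler_nat ltnS.
  + by [].
Qed.

End Growth.

End FixedParameters.

(** * The rescaled equation *)

Section Taylor.
Context {R : realType}.
Implicit Types phi : R -> R.

(** Two mean value steps, which use the derivatives pointwise; the price is an unknown factor [eta]
    in [0, 1] in place of 1/2. *)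
Lemma taylor2 phi phi1 phi2 (x d : R) :
  (forall v : R, is_derive v 1 phi (phi1 v)) ->
  (forall v : R, is_derive v 1 phi1 (phi2 v)) ->
  exists th eta : R, [/\ 0 <= th <= 1, 0 <= eta <= 1 &
    phi (x + d) - phi x - phi1 x * d = phi2 (x + th * d) * (eta * d ^+ 2)].
Proof.
move=> d1 d2; have [th /andP[t0 t1] E] := mvt_th x (x + d) d1.
have xd : x + d - x = d by ring.
rewrite xd in E.
have [et /andP[e0 e1] E'] := mvt_th x (x + th * d) d2.
have xd' : x + th * d - x = th * d by ring.
rewrite xd' in E'.
exists (et * th), th; split; last first.
- rewrite E -mulrBl E' -[et * th * d]mulrA; ring.
- by rewrite t0.
- by rewrite mulr_ge0//= mulr_ile1.
Qed.

Lemma taylor3 phi phi1 phi2 (x d : R) :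
  (forall v : R, is_derive v 1 phi (phi1 v)) ->
  (forall v : R, is_derive v 1 phi1 (phi2 v)) ->
  exists th eta : R, [/\ 0 <= th <= 1, 0 <= eta <= 1 &
    phi (x + d) - phi x - phi1 x * d - 2^-1 * phi2 x * d ^+ 2 =
      (phi2 (x + th * d) - phi2 x) * (eta * d ^+ 2)].
Proof.
move=> d1 d2.
(* Subtracting the quadratic Taylor term turns the second derivative into [phi2 v - phi2 x], and
   [taylor2] applies to the difference. *)
pose c := - (2^-1 * phi2 x).
have daff (v : R) : is_derive v 1 (fun v => v - x) 1.
  by refine (is_derive_eq (dAdd (dId v) (dCst (- x) v)) _); rewrite addr0.
have dq (v : R) : is_derive v 1 (fun v => phi v + c * ((v - x) * (v - x)))
    (phi1 v + c * (2 * (v - x))).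
  by refine (is_derive_eq (dAdd (d1 v) (dScale c (dMul (daff v) (daff v)))) _); ring.
have dq1 (v : R) : is_derive v 1 (fun v => phi1 v + c * (2 * (v - x))) (phi2 v - phi2 x).
  refine (is_derive_eq (dAdd (d2 v) (dScale c (dScale 2 (daff v)))) _).
  by rewrite /c; field.
have [th [eta [t01 e01 E]]] := taylor2 x d dq dq1.
exists th, eta; split => //; by rewrite -E /c; field.
Qed.

End Taylor.

(** * Test functions with second derivative of size [theta 1] *)

Section C2.
Context {R : realType} (b : R).
Hypothesis b1 : 1 < b.
Local Notation RM := (measurableTypeR R).
Local Notation W := (W b).
Local Notation theta := (theta b).
Local Notation tail := (tail b).

(** Only the second derivative is bounded explicitly, by the growth that F_s with s = 2 b imposes on
    it; the growth of phi and [phi1] follows. *)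
Definition C2 (phi phi1 phi2 : R -> R) (C : R) : Prop :=
  [/\ forall v : R, is_derive v 1 phi (phi1 v),
      forall v : R, is_derive v 1 phi1 (phi2 v) &
      forall v, `|phi2 v| <= C * theta 1 v].

Lemma sqr1_le_W v : 1 + v ^+ 2 <= W v.
Proof. by apply: le1r_powR (ltW b1); rewrite lerDl sqr_ge0. Qed.

Lemma sqr_le_W v : v ^+ 2 <= W v.
Proof. by apply: le_trans (sqr1_le_W v); rewrite lerDr. Qed.

Lemma norm_le_W v : `|v| <= W v.
Proof.
apply: le_trans (sqr1_le_W v); rewrite -[v ^+ 2]real_normK ?num_real//.
have := sqr_ge0 (`|v| - 1); rewrite sqrrB1; have := normr_ge0 v.
by rewrite mulr2n; lra.
Qed.

(** The mean value theorem from 0, once for [phi1] and once more for phi; [theta 1] is monotone, so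
    intermediate points cost nothing. *)
Lemma C2_growth phi phi1 phi2 C : C2 phi phi1 phi2 C ->
  exists2 D : R, 0 <= D & forall v, [/\ `|phi v| <= D * W v,
    `|phi1 v| <= D * W v, `|v * phi1 v| <= D * W v & v ^+ 2 * `|phi2 v| <= D * W v].
Proof.
move=> [d1 d2 B].
have C0 : 0 <= C.
  by have := le_trans (normr_ge0 _) (B 0); rewrite pmulr_lge0// theta_gt0.
have thv (th v : R) : 0 <= th <= 1 -> `|0 + th * (v - 0)| <= `|v|.
  by move=> /andP[t0 t1]; rewrite add0r subr0 normrM ger0_norm// ler_piMl.
have H1 v : `|phi1 v| <= `|phi1 0| + `|v| * (C * theta 1 v).
  have [th t01 E] := mvt_th 0 v d2.
  rewrite -[phi1 v](subrK (phi1 0)) [leRHS]addrC; apply: (le_trans (ler_normD _ _)).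
  rewrite lerD2r E normrM subr0 mulrC ler_wpM2l//; apply: (le_trans (B _)).
  rewrite ler_wpM2l// theta_mono//.
  by have := thv th v t01; rewrite subr0.
have tW v : v ^+ 2 * theta 1 v <= W v := tail_le_W b v (lexx 1).
have vW v : `|v| * theta 1 v <= W v.
  rewrite W_theta1; apply: ler_wpM2r; first by rewrite ltW// theta_gt0.
  rewrite -[v ^+ 2]real_normK ?num_real//.
  have := sqr_ge0 (`|v| - 1); rewrite sqrrB1; have := normr_ge0 v.
  by rewrite mulr2n; lra.
pose D := `|phi 0| + `|phi1 0| + C.
have P0 := normr_ge0 (phi 0); have P1 := normr_ge0 (phi1 0).
exists D; first by rewrite !addr_ge0.
move=> v; have Wv := W_ge1 b1 v; have nW := norm_le_W v.
have W0 := W_gt0 b v.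
have K0 : 0 <= `|phi 0| * W v by rewrite mulr_ge0// ltW.
have K1 : 0 <= `|phi1 0| * W v by rewrite mulr_ge0// ltW.
have KC : 0 <= C * W v by rewrite mulr_ge0// ltW.
have E1 : `|phi1 0| <= `|phi1 0| * W v by rewrite ler_peMr.
have E0 : `|phi 0| <= `|phi 0| * W v by rewrite ler_peMr.
have E2 : `|phi1 0| * `|v| <= `|phi1 0| * W v by rewrite ler_wpM2l.
have E3 : C * (v ^+ 2 * theta 1 v) <= C * W v by rewrite ler_wpM2l.
have E4 : C * (`|v| * theta 1 v) <= C * W v by rewrite ler_wpM2l.
have vv : `|v| * `|v| = v ^+ 2 by rewrite -expr2 real_normK ?num_real.
have Q : `|v| * (`|phi1 0| + `|v| * (C * theta 1 v)) =
    `|phi1 0| * `|v| + C * (v ^+ 2 * theta 1 v) by rewrite -vv; ring.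
have DE : D * W v = `|phi 0| * W v + `|phi1 0| * W v + C * W v by rewrite /D; ring.
rewrite DE; split.
- have [th t01 E] := mvt_th 0 v d1.
  have t' : `|th * v| <= `|v|.
    by move: (thv th v t01); rewrite add0r subr0.
  have : `|phi v| <= `|phi 0| + `|v| * (`|phi1 0| + `|v| * (C * theta 1 v)).
    rewrite -[phi v](subrK (phi 0)) [leRHS]addrC; apply: (le_trans (ler_normD _ _)).
    rewrite lerD2r E normrM subr0 add0r mulrC ler_wpM2l//.
    apply: (le_trans (H1 _)); rewrite lerD2l; apply: ler_pM => //.
      by rewrite mulr_ge0// ltW// theta_gt0.
    by rewrite ler_wpM2l// theta_mono.
  by rewrite Q; lra.
- apply: (le_trans (H1 v)).
  have -> : `|v| * (C * theta 1 v) = C * (`|v| * theta 1 v) by ring.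
  lra.
- rewrite normrM; apply: (@le_trans _ _ (`|v| * (`|phi1 0| + `|v| * (C * theta 1 v)))).
    by rewrite ler_wpM2l.
  by rewrite Q; lra.
- apply: (@le_trans _ _ (v ^+ 2 * (C * theta 1 v))); first by rewrite ler_wpM2l ?sqr_ge0.
  have -> : v ^+ 2 * (C * theta 1 v) = C * (v ^+ 2 * theta 1 v) by ring.
  lra.
Qed.

End C2.

(** * Moments of the unscaled solution and the effect of the scaling *)

Section Moments.
Context {R : realType} (b p q : R) (f0 : borelProb R) (f : R -> borelProb R).
Hypothesis b1 : 1 < b.
Hypothesis p0 : 0 <= p.
Hypothesis q0 : 0 <= q.
Local Notation RM := (measurableTypeR R).
Local Notation W := (W b).
Local Notation tail := (tail b).
Local Notation dbl := (dbl b).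
Hypothesis iW0 : intg f0 W.
Hypothesis iWf : forall t : R, 0 <= t -> intg (f t) W.
Hypothesis tests : forall phi, test_function phi -> boltz p q f0 f phi.

Let growth := boltz_growth b1 p0 q0 iW0 iWf tests.

Let mid : mR (fun v : R => v). Proof. exact: measurable_id. Qed.

Let msq : mR (fun v : R => v ^+ 2).
Proof. by apply: mR_continuous; exact: continuous_der (@dSqr R). Qed.

Let idW v : `|v| <= 1 * W v. Proof. by rewrite mul1r norm_le_W. Qed.

Let sqW v : `|v ^+ 2| <= 1 * W v.
Proof. by rewrite mul1r ger0_norm ?sqr_ge0// sqr_le_W. Qed.

Lemma intg_id (mu : borelProb R) : intg mu W -> intg mu (fun v => v).
Proof. exact: intg_dom mid idW. Qed.

Lemma intg_sqr (mu : borelProb R) : intg mu W -> intg mu (fun v => v ^+ 2).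
Proof. exact: intg_dom msq sqW. Qed.

(** The gain of the identity is a multiple of the mean. Gronwall's inequality for the mean and for
    its opposite replaces solving the linear equation; [energy_eq] proceeds likewise. *)
Lemma mean_zero t : \int[f0]_v v = 0 -> 0 <= t -> \int[f t]_v v = 0.
Proof.
move=> m0 t0; have [d c e] := growth mid idW.
have G s : 0 <= s -> gain p q (f s) (fun v => v) = (p + q - 1) * \int[f s]_v v.
  move=> s0; have i := intg_id (iWf s0).
  have i1 : intg (f s \x f s)%E (fun z : RM * RM => z.1) by exact: (intg_fst _ i).
  have i2 : intg (f s \x f s)%E (fun z : RM * RM => z.2) by exact: (intg_snd _ i).
  rewrite /gain expB//; last by apply: intgD; exact: intgZ.
  rewrite expD; [|exact: intgZ|exact: intgZ].
  rewrite !expZ// (exp_fst (f s) i) (exp_snd (f s) i); ring.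
have H1 : \int[f t]_v v <= 0.
  have := gronwall (C := p + q - 1) d c _ t0; rewrite e m0 mulr0; apply=> s s0.
  by rewrite G// ltW.
have H2 : - (\int[f t]_v v) <= 0.
  have d' (s : R) : 0 < s -> is_derive s 1 (fun u => - \int[f u]_v v)
      (- gain p q (f s) (fun v => v)).
    by move=> s0; apply: is_deriveN; exact: d.
  have cN : - (\int[f t]_v v) @[t --> 0^'+] --> - \int[f 0]_v v by exact: cvgN.
  have := gronwall (C := p + q - 1) d' cN _ t0.
  rewrite e m0 oppr0 mulr0; apply=> s s0.
  by rewrite (G s (ltW s0)) mulrN.
by apply/eqP; rewrite eq_le H1 -oppr_le0.
Qed.

Lemma energy_eq t : \int[f0]_v v = 0 -> \int[f0]_v (v ^+ 2) = 1 -> 0 <= t ->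
  \int[f t]_v (v ^+ 2) = energy p q t.
Proof.
move=> m0 v1 t0; have [d c e] := growth msq sqW.
pose A := p ^+ 2 + q ^+ 2 - 1.
have G s : 0 <= s -> gain p q (f s) (fun v => v ^+ 2) = A * \int[f s]_v (v ^+ 2).
  move=> s0; have i := intg_id (iWf s0); have j := intg_sqr (iWf s0).
  have i1 : intg (f s \x f s)%E (fun z : RM * RM => z.1 ^+ 2) by exact: (intg_fst _ j).
  have i2 : intg (f s \x f s)%E (fun z : RM * RM => z.2 ^+ 2) by exact: (intg_snd _ j).
  have i12 : intg (f s \x f s)%E (fun z : RM * RM => z.1 * z.2) by exact: (intg_prod i i).
  rewrite /gain.
  transitivity (\int[(f s \x f s)%E]_z ((p ^+ 2 - 1) * z.1 ^+ 2 + (q ^+ 2 * z.2 ^+ 2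
     + (2 * p * q) * (z.1 * z.2)))).
    by apply: eq_Rintegral => z _; ring.
  rewrite expD; [|exact: intgZ|by apply: intgD; exact: intgZ].
  rewrite expD; [|exact: intgZ|exact: intgZ].
  rewrite !expZ// (exp_fst (f s) j) (exp_snd (f s) j) (exp_prod i i).
  by rewrite mean_zero// /A; ring.
have H1 : \int[f t]_v (v ^+ 2) <= energy p q t.
  have := gronwall (C := A) d c _ t0; rewrite e v1 mulr1; apply=> s s0.
  by rewrite G// ltW.
have H2 : - (\int[f t]_v (v ^+ 2)) <= - energy p q t.
  have d' (s : R) : 0 < s -> is_derive s 1 (fun u => - \int[f u]_v (v ^+ 2))
      (- gain p q (f s) (fun v => v ^+ 2)).
    by move=> s0; apply: is_deriveN; exact: d.
  have cN : - (\int[f t]_v v ^+ 2) @[t --> 0^'+] --> - \int[f 0]_v v ^+ 2.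
    exact: cvgN.
  have := gronwall (C := A) d' cN _ t0.
  rewrite e v1 mulrN1; apply=> s s0.
  by rewrite (G s (ltW s0)) mulrN.
by apply/eqP; rewrite eq_le H1 -lerN2.
Qed.

Lemma uniform_W_bound : exists K : R, forall t u, 0 <= u <= t ->
  \int[f u]_v W v <= 2 `^ b + 2 * (expR (K * t) * \int[f0]_v tail 1 v).
Proof.
have [K K0 HK] : exists2 K : R, 0 <= K & forall u, 0 <= u ->
    \int[f u]_v tail 1 v <= expR (K * u) * \int[f0]_v tail 1 v.
  exists (2 * (mixc p q ^+ 2 * dbl (mixc p q))).
    by rewrite mulr_ge0// mulr_ge0 ?sqr_ge0 ?dbl_ge0.
  by move=> u u0; apply: tail_growth.
exists K => t u /andP[u0 ut].
have it : intg (f u) (tail 1) by apply: intg_tail => //; exact: iWf.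
apply: (@le_trans _ _ (\int[f u]_v (2 `^ b + 2 * tail 1 v))).
  apply: exp_le; [exact: iWf|by apply: intgD; [exact: intg_cst|exact: intgZ]|].
  by move=> v; exact: W_le.
rewrite expD; [|exact: intg_cst|exact: intgZ].
rewrite exp_cst expZ// lerD2l ler_wpM2l//; apply: (le_trans (HK u u0)).
rewrite ler_wpM2r ?ler_expR ?ler_wpM2l//.
by apply: exp_ge0 => v; rewrite tail_ge0.
Qed.

Definition rate : R := 2^-1 * (p ^+ 2 + q ^+ 2 - 1).

(** This is E(t)^(-1/2), the dilation that defines the scaled solution, as [sqrt_energy] records. *)
Definition scale (t : R) : R := expR (- rate * t).

Lemma dscale (t : R) : is_derive t 1 scale (- rate * scale t).
Proof.
have d0 : is_derive t 1 (fun t : R => - rate * t) (- rate).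
  by refine (is_derive_eq (dScale (- rate) (dId t)) _); rewrite mulr1.
have := @is_derive1_comp _ expR _ t _ _ (is_derive_expR _) d0.
by move=> H; refine (is_derive_eq H _); rewrite mulrC.
Qed.

Section Scaled.
Variables (phi phi1 phi2 : R -> R) (C : R).
Hypothesis c2 : C2 b phi phi1 phi2 C.

Let dphi : forall v : R, is_derive v 1 phi (phi1 v). Proof. by case: c2. Qed.
Let dphi1 : forall v : R, is_derive v 1 phi1 (phi2 v). Proof. by case: c2. Qed.

Let cphi : mR phi. Proof. by apply: mR_continuous; exact: continuous_der dphi. Qed.

Let mvphi1 : mR (fun v => v * phi1 v).
Proof.
apply: mR_continuous.
exact: (continuous_der (fun v => dMul (dId v) (dphi1 v))).
Qed.

Let mscale (psi : R -> R) (a : R) : mR psi -> mR (fun v => psi (a * v)).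
Proof.
move=> m; have -> : (fun v => psi (a * v)) = (fun v => psi (a * v + 0)).
  by apply/funext => v; rewrite addr0.
exact: mR_affine.
Qed.

Lemma intg_scale (psi : R -> R) (D a t : R) : 0 <= t -> mR psi ->
  (forall v, `|psi v| <= D * W v) -> intg (f t) (fun v => psi (a * v)).
Proof.
move=> t0 m H; have c1 : 1 <= 1 + `|a| by rewrite lerDl.
have D0 : 0 <= D.
  by have := le_trans (normr_ge0 _) (H 0); rewrite pmulr_lge0// W_gt0.
apply: (@intg_dom _ b _ _ (D * dbl (1 + `|a|))); [exact: mscale| |exact: iWf].
move=> v; apply: (le_trans (H _)); rewrite -mulrA ler_wpM2l//.
by apply: W_dbl => //; rewrite normrM mulrDl mul1r lerDr.
Qed.

Let path (v t : R) := phi (scale t * v).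
Let path1 (v t : R) := - rate * (scale t * v * phi1 (scale t * v)).
Let path2 (v t : R) := rate ^+ 2 * (scale t * v * phi1 (scale t * v) +
  (scale t * v) ^+ 2 * phi2 (scale t * v)).

Let dy (v t : R) : is_derive t 1 (fun t => scale t * v) (- rate * (scale t * v)).
Proof.
by refine (is_derive_eq (dMul (dscale t) (dCst v t)) _); ring.
Qed.

Let dpath v (t : R) : is_derive t 1 (path v) (path1 v t).
Proof.
have H := @is_derive1_comp _ phi _ t _ _ (dphi _) (dy v t).
by refine (is_derive_eq H _); rewrite /path1; ring.
Qed.

Let dpath1 v (t : R) : is_derive t 1 (path1 v) (path2 v t).
Proof.
have H := @is_derive1_comp _ phi1 _ t _ _ (dphi1 _) (dy v t).
refine (is_derive_eq (dScale (- rate) (dMul (dy v t) H)) _).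
by rewrite /path2 /=; ring.
Qed.

Let bnd (D t0 t : R) v : 0 <= D -> 0 <= t0 -> `|t| <= t0 ->
  D * W (scale t * v) <= D * (dbl (expR (`|rate| * t0)) * W v).
Proof.
move=> D0 t00 tt; apply: ler_wpM2l => //; apply: W_dbl => //.
  by rewrite -expR0 ler_expR mulr_ge0.
rewrite normrM ler_wpM2r// ger0_norm ?expR_ge0// ler_expR.
by apply: (le_trans (ler_norm _)); rewrite normrM normrN ler_wpM2l.
Qed.

(** Both the measure and the integrand move with time. The integrand frozen at time t is handled by
    [growth]; its own motion is expanded to second order along [path], pointwise in v, and
    integrated against [f u]; the first order term is then moved from [f u] to [f t] by
    continuity. *)
Lemma scaled_derive (t : R) : 0 < t ->
  is_derive t 1 (fun u : R => \int[f u]_v phi (scale u * v))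
    (- rate * \int[f t]_v (scale t * v * phi1 (scale t * v)) +
     gain p q (f t) (fun v => phi (scale t * v))).
Proof.
move=> t0; have [D D0 HD] := C2_growth b1 c2.
have H0 v : `|phi v| <= D * W v by case: (HD v).
have H1 v : `|v * phi1 v| <= D * W v by case: (HD v).
have H2 v : v ^+ 2 * `|phi2 v| <= D * W v by case: (HD v).
have T0 : 0 <= t + 1 by rewrite addr_ge0// ltW.
have [K HK] := uniform_W_bound.
set M := 2 `^ b + 2 * (expR (K * (t + 1)) * \int[f0]_v tail 1 v).
have M0 : 0 <= M.
  rewrite addr_ge0 ?powR_ge0// mulr_ge0// mulr_ge0 ?expR_ge0//.
  by apply: exp_ge0 => v; rewrite tail_ge0.
pose B := dbl (expR (`|rate| * (t + 1))).
have B0 : 0 <= B by exact: dbl_ge0.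
pose psi v := scale t * v * phi1 (scale t * v).
pose ph v := phi (scale t * v).
have mph : mR ph by exact: mscale.
have mpsi : mR psi by exact: (mscale (scale t) mvphi1).
have tt : `|t| <= t + 1 by rewrite gtr0_norm// lerDl.
have gph v : `|ph v| <= (D * B) * W v.
  by apply: (le_trans (H0 _)); rewrite -mulrA; exact: bnd.
have gpsi v : `|psi v| <= (D * B) * W v.
  by apply: (le_trans (H1 _)); rewrite -mulrA; exact: bnd.
have [dph _ _] := growth mph gph; have [dpsi _ _] := growth mpsi gpsi.
have Dph := dph t t0; have Dpsi := dpsi t t0.
have cpsi := is_derive_cts Dpsi.
apply: is_derive_approx => e e0; have e3 : 0 < e / 3 by rewrite divr_gt0.
have [d1 d10 Hd1] := is_derive_approxP Dph e3.
pose L := 2 * rate ^+ 2 * D * B * M.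
have r20 : 0 <= rate ^+ 2 by exact: sqr_ge0.
have L0 : 0 <= L by do 4 rewrite mulr_ge0//.
pose e' := e / 3 / (`|rate| + 1).
have e'0 : 0 < e' by rewrite divr_gt0// ltr_wpDl.
have [d2 /= d20 Hd2] : exists2 d2 : R, 0 < d2 & forall u, `|u - t| < d2 ->
    `|\int[f u]_v psi v - \int[f t]_v psi v| <= e'.
  move/cvgrPdist_le : cpsi => /(_ _ e'0) /nbhs_ballP[d2 /= d20 Hd2].
  by exists d2 => // u ut; rewrite distrC; apply: Hd2; rewrite /ball/= distrC.
pose d := Num.min (Num.min d1 d2) (Num.min (Num.min 1 t) (e / 3 / (L + 1))).
exists d; first by rewrite !lt_min d10 d20 ltr01 t0 divr_gt0// ltr_wpDl.
move=> u; rewrite !lt_min => /andP[/andP[ud1 ud2] /andP[/andP[u1 ut] ue]].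
have u0 : 0 < u by move: ut; rewrite ltr_norml => /andP[? _]; lra.
have uT : u <= t + 1 by move: u1; rewrite ltr_norml => /andP[_ ?]; lra.
have iph s : 0 <= s -> intg (f s) ph by move=> s0; exact: intg_dom mph gph (iWf s0).
have ipsi s : 0 <= s -> intg (f s) psi by move=> s0; exact: intg_dom mpsi gpsi (iWf s0).
have ipu : intg (f u) (fun v => path v u).
  by apply: (intg_scale (psi := phi) (D := D)) => //; exact: ltW.
pose X v := path v u - path v t - (u - t) * (- rate * psi v).
have iX : intg (f u) X.
  apply: intgB; first by apply: intgB => //; exact: iph (ltW u0).
  by do 2 apply: intgZ; exact: ipsi (ltW u0).
have XE v : `|X v| <= 2 * rate ^+ 2 * D * B * `|u - t| ^+ 2 * W v.
  have [th [eta [/andP[t1 t2] /andP[n1 n2] E]]] := taylor2 t (u - t) (dpath v) (dpath1 v).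
  have ut' : t + (u - t) = u by ring.
  rewrite ut' in E; have -> : X v = path v u - path v t - path1 v t * (u - t).
    by rewrite /X /path1 /psi; ring.
  rewrite E; set s := t + th * (u - t).
  have sT : `|s| <= t + 1.
    rewrite /s; apply: (le_trans (ler_normD _ _)); rewrite gtr0_norm// lerD2l.
    by rewrite normrM ger0_norm// mulr_ile1// ltW.
  have P2 : `|path2 v s| <= rate ^+ 2 * (2 * (D * (B * W v))).
    rewrite normrM ger0_norm ?sqr_ge0//; apply: ler_wpM2l; first exact: sqr_ge0.
    apply: (le_trans (ler_normD _ _)); rewrite mulrDl mul1r.
    apply: lerD; first by apply: (le_trans (H1 _)); exact: bnd.
    rewrite normrM (ger0_norm (sqr_ge0 _)).
    by apply: (le_trans (H2 _)); exact: bnd.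
  rewrite normrM; have -> : 2 * rate ^+ 2 * D * B * `|u - t| ^+ 2 * W v =
    rate ^+ 2 * (2 * (D * (B * W v))) * `|u - t| ^+ 2 by ring.
  apply: ler_pM => //; rewrite normrM ger0_norm// normrX.
  by rewrite ler_piMl.
have EX : `|\int[f u]_v X v| <= e / 3 * `|u - t|.
  apply: (@le_trans _ _ (\int[f u]_v (2 * rate ^+ 2 * D * B * `|u - t| ^+ 2 * W v))).
    by apply: exp_norm => //; apply: intgZ; apply: iWf; exact: ltW.
  rewrite expZ; last by apply: iWf; exact: ltW.
  have WM : \int[f u]_v W v <= M by apply: HK; rewrite uT ltW.
  apply: (@le_trans _ _ (2 * rate ^+ 2 * D * B * `|u - t| ^+ 2 * M)).
    by rewrite ler_wpM2l//; do 4 rewrite mulr_ge0 ?sqr_ge0//.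
  have -> : 2 * rate ^+ 2 * D * B * `|u - t| ^+ 2 * M = L * `|u - t| * `|u - t|.
    by rewrite /L; ring.
  rewrite ler_wpM2r//; apply: (@le_trans _ _ ((L + 1) * `|u - t|)).
    by rewrite ler_wpM2r// lerDl.
  by rewrite mulrC -ler_pdivlMr ?ltr_wpDl// ltW.
have XX : \int[f u]_v X v = \int[f u]_v path v u - \int[f u]_v ph v -
    (u - t) * (- rate * \int[f u]_v psi v).
  rewrite /X expB; last 2 first.
  - by apply: intgB => //; exact: iph (ltW u0).
  - by do 2 apply: intgZ; exact: ipsi (ltW u0).
  rewrite expB//; last exact: iph (ltW u0).
  rewrite !expZ//; [exact: ipsi (ltW u0)|by apply: intgZ; exact: ipsi (ltW u0)].
have E2 : `|(u - t) * (- rate * (\int[f u]_v psi v - \int[f t]_v psi v))| <= e / 3 * `|u - t|.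
  rewrite normrM mulrC ler_wpM2r// normrM normrN.
  apply: (@le_trans _ _ ((`|rate| + 1) * e')).
    by apply: ler_pM => //; [rewrite lerDl|exact: Hd2].
  by rewrite /e' mulrC divfK// gt_eqF// ltr_wpDl.
have E1 := Hd1 u ud1.
set g := gain _ _ _ _ in E1 *.
have -> : \int[f u]_v phi (scale u * v) - \int[f t]_v phi (scale t * v) -
    (u - t) * (- rate * \int[f t]_v (scale t * v * phi1 (scale t * v)) + g) =
  \int[f u]_v X v + (u - t) * (- rate * (\int[f u]_v psi v - \int[f t]_v psi v)) +
  (\int[f u]_v ph v - \int[f t]_v ph v - (u - t) * g).
  by rewrite XX /ph /psi /path; ring.
apply: (le_trans (ler_normD _ _)).
apply: (le_trans (lerD (ler_normD _ _) (lexx _))).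
apply: (le_trans (lerD (lerD EX E2) E1)).
rewrite -!mulrDl ler_wpM2r//; lra.
Qed.

Lemma scaled_cvg0 :
  \int[f t]_v phi (scale t * v) @[t --> 0^'+] --> \int[f0]_v phi v.
Proof.
have [D D0 HD] := C2_growth b1 c2.
have H0 v : `|phi v| <= D * W v by case: (HD v).
have H1 v : `|v * phi1 v| <= D * W v by case: (HD v).
have [K HK] := uniform_W_bound.
set M := 2 `^ b + 2 * (expR (K * 1) * \int[f0]_v tail 1 v) in HK.
have M0 : 0 <= M.
  rewrite addr_ge0 ?powR_ge0// mulr_ge0// mulr_ge0 ?expR_ge0//.
  by apply: exp_ge0 => v; rewrite tail_ge0.
pose B := dbl (expR (`|rate| * 1)).
have B0 : 0 <= B by exact: dbl_ge0.
pose L := `|rate| * D * B * M.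
have L0 : 0 <= L by rewrite !mulr_ge0.
have [_ c e] := growth cphi H0.
have close t : 0 < t -> t <= 1 ->
    `|\int[f t]_v phi (scale t * v) - \int[f t]_v phi v| <= L * t.
  move=> t0 t1; rewrite -expB; last 2 first.
  - by apply: (intg_scale (psi := phi) (D := D)) => //; exact: ltW.
  - by apply: intg_dom cphi H0 _; apply: iWf; exact: ltW.
  apply: (@le_trans _ _ (\int[f t]_v (`|rate| * D * B * t * W v))).
    apply: exp_norm.
    + apply: intgB; first by apply: (intg_scale (psi := phi) (D := D)) => //; exact: ltW.
      by apply: intg_dom cphi H0 _; apply: iWf; exact: ltW.
    + by apply: intgZ; apply: iWf; exact: ltW.
    + move=> v; have [th /andP[th0 th1] E] := mvt_th 0 t (dpath v).
      have pv : phi v = path v 0 by rewrite /path /scale mulr0 expR0 mul1r.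
      rewrite pv E subr0 add0r normrM (gtr0_norm t0).
      have -> : `|rate| * D * B * t * W v = `|rate| * (D * (B * W v)) * t by ring.
      apply: ler_wpM2r; first exact: ltW.
      rewrite /path1 normrM normrN; apply: ler_wpM2l => //.
      apply: (le_trans (H1 _)); apply: bnd => //.
      by rewrite normrM !ger0_norm ?(ltW t0)// mulr_ile1// ltW.
  rewrite expZ; last by apply: iWf; exact: ltW.
  have -> : L * t = `|rate| * D * B * t * M by rewrite /L; ring.
  apply: ler_wpM2l; first by rewrite !mulr_ge0// ltW.
  by apply: HK; rewrite t1 ltW.
apply/cvgrPdist_le => ee ee0; have e2 : 0 < ee / 2 by rewrite divr_gt0.
have c1 : \forall t \near (0 : R)^'+,
    `|\int[f 0]_v phi v - \int[f t]_v phi v| <= ee / 2.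
  by move/cvgrPdist_le : c; apply.
have c2' : \forall t \near (0 : R)^'+, 0 < t by exact: nbhs_right_gt.
have c3 : \forall t \near (0 : R)^'+, t <= Num.min 1 (ee / 2 / (L + 1)).
  by apply: nbhs_right_le; rewrite lt_min ltr01 divr_gt0// ltr_wpDl.
suff : \forall t \near (0 : R)^'+,
    `|\int[f0]_v phi v - \int[f t]_v phi (scale t * v)| <= ee by [].
apply: filterS3 c1 c2' c3 => t h1 t0; rewrite le_min => /andP[t1 te].
have h2 := close t t0 t1; rewrite -e.
have h3 : L * t <= ee / 2.
  apply: (@le_trans _ _ ((L + 1) * t)); first by rewrite ler_wpM2r ?(ltW t0)// lerDl.
  by rewrite mulrC -ler_pdivlMr ?ltr_wpDl.
move: h1 (le_trans h2 h3); rewrite !ler_norml => /andP[? ?] /andP[? ?].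
by apply/andP; split; lra.
Qed.

End Scaled.

End Moments.

(** * Transport of integrals and of the gain by a dilation *)

Section Pushforward.
Context {R : realType} (b : R).
Hypothesis b1 : 1 < b.
Local Notation RM := (measurableTypeR R).
Local Notation W := (W b).
Variables (mu : borelProb R) (c : R).
Hypothesis iW : intg mu W.
Local Notation nu := (distribution mu (dilation c)).

Lemma mR_dilation (phi : R -> R) : mR phi -> mR (fun v => phi (c * v)).
Proof.
move=> m; have -> : (fun v => phi (c * v)) = (fun v => phi (c * v + 0)).
  by apply/funext => v; rewrite addr0.
exact: mR_affine.
Qed.

Lemma W_dilation v : W (c * v) <= dbl b (1 + `|c|) * W v.
Proof.
by apply: W_dbl => //; rewrite ?lerDl// normrM mulrDl mul1r lerDr.
Qed.

Lemma growth_ge0 (phi : R -> R) C : (forall v, `|phi v| <= C * W v) -> 0 <= C.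
Proof.
by move=> H; have := le_trans (normr_ge0 _) (H 0); rewrite pmulr_lge0// W_gt0.
Qed.

Lemma intg_dilation (phi : R -> R) C : mR phi -> (forall v, `|phi v| <= C * W v) ->
  intg mu (fun v => phi (c * v)).
Proof.
move=> m H; apply: (@intg_dom _ b _ _ (C * dbl b (1 + `|c|))) => //.
  exact: mR_dilation.
move=> v; apply: (le_trans (H _)); rewrite -mulrA ler_wpM2l//.
  exact: growth_ge0 H.
exact: W_dilation.
Qed.

Lemma exp_dilation (phi : R -> R) C : mR phi -> (forall v, `|phi v| <= C * W v) ->
  \int[nu]_v phi v = \int[mu]_v phi (c * v).
Proof.
move=> m H; rewrite (@exp_distribution _ _ RM RM R mu _ phi)//.
exact: intg_dilation H.
Qed.

Lemma intg_W_dilation : intg nu W.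
Proof.
have mW : mR W by exact: mR_W.
apply/integrableP; split; first exact/measurable_EFinP.
rewrite ge0_integral_distribution//; last first.
  by apply: measurableT_comp => //; exact/measurable_EFinP.
have HW v : `|W v| <= 1 * W v by rewrite mul1r ger0_norm// ltW// W_gt0.
by have /integrableP[_] := intg_dilation mW HW.
Qed.

(** Collisions are linear in the velocities and so commute with dilations. Fubini's theorem reduces
    the change of variable on the product to two on the line. *)
Lemma gain_dilation (p q : R) (phi : R -> R) C : 0 <= p -> 0 <= q ->
  mR phi -> (forall v, `|phi v| <= C * W v) ->
  gain p q nu phi = gain p q mu (fun v => phi (c * v)).
Proof.
move=> p0 q0 m H; have iWn := intg_W_dilation.
have C0 := growth_ge0 H.
pose F (z : RM * RM) := phi (p * z.1 + q * z.2) - phi z.1.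
have dF : dom2 b F by apply: dom2B; [exact: dom2_mix H|exact: dom2_fst H].
have [mF [D HD]] := dF.
have D0 : 0 <= D.
  have := le_trans (normr_ge0 _) (HD (0, 0)) => /=.
  by rewrite pmulr_lge0// addr_gt0// W_gt0.
pose ps v := phi (c * v).
have mps : mR ps by exact: mR_dilation.
have psC v : `|ps v| <= C * dbl b (1 + `|c|) * W v.
  by apply: (le_trans (H _)); rewrite -mulrA ler_wpM2l//; exact: W_dilation.
pose G (z : RM * RM) := ps (p * z.1 + q * z.2) - ps z.1.
have dG : dom2 b G by apply: dom2B; [exact: dom2_mix psC|exact: dom2_fst psC].
have GE x y : G (x, y) = F (c * x, c * y).
  by rewrite /G /F /ps /=; congr (phi _ - _); ring.
have mFy y : mR (fun x => F (x, y)).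
  have -> : (fun x => F (x, y)) = (fun x => phi (p * x + q * y) - phi x) by [].
  by apply: measurable_funB; [exact: (mR_affine p (q * y) m)|exact: m].
have FyC y v : `|F (v, y)| <= D * (1 + W y) * W v.
  apply: (le_trans (HD _)) => /=; rewrite -mulrA ler_wpM2l//.
  rewrite mulrDl mul1r lerD2l ler_peMr ?W_ge1//; exact/ltW/W_gt0.
have iFy (la : borelProb R) y : intg la W -> intg la (fun x => F (x, y)).
  by move=> i; apply: intg_dom (mFy y) (FyC y) i.
have iGy y : intg mu (fun x => G (x, y)).
  have -> : (fun x => G (x, y)) = (fun x => F (c * x, c * y)).
    by apply/funext => x; rewrite GE.
  by apply: intg_dilation (mFy _) (FyC _).
pose H1 y := \int[nu]_x F (x, y).
have mH1 : mR H1.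
  by apply: (measurable_exp2 (intg_dom2 dF iWn iWn)) => y; exact: iFy.
have HC y : `|H1 y| <= (D * (\int[nu]_x W x + 1)) * W y.
  have i1 : intg nu (fun x => D * (W x + W y)).
    by apply: intgZ; apply: intgD => //; exact: intg_cst.
  apply: (@le_trans _ _ (\int[nu]_x (D * (W x + W y)))).
    by apply: exp_norm; [exact: iFy|exact: i1|move=> x; exact: HD].
  rewrite expZ; last by apply: intgD => //; exact: intg_cst.
  rewrite expD//; last exact: intg_cst.
  rewrite exp_cst -mulrA ler_wpM2l// mulrDl mul1r lerD2r ler_peMr ?W_ge1//.
  by apply: exp_ge0 => x; exact/ltW/W_gt0.
transitivity (\int[nu]_y H1 y).
  rewrite /gain (exp_fubini2 (intg_dom2 dF iWn iWn))// => y; exact: iFy.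
transitivity (\int[mu]_y H1 (c * y)).
  exact: exp_dilation HC.
transitivity (\int[mu]_y \int[mu]_x G (x, y)).
  apply: eq_Rintegral => y _; rewrite /H1.
  transitivity (\int[mu]_x F (c * x, c * y)).
    exact: (exp_dilation (mFy (c * y)) (FyC (c * y))).
  by apply: eq_Rintegral => x _; rewrite GE.
by rewrite /gain (exp_fubini2 (intg_dom2 dG iW iW)).
Qed.

End Pushforward.

(** * The scaled solution in the time tau *)

Section Rescaled.
Context {R : realType} (b lambda : R).
Hypothesis b1 : 1 < b.
Local Notation RM := (measurableTypeR R).
Local Notation W := (W b).

(* Second-order Taylor remainder of the collision [v -> v + (k v + q w)], where
   [k = p - 1]. *)
Definition remainder (phi phi1 : R -> R) (k q : R) (z : RM * RM) : R :=
  phi (z.1 + (k * z.1 + q * z.2)) - phi z.1 - phi1 z.1 * (k * z.1 + q * z.2).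

(** The later estimates see the solution only through these facts, where k stands for p - 1 and time
    is tau = q^2 t. The drift coefficient is free of q, because the first order part of the
    collision has been merged into it. *)
Record evolution (k q : R) (f0 : borelProb R) (h : R -> borelProb R) : Prop := {
  evo_W : forall t : R, 0 <= t -> intg (h t) W ;
  evo_mean : forall t : R, 0 <= t -> \int[h t]_v v = 0 ;
  evo_energy : forall t : R, 0 <= t -> \int[h t]_v (v ^+ 2) = 1 ;
  evo_derive : forall phi phi1 phi2 C, C2 b phi phi1 phi2 C ->
    forall t : R, 0 < t -> is_derive t 1 (fun u : R => \int[h u]_v phi v)
      (- (2^-1 * (1 + lambda ^+ 2)) * \int[h t]_v (v * phi1 v) +
       q ^- 2 * \int[(h t \x h t)%E]_z remainder phi phi1 k q z) ;
  evo_cvg0 : forall phi phi1 phi2 C, C2 b phi phi1 phi2 C ->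
    \int[h t]_v phi v @[t --> 0^'+] --> \int[h 0]_v phi v ;
  evo_init : forall phi C, mR phi -> (forall v, `|phi v| <= C * W v) ->
    \int[h 0]_v phi v = \int[f0]_v phi v }.

Lemma dom2_remainder phi phi1 phi2 C (k q : R) (mu nu : borelProb R) :
  C2 b phi phi1 phi2 C -> 0 <= 1 + k -> 0 <= q -> intg mu W -> intg nu W ->
  intg (mu \x nu)%E (remainder phi phi1 k q).
Proof.
move=> c2 k0 q0 iW iW'; have [D D0 HD] := C2_growth b1 c2.
have [d1 d2 _] := c2.
have m0 : mR phi by apply: mR_continuous; exact: continuous_der d1.
have m1 : mR phi1 by apply: mR_continuous; exact: continuous_der d2.
have m2 : mR (fun v => v * phi1 v).
  by apply: mR_continuous; exact: (continuous_der (fun v => dMul (dId v) (d2 v))).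
have H0 v : `|phi v| <= D * W v by case: (HD v).
have H1 v : `|phi1 v| <= D * W v by case: (HD v).
have H2 v : `|v * phi1 v| <= D * W v by case: (HD v).
have dF : dom2 b (fun z => phi ((1 + k) * z.1 + q * z.2) - phi z.1).
  by apply: dom2B; [exact: dom2_mix H0|exact: dom2_fst H0].
have i1 := intg_dom2 dF iW iW'.
have i2 : intg (mu \x nu)%E (fun z : RM * RM => z.1 * phi1 z.1).
  exact: (intg_fst nu (intg_dom m2 H2 iW)).
have i3 : intg (mu \x nu)%E (fun z : RM * RM => phi1 z.1 * z.2).
  exact: (intg_prod (intg_dom m1 H1 iW) (intg_id b1 iW')).
have := intgB i1 (intgD (intgZ k i2) (intgZ q i3)).
congr intg; apply/funext => z; rewrite /remainder.
have -> : (1 + k) * z.1 + q * z.2 = z.1 + (k * z.1 + q * z.2) by ring.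
by ring.
Qed.

(** The first order term [q * (phi1 v * w)] integrates to a product containing the mean, which is
    0. *)
Lemma gain_remainder phi phi1 phi2 C (p q : R) (mu : borelProb R) :
  C2 b phi phi1 phi2 C -> 0 <= p -> 0 <= q -> intg mu W -> \int[mu]_v v = 0 ->
  gain p q mu phi = (p - 1) * \int[mu]_v (v * phi1 v) +
    \int[(mu \x mu)%E]_z remainder phi phi1 (p - 1) q z.
Proof.
move=> c2 p0 q0 iW m; have [D D0 HD] := C2_growth b1 c2.
have [d1 d2 _] := c2.
have m1 : mR phi1 by apply: mR_continuous; exact: continuous_der d2.
have m2 : mR (fun v => v * phi1 v).
  by apply: mR_continuous; exact: (continuous_der (fun v => dMul (dId v) (d2 v))).
have H1 v : `|phi1 v| <= D * W v by case: (HD v).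
have H2 v : `|v * phi1 v| <= D * W v by case: (HD v).
have k0 : 0 <= 1 + (p - 1) by rewrite addrC subrK.
have ir := dom2_remainder c2 k0 q0 iW iW.
have j2 := intg_dom m2 H2 iW; have j1 := intg_dom m1 H1 iW.
have jid := intg_id b1 iW.
have i2 : intg (mu \x mu)%E (fun z : RM * RM => z.1 * phi1 z.1) := intg_fst mu j2.
have i3 : intg (mu \x mu)%E (fun z : RM * RM => phi1 z.1 * z.2) := intg_prod j1 jid.
rewrite /gain; transitivity (\int[(mu \x mu)%E]_z ((p - 1) * (z.1 * phi1 z.1) +
    (q * (phi1 z.1 * z.2) + remainder phi phi1 (p - 1) q z))).
  apply: eq_Rintegral => z _; rewrite /remainder.
  have -> : z.1 + ((p - 1) * z.1 + q * z.2) = p * z.1 + q * z.2 by ring.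
  by ring.
rewrite expD; [|exact: intgZ|by apply: intgD => //; exact: intgZ].
rewrite expD//; last exact: intgZ.
by rewrite !expZ// (exp_fst mu j2) (exp_prod j1 jid) m !mulr0 add0r.
Qed.

Lemma sqrt_energy (p q t : R) : (Num.sqrt (energy p q t))^-1 = scale p q t.
Proof.
rewrite /energy /scale /rate.
have -> : expR ((p ^+ 2 + q ^+ 2 - 1) * t) =
    expR (2^-1 * (p ^+ 2 + q ^+ 2 - 1) * t) ^+ 2.
  by rewrite [RHS]expr2 -expRD; congr expR; field.
by rewrite sqrtr_sqr ger0_norm ?expR_ge0// mulNr expRN.
Qed.

Lemma evolution_scaled (p q : R) (f0 : borelProb R) (f : R -> borelProb R) : 0 < q -> q < p ->
  (p - 1) ^+ 2 = lambda ^+ 2 * q ^+ 2 ->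
  intg f0 W -> (forall t : R, 0 <= t -> intg (f t) W) ->
  (forall phi, test_function phi -> boltz p q f0 f phi) ->
  \int[f0]_v v = 0 -> \int[f0]_v (v ^+ 2) = 1 ->
  evolution (p - 1) q f0 (fun t => scaled_solution p q f (t / q ^+ 2)).
Proof.
move=> qp qlp lam iW0 iWf tests m0 v1.
have q0 := ltW qp; have p0 : 0 <= p by rewrite ltW// (lt_trans qp).
have q20 : 0 < q ^+ 2 by rewrite exprn_gt0.
have tq t : 0 <= t -> 0 <= t / q ^+ 2 by move=> t0; rewrite divr_ge0// ltW.
have growth := boltz_growth b1 p0 q0 iW0 iWf tests.
have sE phi C u : 0 <= u -> mR phi -> (forall v, `|phi v| <= C * W v) ->
    \int[scaled_solution p q f u]_v phi v = \int[f u]_v phi (scale p q u * v).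
  move=> u0 m H; rewrite -sqrt_energy; exact: (exp_dilation b1 _ (iWf u u0) m H).
have iWs u : 0 <= u -> intg (scaled_solution p q f u) W.
  by move=> u0; apply: intg_W_dilation => //; exact: iWf.
have mid : mR (fun v : R => v) by exact: measurable_id.
have msq : mR (fun v : R => v ^+ 2).
  by apply: mR_continuous; exact: continuous_der (@dSqr R).
have idW v : `|v| <= 1 * W v by rewrite mul1r norm_le_W.
have sqW v : `|v ^+ 2| <= 1 * W v by rewrite mul1r ger0_norm ?sqr_ge0// sqr_le_W.
have mean u : 0 <= u -> \int[scaled_solution p q f u]_v v = 0.
  move=> u0; rewrite (sE _ _ _ u0 mid idW) expZ; last first.
    exact: (intg_id b1 (iWf u u0)).
  by rewrite (mean_zero b1 p0 q0 iW0 iWf tests m0 u0) mulr0.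
split.
- by move=> t t0; apply: iWs; exact: tq.
- by move=> t t0; apply: mean; exact: tq.
- move=> t /tq; set u := t / _ => u0; rewrite (sE _ _ _ u0 msq sqW).
  transitivity (\int[f u]_v (scale p q u ^+ 2 * v ^+ 2)).
    by apply: eq_Rintegral => v _; rewrite exprMn.
  rewrite expZ; last exact: (intg_sqr b1 (iWf u u0)).
  rewrite (energy_eq b1 p0 q0 iW0 iWf tests m0 v1 u0) /scale /energy /rate.
  set A := _ + _ - 1; rewrite [X in X * _]expr2 -!expRD -[RHS]expR0.
  by congr expR; field.
- move=> phi phi1 phi2 C c2 t t0; set u := t / q ^+ 2.
  have u0 : 0 < u by rewrite divr_gt0.
  have [D D0 HD] := C2_growth b1 c2; have [d1 d2 _] := c2.
  have H0 v : `|phi v| <= D * W v by case: (HD v).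
  have H1 v : `|v * phi1 v| <= D * W v by case: (HD v).
  have mp : mR phi by apply: mR_continuous; exact: continuous_der d1.
  have mp1 : mR (fun v => v * phi1 v).
    by apply: mR_continuous; exact: (continuous_der (fun v => dMul (dId v) (d2 v))).
  have Du := scaled_derive b1 p0 q0 iW0 iWf tests c2 u0.
  rewrite -(sE _ _ _ (ltW u0) mp1 H1) in Du.
  have G : gain p q (f u) (fun v => phi (scale p q u * v)) =
      gain p q (scaled_solution p q f u) phi.
    by rewrite -sqrt_energy -(gain_dilation b1 _ (iWf u (ltW u0)) p0 q0 mp H0).
  rewrite G (gain_remainder c2 p0 q0 (iWs u (ltW u0)) (mean u (ltW u0))) in Du.
  have dl : is_derive t 1 (fun t : R => q ^- 2 * t) (q ^- 2).
    by refine (is_derive_eq (dScale _ (dId t)) _); rewrite mulr1.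
  have uE : u = q ^- 2 * t by rewrite /u mulrC.
  rewrite {1}uE in Du.
  have Dc := @is_derive1_comp R (fun u => \int[f u]_v phi (scale p q u * v))
    (fun t : R => q ^- 2 * t) t _ _ Du dl.
  have Ds : is_derive t 1 (fun t => \int[scaled_solution p q f (t / q ^+ 2)]_v phi v)
      ((- rate p q * \int[scaled_solution p q f u]_v (v * phi1 v) +
        ((p - 1) * \int[scaled_solution p q f u]_v (v * phi1 v) +
         \int[(scaled_solution p q f u \x scaled_solution p q f u)%E]_z
            remainder phi phi1 (p - 1) q z)) * q ^- 2).
    (* The change of variable [sE] holds at nonnegative times only, so the two functions are
       identified near t. *)
    apply: (near_eq_is_derive _ Dc).
    have : \forall s \near t, 0 < s by exact: lt_nbhsr.
    apply: filterS => s s0 /=.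
    rewrite -(sE _ _ _ _ mp H0); first by rewrite mulrC.
    by rewrite mulrC tq// ltW.
  refine (is_derive_eq Ds _).
  set I := \int[scaled_solution p q f u]_v (v * phi1 v); set J := \int[_]_z remainder _ _ _ _ z.
  (* From p^2 - 1 = 2 k + k^2, the rate is k plus a term of order q^2. The k cancels the first order
     part of the gain, which after division by q^2 would be of order 1/q. *)
  have rE : rate p q = (p - 1) + 2^-1 * (1 + lambda ^+ 2) * q ^+ 2.
    rewrite /rate; have -> : p ^+ 2 + q ^+ 2 - 1 = 2 * (p - 1) + (p - 1) ^+ 2 + q ^+ 2 by ring.
    by rewrite lam; field.
  by rewrite rE; field; rewrite gt_eqF.
- move=> phi phi1 phi2 C c2.
  have [D D0 HD] := C2_growth b1 c2; have [d1 d2 _] := c2.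
  have H0 v : `|phi v| <= D * W v by case: (HD v).
  have mp : mR phi by apply: mR_continuous; exact: continuous_der d1.
  have c0 := scaled_cvg0 b1 p0 q0 iW0 iWf tests c2.
  have [_ _ e] := growth _ _ mp H0.
  rewrite mul0r (sE _ _ _ (lexx 0) mp H0).
  have -> : \int[f 0]_v phi (scale p q 0 * v) = \int[f0]_v phi v.
    by rewrite -e; apply: eq_Rintegral => v _; rewrite /scale mulr0 expR0 mul1r.
  apply/cvgrPdist_le => ee ee0.
  have [d /= d0 Hd] : exists2 d : R, 0 < d & forall u, 0 < u -> u < d ->
     `|\int[f0]_v phi v - \int[f u]_v phi (scale p q u * v)| <= ee.
    have c1 : \forall u \near (0 : R)^'+,
       `|\int[f0]_v phi v - \int[f u]_v phi (scale p q u * v)| <= ee.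
      by move/cvgrPdist_le : c0; apply.
    have [d /= d0 Hd] := c1; exists d => // u u0 ud; apply: Hd => //=.
    by rewrite sub0r normrN gtr0_norm.
  have c2' : \forall t \near (0 : R)^'+, 0 < t by exact: nbhs_right_gt.
  have c3 : \forall t \near (0 : R)^'+, t < d * q ^+ 2.
    by apply: nbhs_right_lt; rewrite mulr_gt0.
  suff : \forall t \near (0 : R)^'+,
      `|\int[f0]_v phi v - \int[scaled_solution p q f (t / q ^+ 2)]_v phi v| <= ee by [].
  apply: filterS2 c2' c3 => t t0 td; rewrite (sE _ _ _ (tq _ (ltW t0)) mp H0).
  by apply: Hd; rewrite ?divr_gt0// ltr_pdivrMr.
- move=> phi C mp H0; have [_ _ e] := growth _ _ mp H0.
  rewrite mul0r (sE _ _ _ (lexx 0) mp H0) -e.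
  by apply: eq_Rintegral => v _; rewrite /scale mulr0 expR0 mul1r.
Qed.

End Rescaled.

(** * Estimates uniform in q *)

(** Only x is confined to [-A, A]; y may leave the segment, as the end of a jump may. The covering
    property of the compact segment gives this form directly. *)
Lemma heine {R : realType} (phi : R -> R) (A e : R) : continuous phi -> 0 < e ->
  exists2 d : R, 0 < d & forall x y, `|x| <= A -> `|y - x| < d -> `|phi y - phi x| <= e.
Proof.
move=> cphi e0.
pose P (d x : R) := forall y, `|y - x| < d -> `|phi y - phi x| <= e.
have := (compact_near_coveringP `[- A, A]%classic).1 (@segment_compact R (- A) A).
move=> /(_ R (0 : R)^'+ P _) cov.
have {cov} : \forall d \near (0 : R)^'+, `[- A, A]%classic `<=` P d.
  apply: cov => x _.
  have e2 : 0 < e / 2 by rewrite divr_gt0.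
  have /cvgrPdist_le /(_ _ e2) /nbhs_ballP [d /= d0 Hd] := cphi x.
  have d2 : 0 < d / 2 by rewrite divr_gt0.
  exists (ball x (d / 2), [set u | u < d / 2]) => /=.
    split; first exact: nbhsx_ballx.
    exact: nbhs_right_lt.
  move=> [x' u] /= [xx' ud] y yx'.
  rewrite /ball/= in xx'.
  have h1 : `|phi x - phi x'| <= e / 2.
    by apply: Hd; rewrite /ball/= (lt_trans xx')// ltr_pdivrMr// ltr_pMr// ltr1n.
  have h2 : `|phi x - phi y| <= e / 2.
    apply: Hd; rewrite /ball/=; have -> : x - y = (x - x') - (y - x') by ring.
    apply: (le_lt_trans (ler_normB _ _)); rewrite [ltRHS]splitr.
    by apply: ltrD => //; exact: lt_trans yx' ud.
  have -> : phi y - phi x' = (phi x - phi x') - (phi x - phi y) by ring.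
  by rewrite (le_trans (ler_normB _ _))// [leRHS]splitr lerD.
move=> H; have [d [d0 Hd]] := filter_ex (filterI (nbhs_right_gt (0 : R)) H).
exists d => // x y xA; apply: Hd.
by rewrite /= in_itv/= -ler_norml.
Qed.

Section Estimates.
Context {R : realType} (b lambda Q : R) (f0 : borelProb R).
Hypothesis b1 : 1 < b.
Hypothesis Q0 : 0 <= Q.
Local Notation RM := (measurableTypeR R).
Local Notation W := (W b).
Local Notation theta := (theta b).
Local Notation tail := (tail b).
Hypothesis iW0 : intg f0 W.

(** The shift k = p - 1 may have either sign. [Q] bounds all the values of q: constants may depend
    on [Q], never on q. *)
Definition admissible (k q : R) : Prop :=
  [/\ 0 < q, q <= Q, 0 <= 1 + k & k ^+ 2 = lambda ^+ 2 * q ^+ 2].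

(** With |k| = |lambda| q, a jump is at most q [lam1] times the larger velocity; [jumpc] then bounds
    every intermediate point of the jump, uniformly for q <= Q. *)
Definition lam1 : R := `|lambda| + 1.

Definition jumpc : R := 1 + Q * lam1.

Let lam1_ge0 : 0 <= lam1. Proof. by rewrite addr_ge0. Qed.

Let jumpc_ge1 : 1 <= jumpc. Proof. by rewrite lerDl mulr_ge0. Qed.

Section Jump.
Variables (k q : R).
Hypothesis adm : admissible k q.

Let q0 : 0 < q. Proof. by case: adm. Qed.

Lemma jump_le (v w : R) : `|k * v + q * w| <= q * lam1 * Num.max `|v| `|w|.
Proof.
have [_ _ _ kk] := adm; have qp := ltW q0.
have kE : `|k| = `|lambda| * q.
  apply: (pexpIrn (n := 2)) => //; rewrite ?nnegrE ?mulr_ge0//.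
  by rewrite exprMn !real_normK ?num_real.
apply: (le_trans (ler_normD _ _)); rewrite !normrM kE (gtr0_norm q0).
have -> : q * lam1 * Num.max `|v| `|w| = `|lambda| * q * Num.max `|v| `|w| +
   q * Num.max `|v| `|w| by rewrite /lam1; ring.
by apply: lerD; apply: ler_wpM2l; rewrite ?mulr_ge0// le_max lexx ?orbT.
Qed.

Lemma jump_mid (th v w : R) : 0 <= th <= 1 ->
  `|v + th * (k * v + q * w)| <= jumpc * Num.max `|v| `|w|.
Proof.
move=> /andP[t0 t1]; have [_ qQ _ _] := adm.
apply: (le_trans (ler_normD _ _)); rewrite /jumpc mulrDl mul1r.
apply: lerD; first by rewrite le_max lexx.
rewrite normrM ger0_norm//.
apply: (le_trans (ler_piMl (normr_ge0 _) t1)); apply: (le_trans (jump_le v w)).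
by apply: ler_wpM2r; [rewrite le_max normr_ge0|exact: ler_wpM2r].
Qed.

Lemma max_tail r (v w : R) : 1 <= r ->
  (Num.max `|v| `|w|) ^+ 2 * theta r (Num.max `|v| `|w|) <= tail r v + tail r w.
Proof.
move=> r1.
have E x : `|x| ^+ 2 * theta r `|x| = tail r x.
  exact: tail_normE.
have [vw|wv] := leP `|v| `|w|; rewrite E.
- by rewrite lerDr tail_ge0.
- by rewrite lerDl tail_ge0.
Qed.

(** The squared jump supplies the q^2 that compensates the factor [q ^- 2] of the evolution. The
    rest is [theta r] at the larger velocity times its square, that is, a tail. *)
Lemma remainder_le phi phi1 phi2 (C r : R) (z : RM * RM) : 1 <= r ->
  (forall v : R, is_derive v 1 phi (phi1 v)) ->
  (forall v : R, is_derive v 1 phi1 (phi2 v)) -> 0 <= C ->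
  (forall v, `|phi2 v| <= C * theta r v) ->
  `|remainder phi phi1 k q z| <=
    q ^+ 2 * (C * dbl b jumpc * lam1 ^+ 2) * (tail r z.1 + tail r z.2).
Proof.
move=> r1 d1 d2 C0 B; rewrite /remainder.
have [th [eta [t01 /andP[e0 e1] ->]]] := taylor2 z.1 (k * z.1 + q * z.2) d1 d2.
set m := Num.max `|z.1 : R| `|z.2 : R|.
have m0 : 0 <= m by rewrite le_max normr_ge0.
have H1 : `|phi2 (z.1 + th * (k * z.1 + q * z.2))| <= C * (dbl b jumpc * theta r m).
  apply: (le_trans (B _)); apply: ler_wpM2l => //; apply: theta_dbl => //.
  by rewrite (ger0_norm m0); exact: jump_mid.
have H2 : `|eta * (k * z.1 + q * z.2) ^+ 2| <= (q * lam1 * m) ^+ 2.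
  rewrite normrM ger0_norm// normrX.
  apply: (@le_trans _ _ (`|k * z.1 + q * z.2| ^+ 2)); first by rewrite ler_piMl.
  by rewrite lerXn2r ?nnegrE ?mulr_ge0// ?(ltW q0)//; exact: jump_le.
rewrite normrM; apply: (le_trans (ler_pM _ _ H1 H2)) => //.
have -> : C * (dbl b jumpc * theta r m) * (q * lam1 * m) ^+ 2 =
  q ^+ 2 * (C * dbl b jumpc * lam1 ^+ 2) * (m ^+ 2 * theta r m) by ring.
apply: ler_wpM2l; last exact: max_tail.
by rewrite mulr_ge0 ?sqr_ge0// mulr_ge0 ?sqr_ge0// mulr_ge0// dbl_ge0.
Qed.

(** The constant [D] ensures integrability, while the bound itself uses the sharper weight
    [theta r]. Thus for phi = [tail r] the right side is again the integral of [tail r], and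
    Gronwall's inequality closes. *)
Lemma remainder_exp phi phi1 phi2 (C D r : R) (mu : borelProb R) : 1 <= r ->
  C2 b phi phi1 phi2 D -> 0 <= C ->
  (forall v, `|phi2 v| <= C * theta r v) -> intg mu W ->
  `|q ^- 2 * \int[(mu \x mu)%E]_z remainder phi phi1 k q z| <=
    (2 * (C * dbl b jumpc * lam1 ^+ 2)) * \int[mu]_v tail r v.
Proof.
move=> r1 c2 C0 B iW; have [d1 d2 _] := c2; have [_ _ k0 _] := adm.
have it : intg mu (tail r) by exact: intg_tail.
set K := C * dbl b jumpc * lam1 ^+ 2.
have ir := dom2_remainder b1 c2 k0 (ltW q0) iW iW.
have q20 : 0 < q ^+ 2 by rewrite exprn_gt0.
have : `|\int[(mu \x mu)%E]_z remainder phi phi1 k q z| <=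
    \int[(mu \x mu)%E]_z (q ^+ 2 * K * (tail r z.1 + tail r z.2)).
  apply: exp_norm; [exact: ir| |].
  - by apply: intgZ; apply: intgD; [exact: intg_fst|exact: intg_snd].
  - by move=> z; apply: (remainder_le _ r1 d1 d2).
rewrite expZ; last by apply: intgD; [exact: intg_fst|exact: intg_snd].
rewrite expD; [|exact: intg_fst|exact: intg_snd].
rewrite (exp_fst mu it) (exp_snd mu it) => H.
rewrite normrM ger0_norm ?invr_ge0 ?(ltW q20)//.
rewrite ler_pdivrMl//; apply: (le_trans H).
by rewrite le_eqVlt; apply/orP; left; apply/eqP; ring.
Qed.

End Jump.

Lemma C2_tail r : 1 <= r -> C2 b (tail r) (tail1 b r) (tail2 b r) (tail2_cst b).
Proof.
move=> r1; split; [by move=> v; exact: dtail|by move=> v; exact: dtail1|move=> v].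
apply: (le_trans (tail2_le b1 v r1)); apply: ler_wpM2l; last exact: theta_le1.
have b0 : 0 <= b by apply: le_trans ler01 (ltW b1).
by rewrite /tail2_cst addr_ge0 ?mulr_ge0 ?addr_ge0 ?mulr_ge0.
Qed.

(** The constant of [remainder_exp] for phi = [tail r], free of r and q. *)
Definition tail_rate : R := 2 * (tail2_cst b * dbl b jumpc * lam1 ^+ 2).

Lemma tail2_cst_ge0 : 0 <= tail2_cst b.
Proof.
have b0 : 0 <= b by apply: le_trans ler01 (ltW b1).
by rewrite /tail2_cst addr_ge0 ?mulr_ge0 ?addr_ge0 ?mulr_ge0.
Qed.

Lemma tail_rate_ge0 : 0 <= tail_rate.
Proof.
rewrite /tail_rate mulr_ge0// mulr_ge0 ?sqr_ge0// mulr_ge0 ?dbl_ge0//.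
exact: tail2_cst_ge0.
Qed.

(* The drift only decreases the tail, since [v * (tail r)' v >= 0]. *)
Lemma tail_evolution k q h r t : admissible k q ->
  evolution b lambda k q f0 h -> 1 <= r -> 0 <= t ->
  \int[h t]_v tail r v <= expR (tail_rate * t) * \int[f0]_v tail r v.
Proof.
move=> adm ev r1 t0; have c2 := C2_tail r1.
have d := evo_derive ev c2; have c := evo_cvg0 ev c2.
have e : \int[h 0]_v tail r v = \int[f0]_v tail r v.
  apply: (evo_init ev (C := 1)); first exact: mR_tail.
  by move=> v; rewrite mul1r ger0_norm ?tail_ge0// tail_le_W.
rewrite -e; apply: (gronwall d c _ t0) => s s0.
have B v : `|tail2 b r v| <= tail2_cst b * theta r v by exact: tail2_le.
have := remainder_exp adm r1 c2 tail2_cst_ge0 B (evo_W ev (ltW s0)).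
rewrite -/tail_rate ler_norml => /andP[_ H].
apply: le_trans H; rewrite gerDr mulNr oppr_le0 mulr_ge0//.
  by rewrite mulr_ge0// addr_ge0// sqr_ge0.
by apply: exp_ge0 => v; exact: tail1_sign.
Qed.

(** One set of measures that contains all the evolutions up to time T, for all admissible
    parameters. On it [W] is uniformly integrable, and it is stable under the limits taken below. *)
Definition tails (T : R) (mu : borelProb R) : Prop :=
  intg mu W /\ forall r, 1 <= r ->
    \int[mu]_v tail r v <= expR (tail_rate * T) * \int[f0]_v tail r v.

Lemma tails_evolution k q h T t : admissible k q ->
  evolution b lambda k q f0 h -> 0 <= t <= T -> tails T (h t).
Proof.
move=> adm ev /andP[t0 tT]; split; first exact: (evo_W ev t0).
move=> r r1; apply: (le_trans (tail_evolution adm ev r1 t0)).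
apply: ler_wpM2r; last by rewrite ler_expR ler_wpM2l// tail_rate_ge0.
by apply: exp_ge0 => v; exact: tail_ge0.
Qed.

Definition Wbound (T : R) : R :=
  2 `^ b + 2 * (expR (tail_rate * T) * \int[f0]_v tail 1 v).

Lemma tails_W T mu : tails T mu -> \int[mu]_v W v <= Wbound T.
Proof.
move=> [iW Ht]; have it := intg_tail b1 (lexx 1) iW.
apply: (@le_trans _ _ (\int[mu]_v (2 `^ b + 2 * tail 1 v))).
  apply: exp_le; [exact: iW|by apply: intgD; [exact: intg_cst|exact: intgZ]|].
  by move=> v; exact: W_le.
rewrite expD; [|exact: intg_cst|exact: intgZ].
by rewrite exp_cst expZ// lerD2l ler_wpM2l//; exact: Ht.
Qed.

Lemma Wbound_ge0 T : 0 <= Wbound T.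
Proof.
rewrite addr_ge0 ?powR_ge0// mulr_ge0// mulr_ge0 ?expR_ge0//.
by apply: exp_ge0 => v; exact: tail_ge0.
Qed.

Lemma tails_small T e : 0 < e -> exists N : nat, forall mu, tails T mu ->
  \int[mu]_v tail N.+1%:R v <= e.
Proof.
move=> e0.
have lim : \int[f0]_v tail k.+1%:R v @[k --> \oo] --> (0 : R).
  have [|//|] := exp_dominated (P := f0) (f_ := fun k => tail k.+1%:R)
      (f := fun=> 0) (g := W) _ iW0 _ (tail_cvg0 b).
  - by move=> k; apply: mR_tail => //; rewrite ler1n.
  - by move=> k v; rewrite ger0_norm ?tail_ge0 ?ler1n// tail_le_W ?ler1n.
  - by rewrite exp_cst.
have e1 : 0 < e / expR (tail_rate * T) by rewrite divr_gt0// expR_gt0.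
have := cvgr_norm_le _ lim; rewrite normr0 => /(_ _ _ e1)[N _ HN].
exists N => mu [_ Ht]; have N1 : 1 <= N.+1%:R :> R by rewrite ler1n.
apply: (le_trans (Ht _ N1)); rewrite mulrC -ler_pdivlMr ?expR_gt0//.
by apply: le_trans (HN N (leqnn _)); exact: ler_norm.
Qed.

Lemma lipschitz_on (F G : R -> R) (M T : R) :
  (forall t : R, 0 < t -> is_derive t 1 F (G t)) ->
  F t @[t --> 0^'+] --> F 0 -> (forall t : R, 0 < t <= T -> `|G t| <= M) ->
  forall s t : R, 0 <= s <= T -> 0 <= t <= T -> `|F t - F s| <= M * `|t - s|.
Proof.
move=> dF F0 GM.
have K a c : 0 <= a -> a < c -> c <= T -> `|F c - F a| <= M * `|c - a|.
  move=> a0 ac cT; have [x /andP[ax xc] ->] := mvt_half dF F0 a0 ac.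
  by rewrite normrM ler_wpM2r// GM// (le_lt_trans a0 ax) (le_trans (ltW xc)).
move=> s t /andP[s0 sT] /andP[t0 tT]; have [st|ts|->] := ltgtP s t.
- exact: K.
- by rewrite distrC [`|t - s|]distrC; exact: K.
- by rewrite !subrr normr0 mulr0.
Qed.

(** The constant [L] is chosen before k, q and h: this is the common modulus of continuity in
    time. *)
Lemma evolution_lip phi phi1 phi2 C T : C2 b phi phi1 phi2 C ->
  exists2 L : R, 0 <= L & forall k q h, admissible k q ->
    evolution b lambda k q f0 h -> forall s t : R, 0 <= s <= T -> 0 <= t <= T ->
    `|\int[h t]_v phi v - \int[h s]_v phi v| <= L * `|t - s|.
Proof.
move=> c2; have [D D0 HD] := C2_growth b1 c2; have [d1 d2 B] := c2.
have H1 v : `|v * phi1 v| <= D * W v by case: (HD v).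
have C0 : 0 <= C.
  by have := le_trans (normr_ge0 _) (B 0); rewrite pmulr_lge0// theta_gt0.
have mp1 : mR (fun v => v * phi1 v).
  by apply: mR_continuous; exact: (continuous_der (fun v => dMul (dId v) (d2 v))).
pose a := 2^-1 * (1 + lambda ^+ 2); pose K := 2 * (C * dbl b jumpc * lam1 ^+ 2).
have a0 : 0 <= a by rewrite mulr_ge0// addr_ge0// sqr_ge0.
have K0 : 0 <= K.
  by rewrite mulr_ge0// mulr_ge0 ?sqr_ge0// mulr_ge0 ?dbl_ge0.
exists ((a * D + K) * Wbound T).
  by rewrite mulr_ge0 ?Wbound_ge0// addr_ge0// mulr_ge0.
move=> k q h adm ev; apply: lipschitz_on (evo_derive ev c2) (evo_cvg0 ev c2) _.
move=> t /andP[t0 tT].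
have tl : tails T (h t) by apply: (tails_evolution adm ev); rewrite ltW.
have [iW _] := tl; have WT := tails_W tl.
have R1 := remainder_exp adm (lexx 1) c2 C0 B iW.
have j1 : intg (h t) (fun v => v * phi1 v) by exact: intg_dom mp1 H1 iW.
have R2 : `|- a * \int[h t]_v (v * phi1 v)| <= a * D * Wbound T.
  have -> : a * D * Wbound T = a * (D * Wbound T) by ring.
  rewrite normrM normrN (ger0_norm a0); apply: ler_wpM2l => //.
  apply: (@le_trans _ _ (\int[h t]_v (D * W v))).
    by apply: exp_norm => //; exact: intgZ.
  by rewrite expZ// ler_wpM2l.
rewrite mulrDl; apply: (le_trans (ler_normD _ _)); apply: lerD => //.
apply: (le_trans R1); apply: ler_wpM2l => //; apply: le_trans WT.
apply: exp_le => //; first exact: intg_tail.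
by move=> v; exact: tail_le_W.
Qed.

(** The formal adjoint of the Fokker-Planck operator, applied to phi. *)
Definition generator (phi1 phi2 : R -> R) (v : R) : R :=
  2^-1 * ((1 + lambda ^+ 2 * v ^+ 2) * phi2 v) - 2^-1 * (1 + lambda ^+ 2) * (v * phi1 v).

Section Error.
Variables (phi phi1 phi2 : R -> R) (C : R).
Hypothesis c2 : C2 b phi phi1 phi2 C.
Hypothesis cphi2 : continuous phi2.

Let C0 : 0 <= C.
Proof.
have [_ _ B] := c2.
by have := le_trans (normr_ge0 _) (B 0); rewrite pmulr_lge0// theta_gt0.
Qed.

Let E3 : R := C * dbl b jumpc.

Let E3_ge0 : 0 <= E3. Proof. by rewrite mulr_ge0// dbl_ge0. Qed.

(* For jumps issued from velocities below [N] the oscillation of [phi2] is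
   uniformly small; the other ones are absorbed by the tail. *)
Lemma remainder2_le (N e : R) : 1 <= N -> 0 < e ->
  exists2 q1 : R, 0 < q1 & forall k q, admissible k q -> q <= q1 -> forall z : RM * RM,
    `|remainder phi phi1 k q z - 2^-1 * phi2 z.1 * (k * z.1 + q * z.2) ^+ 2| <=
    q ^+ 2 * lam1 ^+ 2 * (e * (z.1 ^+ 2 + z.2 ^+ 2) + 4 * E3 * (tail N z.1 + tail N z.2)).
Proof.
move=> N1 e0; have [d1 d2 B] := c2.
have [d d0 Hd] := heine N cphi2 e0.
have N0 : 0 < N by exact: lt_le_trans ltr01 N1.
(* When both velocities are at most N the jump is at most q [lam1] N, which this value keeps below
   d. *)
exists (d / (lam1 + 1) / N / 2); first by rewrite !divr_gt0// ltr_wpDl.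
move=> k q adm qd z; have [q0 qQ _ _] := adm.
rewrite /remainder.
have [th [eta [/andP[t0 t1] /andP[e0' e1] ->]]] := taylor3 z.1 (k * z.1 + q * z.2) d1 d2.
set m := Num.max `|z.1 : R| `|z.2 : R|.
have m0 : 0 <= m by rewrite le_max normr_ge0.
have H2 : `|eta * (k * z.1 + q * z.2) ^+ 2| <= (q * lam1 * m) ^+ 2.
  rewrite normrM ger0_norm// normrX.
  apply: (@le_trans _ _ (`|k * z.1 + q * z.2| ^+ 2)); first by rewrite ler_piMl.
  by rewrite lerXn2r ?nnegrE ?mulr_ge0// ?(ltW q0)//; exact: jump_le.
rewrite normrM; apply: (le_trans (ler_wpM2l (normr_ge0 _) H2)).
have -> : (q * lam1 * m) ^+ 2 = q ^+ 2 * lam1 ^+ 2 * m ^+ 2 by ring.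
rewrite mulrCA; apply: ler_wpM2l; first by rewrite mulr_ge0 ?sqr_ge0.
have Ts : 0 <= 4 * E3 * (tail N z.1 + tail N z.2).
  by rewrite mulr_ge0 ?addr_ge0 ?tail_ge0// mulr_ge0.
have Es : 0 <= e * (z.1 ^+ 2 + z.2 ^+ 2).
  by rewrite mulr_ge0 ?addr_ge0 ?sqr_ge0// ltW.
have mz : m ^+ 2 <= z.1 ^+ 2 + z.2 ^+ 2.
  by rewrite /m; have [_|_] := leP `|z.1 : R| `|z.2 : R|;
    rewrite real_normK ?num_real// ?lerDr ?lerDl sqr_ge0.
have [mN|Nm] := leP m N.
- have dist : `|z.1 + th * (k * z.1 + q * z.2) - z.1| < d.
    have -> : z.1 + th * (k * z.1 + q * z.2) - z.1 = th * (k * z.1 + q * z.2) by ring.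
    rewrite normrM ger0_norm//; apply: (le_lt_trans (ler_piMl (normr_ge0 _) t1)).
    apply: (le_lt_trans (jump_le adm _ _)); rewrite -/m.
    apply: (@le_lt_trans _ _ (q * (lam1 + 1) * N)).
      by apply: ler_pM => //; [rewrite mulr_ge0// ltW|rewrite ler_wpM2l ?(ltW q0)// lerDl].
    have l0 : 0 < lam1 + 1 by rewrite ltr_wpDl.
    apply: (@le_lt_trans _ _ (d / (lam1 + 1) / N / 2 * (lam1 + 1) * N)).
      by rewrite ler_wpM2r ?(ltW N0)// ler_wpM2r ?(ltW l0).
    have -> : d / (lam1 + 1) / N / 2 * (lam1 + 1) * N = d / 2.
      by field; rewrite !gt_eqF.
    by rewrite ltr_pdivrMr// ltr_pMr// ltr1n.
  have zN : `|z.1 : R| <= N by apply: le_trans mN; rewrite le_max lexx.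
  have := Hd _ _ zN dist => Hphi.
  apply: (@le_trans _ _ (e * (z.1 ^+ 2 + z.2 ^+ 2))); last by rewrite lerDl.
  by apply: ler_pM => //; exact: sqr_ge0.
(* Here the larger velocity exceeds N. The factor 4 is 2 for the two values of [phi2] and 2 for
   comparing [W] with [tail N]. *)
- have T (x : R) : `|x| <= jumpc * m -> `|phi2 x| <= E3 * theta 1 m.
    move=> xm; apply: (le_trans (B x)); rewrite /E3 -mulrA ler_wpM2l//.
    by apply: theta_dbl => //; rewrite (ger0_norm m0).
  have z1m : `|z.1 : R| <= jumpc * m.
    apply: (@le_trans _ _ m); first by rewrite le_max lexx.
    by rewrite ler_peMl.
  have xm : `|z.1 + th * (k * z.1 + q * z.2)| <= jumpc * m.
    by apply: jump_mid => //; rewrite t0.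
  apply: (@le_trans _ _ (4 * E3 * (tail N z.1 + tail N z.2))); last by rewrite lerDr.
  apply: (@le_trans _ _ (2 * (E3 * theta 1 m) * m ^+ 2)).
    apply: ler_wpM2r; first exact: sqr_ge0.
    by apply: (le_trans (ler_normB _ _)); rewrite mulrDl mul1r; apply: lerD; exact: T.
  have -> : 2 * (E3 * theta 1 m) * m ^+ 2 = 2 * E3 * tail 1 m by rewrite tailE; ring.
  have -> : 4 * E3 * (tail N z.1 + tail N z.2) =
    2 * E3 * (2 * (tail N z.1 + tail N z.2)) by ring.
  apply: ler_wpM2l; first by rewrite mulr_ge0.
  apply: (le_trans (tail_le_W b m (lexx 1))).
  apply: (@le_trans _ _ (2 * tail N m)).
    by apply: W_le_tail => //; rewrite (ger0_norm m0) ltW.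
  by apply: ler_wpM2l => //; exact: (max_tail _ _ N1).
Qed.

Lemma generator_growth : exists D, forall v, `|generator phi1 phi2 v| <= D * W v.
Proof.
have [D D0 HD] := C2_growth b1 c2; have [d1 d2 B] := c2.
exists (2^-1 * (C + lambda ^+ 2 * D) + 2^-1 * (1 + lambda ^+ 2) * D) => v.
have [_ _ H1 H2] := HD v.
have H3 : `|phi2 v| <= C * W v.
  apply: (le_trans (B v)); apply: ler_wpM2l => //; rewrite W_theta1.
  rewrite ler_peMl//; first by rewrite ltW// theta_gt0.
  by rewrite lerDl sqr_ge0.
rewrite /generator; apply: (le_trans (ler_normB _ _)); rewrite [leRHS]mulrDl; apply: lerD.
- have -> : 2^-1 * ((1 + lambda ^+ 2 * v ^+ 2) * phi2 v) =
    2^-1 * (phi2 v + lambda ^+ 2 * (v ^+ 2 * phi2 v)) by ring.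
  have -> : 2^-1 * (C + lambda ^+ 2 * D) * W v =
    2^-1 * (C * W v + lambda ^+ 2 * (D * W v)) by ring.
  have h0 : 0 <= 2^-1 :> R by rewrite invr_ge0.
  rewrite normrM (ger0_norm h0); apply: ler_wpM2l => //.
  apply: (le_trans (ler_normD _ _)); apply: lerD => //.
  rewrite normrM (ger0_norm (sqr_ge0 _)); apply: ler_wpM2l; first exact: sqr_ge0.
  by rewrite normrM (ger0_norm (sqr_ge0 _)).
- rewrite normrM ger0_norm; last by rewrite mulr_ge0// addr_ge0// sqr_ge0.
  by rewrite -[leRHS]mulrA ler_wpM2l// mulr_ge0// addr_ge0// sqr_ge0.
Qed.

Lemma generator_continuous : continuous (generator phi1 phi2).
Proof.
have [d1 d2 _] := c2; have cphi1 := continuous_der d2.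
have cv : continuous (fun v : R => v ^+ 2).
  exact: continuous_der (@dSqr R).
move=> v; apply: cvgB.
  apply: cvgMr; apply: cvgM; last exact: cphi2.
  by apply: cvgD; [exact: cvg_cst|apply: cvgMr; exact: cv].
apply: cvgMr; apply: cvgM; [exact: cvg_id|exact: cphi1].
Qed.

Lemma evolution_error T e : 0 < e -> exists2 q1 : R, 0 < q1 &
  forall k q h, admissible k q -> evolution b lambda k q f0 h -> q <= q1 ->
  forall t, 0 < t <= T ->
    `|(- (2^-1 * (1 + lambda ^+ 2)) * \int[h t]_v (v * phi1 v) +
       q ^- 2 * \int[(h t \x h t)%E]_z remainder phi phi1 k q z) -
      \int[h t]_v generator phi1 phi2 v| <= e.
Proof.
move=> e0; have [D D0 HD] := C2_growth b1 c2; have [d1 d2 B] := c2.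
have l2 : 0 < lam1 ^+ 2 + 1 by rewrite ltr_wpDl// sqr_ge0.
(* The energy is 1 for each of the two velocities, so the quarter becomes a half; the 16 makes 8
   [E3] times the tail at most the other half. The remaining factor [lam1 ^+ 2] is absorbed by
   [lam1 ^+ 2 + 1]. *)
have e1 : 0 < e / (lam1 ^+ 2 + 1) / 4 by rewrite !divr_gt0.
have e2 : 0 < e / (lam1 ^+ 2 + 1) / (16 * (E3 + 1)).
  by rewrite !divr_gt0// mulr_gt0// ltr_wpDl.
have [N HN] := tails_small T e2.
have N1 : 1 <= N.+1%:R :> R by rewrite ler1n.
have [q1 q10 Hq] := remainder2_le N1 e1.
exists q1 => // k q h adm ev qq1 t /andP[t0 tT].
have [q0 qQ k0 kk] := adm; have q20 : 0 < q ^+ 2 by rewrite exprn_gt0.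
have tl : tails T (h t) by apply: (tails_evolution adm ev); rewrite ltW.
have [iW _] := tl; set mu := h t in iW tl *.
have mu1 : \int[mu]_v v = 0 by exact: (evo_mean ev (ltW t0)).
have mu2 : \int[mu]_v (v ^+ 2) = 1 by exact: (evo_energy ev (ltW t0)).
have jid := intg_id b1 iW; have jsq := intg_sqr b1 iW.
have mphi1 : mR phi1 by apply: mR_continuous; exact: continuous_der d2.
have mphi2 : mR phi2 by exact: mR_continuous.
have mp1 : mR (fun v => v * phi1 v).
  by apply: mR_continuous; exact: (continuous_der (fun v => dMul (dId v) (d2 v))).
have msq : mR (fun v : R => v ^+ 2).
  by apply: mR_continuous; exact: continuous_der (@dSqr R).
have g1 v : `|v * phi1 v| <= D * W v by case: (HD v).
have g3 v : `|phi2 v| <= C * W v.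
  apply: (le_trans (B v)); apply: ler_wpM2l => //; rewrite W_theta1.
  rewrite ler_peMl//; first by rewrite ltW// theta_gt0.
  by rewrite lerDl sqr_ge0.
have g2 v : `|v ^+ 2 * phi2 v| <= D * W v.
  by rewrite normrM ger0_norm ?sqr_ge0//; case: (HD v).
have g4 v : `|v * phi2 v| <= (C + D) * W v.
  have vv : `|v| <= 1 + v ^+ 2.
    rewrite -[v ^+ 2]real_normK ?num_real//.
    have := sqr_ge0 (`|v| - 1); rewrite sqrrB1; have := normr_ge0 v.
    by rewrite mulr2n; lra.
  rewrite normrM; apply: (le_trans (ler_wpM2r (normr_ge0 _) vv)).
  rewrite !mulrDl mul1r; apply: lerD => //.
  by have := g2 v; rewrite normrM ger0_norm ?sqr_ge0.
have j1 := intg_dom mp1 g1 iW.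
have j2 : intg mu (fun v => v ^+ 2 * phi2 v).
  by apply: intg_dom _ g2 iW; apply: measurable_funM.
have j3 := intg_dom mphi2 g3 iW.
have j4 : intg mu (fun v => v * phi2 v).
  by apply: intg_dom _ g4 iW; apply: measurable_funM => //; exact: measurable_id.
have i2 : intg (mu \x mu)%E (fun z : RM * RM => z.1 ^+ 2 * phi2 z.1) := intg_fst mu j2.
have i4 : intg (mu \x mu)%E (fun z : RM * RM => z.1 * phi2 z.1 * z.2) := intg_prod j4 jid.
have i3 : intg (mu \x mu)%E (fun z : RM * RM => phi2 z.1 * z.2 ^+ 2) := intg_prod j3 jsq.
pose q2 (z : RM * RM) := 2^-1 * phi2 z.1 * (k * z.1 + q * z.2) ^+ 2.
have q2E : q2 = (fun z : RM * RM => 2^-1 * (k ^+ 2 * (z.1 ^+ 2 * phi2 z.1) +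
    (2 * k * q * (z.1 * phi2 z.1 * z.2) + q ^+ 2 * (phi2 z.1 * z.2 ^+ 2)))).
  by apply/funext => z; rewrite /q2; ring.
have iq2 : intg (mu \x mu)%E q2.
  by rewrite q2E; apply: intgZ; apply: intgD; [exact: intgZ|apply: intgD; exact: intgZ].
(* The cross term vanishes with the mean; k^2 = lambda^2 q^2 and unit energy turn the two squares
   into the second order part of the generator. *)
have Eq2 : q ^- 2 * \int[(mu \x mu)%E]_z q2 z =
    2^-1 * (lambda ^+ 2 * \int[mu]_v (v ^+ 2 * phi2 v) + \int[mu]_v phi2 v).
  rewrite q2E expZ; last by apply: intgD; [exact: intgZ|apply: intgD; exact: intgZ].
  rewrite expD; [|exact: intgZ|by apply: intgD; exact: intgZ].
  rewrite expD; [|exact: intgZ|exact: intgZ].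
  rewrite !expZ// (exp_fst mu j2) (exp_prod j4 jid) (exp_prod j3 jsq) mu1 mu2 kk.
  by field; rewrite gt_eqF.
have gE : \int[mu]_v generator phi1 phi2 v = - (2^-1 * (1 + lambda ^+ 2)) *
    \int[mu]_v (v * phi1 v) + q ^- 2 * \int[(mu \x mu)%E]_z q2 z.
  rewrite Eq2; transitivity (\int[mu]_v (- (2^-1 * (1 + lambda ^+ 2)) * (v * phi1 v) +
      2^-1 * (lambda ^+ 2 * (v ^+ 2 * phi2 v) + phi2 v))).
    by apply: eq_Rintegral => v _; rewrite /generator; ring.
  rewrite expD; [|exact: intgZ|by apply: intgZ; apply: intgD => //; exact: intgZ].
  rewrite !expZ//; last by apply: intgD => //; exact: intgZ.
  by rewrite expD// ?expZ//; exact: intgZ.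
have ir := dom2_remainder b1 c2 k0 (ltW q0) iW iW.
rewrite gE; have -> : forall x y z : R, x + y - (x + z) = y - z by move=> *; ring.
rewrite -mulrBr -expB//.
have it := intg_tail b1 N1 iW.
pose dom (z : RM * RM) := q ^+ 2 * lam1 ^+ 2 * (e / (lam1 ^+ 2 + 1) / 4 *
  (z.1 ^+ 2 + z.2 ^+ 2) + 4 * E3 * (tail N.+1%:R z.1 + tail N.+1%:R z.2)).
have f1 : intg (mu \x mu)%E (fun z : RM * RM => z.1 ^+ 2) := intg_fst mu jsq.
have f2 : intg (mu \x mu)%E (fun z : RM * RM => z.2 ^+ 2) := intg_snd mu jsq.
have t1 : intg (mu \x mu)%E (fun z : RM * RM => tail N.+1%:R z.1) := intg_fst mu it.
have t2 : intg (mu \x mu)%E (fun z : RM * RM => tail N.+1%:R z.2) := intg_snd mu it.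
have bound : `|\int[(mu \x mu)%E]_z (remainder phi phi1 k q z - q2 z)| <=
    \int[(mu \x mu)%E]_z dom z.
  apply: exp_norm.
  - exact: intgB.
  - by apply: intgZ; apply: intgD; apply: intgZ; apply: intgD.
  - by move=> z; exact: (Hq k q adm qq1 z).
have domE : \int[(mu \x mu)%E]_z dom z = q ^+ 2 * lam1 ^+ 2 *
    (e / (lam1 ^+ 2 + 1) / 4 * (1 + 1) +
     4 * E3 * (\int[mu]_v tail N.+1%:R v + \int[mu]_v tail N.+1%:R v)).
  rewrite /dom expZ; last by apply: intgD; apply: intgZ; apply: intgD.
  rewrite expD; [|by apply: intgZ; apply: intgD|by apply: intgZ; apply: intgD].
  rewrite expZ; last exact: intgD.
  rewrite expZ; last exact: intgD.
  by rewrite !expD// (exp_fst mu jsq) (exp_snd mu jsq) (exp_fst mu it) (exp_snd mu it) mu2.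
rewrite domE in bound.
rewrite normrM ger0_norm ?invr_ge0 ?(ltW q20)// ler_pdivrMl//.
apply: (le_trans bound); rewrite -[leLHS]mulrA; apply: ler_wpM2l; first exact: ltW.
have HT := HN _ tl; set I := \int[mu]_v _ in HT *.
have I0 : 0 <= I by apply: exp_ge0 => v; exact: tail_ge0.
have b1' : 4 * E3 * (I + I) <= e / (lam1 ^+ 2 + 1) / 2.
  have E30 : 0 < 16 * (E3 + 1) by rewrite mulr_gt0// ltr_wpDl.
  apply: (@le_trans _ _ (16 * (E3 + 1) * I / 2)).
    have -> : 16 * (E3 + 1) * I / 2 = 4 * E3 * (I + I) + 8 * I by field.
    by rewrite lerDl mulr_ge0.
  by rewrite ler_wpM2r// [leLHS]mulrC -ler_pdivlMr.
have b2' : e / (lam1 ^+ 2 + 1) / 4 * (1 + 1) = e / (lam1 ^+ 2 + 1) / 2 by field; rewrite gt_eqF.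
rewrite b2'; apply: (@le_trans _ _ (lam1 ^+ 2 * (e / (lam1 ^+ 2 + 1)))).
  apply: ler_wpM2l; first exact: sqr_ge0.
  by rewrite [leRHS]splitr lerD2l.
rewrite mulrCA ler_piMr ?(ltW e0)// ler_pdivrMr// mul1r lerDl//.
Qed.

End Error.

End Estimates.

(** * Compactness *)

Section Subsequences.

Definition subseq_index (k : nat -> nat) : Prop := forall n, (k n < k n.+1)%N.

Lemma subseq_homo k : subseq_index k -> {homo k : i j / (i < j)%N}.
Proof.
move=> H i j; elim: j => // j IH; rewrite ltnS leq_eqVlt => /predU1P[-> //|ij].
exact: ltn_trans (IH ij) (H j).
Qed.

Lemma subseq_ge k n : subseq_index k -> (n <= k n)%N.
Proof.
move=> H; elim: n => // n IH; exact: leq_ltn_trans IH (H n).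
Qed.

Lemma subseq_comp k j : subseq_index k -> subseq_index j -> subseq_index (k \o j).
Proof. move=> H K n; exact: (subseq_homo H (K n)). Qed.

Lemma cvg_subseq {R : realType} (u : nat -> R) (l : R) k : subseq_index k ->
  u @ \oo --> l -> u (k n) @[n --> \oo] --> l.
Proof.
move=> H /cvgrPdist_le ul; apply/cvgrPdist_le => e e0.
have [N _ HN] := ul e e0; exists N => // n /= Nn; apply: HN => /=.
exact: leq_trans Nn (subseq_ge n H).
Qed.

Lemma cvg_le_lim {R : realType} (u v : nat -> R) (a c : R) :
  u @ \oo --> a -> v @ \oo --> c -> (forall n, u n <= v n) -> a <= c.
Proof.
move=> ua vc uv; rewrite -(cvg_lim (@Rhausdorff R) ua) -(cvg_lim (@Rhausdorff R) vc).
by apply: ler_lim; [apply/cvg_ex; exists a|apply/cvg_ex; exists c|apply: nearW].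
Qed.

Lemma bw_bounded {R : realType} (u : nat -> R) (M : R) : (forall n, `|u n| <= M) ->
  exists2 j, subseq_index j & cvgn (u \o j).
Proof.
move=> uM; have bu : bounded_fun u.
  exists M; split; first exact: num_real.
  by move=> y My n _ /=; apply: (le_trans (uM n)); exact: ltW.
have [j ij cj] := bolzano_weierstrass bu; exists j => // n.
by have /= h := ij n.+1 n; rewrite ltnNge; apply/negP => jn; move: h; rewrite leEnat jn ltnn.
Qed.

Lemma diagonal {R : realType} (u : nat -> nat -> R) (M : R) :
  (forall i n, `|u i n| <= M) ->
  exists2 k, subseq_index k & forall i, cvgn (fun n => u i (k n)).
Proof.
move=> uM.
have [J HJ] : exists J : nat -> (nat -> nat) -> (nat -> nat),
    forall i k, subseq_index (J i k) /\ cvgn (fun n => u i (k (J i k n))).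
  have H i k : exists j, subseq_index j /\ cvgn (fun n => u i (k (j n))).
    have [j ij cj] := @bw_bounded R (fun n => u i (k n)) M (fun n => uM i (k n)).
    by exists j.
  have [J HJ] := choice (fun ik : nat * (nat -> nat) => H ik.1 ik.2).
  by exists (fun i k => J (i, k)) => i k; exact: (HJ (i, k)).
pose K := fix K i := if i is i'.+1 then K i' \o J i' (K i') else id.
have iK i : subseq_index (K i).
  elim: i => [|i IH]; first by move=> n; exact: ltnSn.
  by apply: subseq_comp => //; case: (HJ i (K i)).
exists (fun n => K n n).
  move=> n /=; apply: subseq_homo => //.
  have [h _] := HJ n (K n).
  exact: leq_ltn_trans (subseq_ge n h) (h n).
move=> i.
have [l cl] : exists l : R, (fun n => u i (K i.+1 n)) @ \oo --> l.
  by have [_ /cvg_ex[l cl]] := HJ i (K i); exists l.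
apply/cvg_ex; exists l.
(* Each later subsequence factors through [K i.+1], so the n-th diagonal term is a term of it of
   index at least n, once n > i. *)
have fac m : exists g, subseq_index g /\ forall n, K (i.+1 + m)%N n = K i.+1 (g n).
  elim: m => [|m [g [ig Hg]]].
    by exists id; split; [move=> n; exact: ltnSn|rewrite addn0].
  exists (g \o J (i.+1 + m)%N (K (i.+1 + m)%N)); split.
    by apply: subseq_comp => //; case: (HJ (i.+1 + m)%N (K (i.+1 + m)%N)).
  by move=> n; rewrite addnS; exact: Hg.
apply/cvgrPdist_le => e e0; move/cvgrPdist_le : cl => /(_ e e0)[N _ HN].
exists (i.+1 + N)%N => // n /= Nn.
have [g [ig Hg]] := fac (n - i.+1)%N.
have in' : (i.+1 <= n)%N by apply: leq_trans Nn; rewrite leq_addr.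
have := Hg n; rewrite subnKC// => ->; apply: HN => /=.
apply: leq_trans (subseq_ge n ig); apply: leq_trans Nn.
by rewrite leq_addl.
Qed.

End Subsequences.

(** * Helly's selection theorem *)

Section Helly.
Context {R : realType}.
Local Notation RM := (measurableTypeR R).

Definition cdfR (mu : borelProb R) (x : R) : R := fine (mu `]-oo, x]%classic).

Lemma cdf_exists (G : R -> R) : {homo G : x y / x <= y} ->
  (forall x : R, G y @[y --> x^'+] --> G x) ->
  G x @[x --> -oo] --> (0 : R) -> G x @[x --> +oo] --> (1 : R) ->
  exists mu : borelProb R, forall x, cdfR mu x = G x.
Proof.
move=> nd rc Ny yy.
pose m1 := isCumulative.Build R _ R G nd rc.
pose m2 := isCumulativeBounded.Build R 0 1 G Ny yy.
pose F : cumulativeBounded (0 : R) (1 : R) := HB.pack G m1 m2.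
exists (lebesgue_stieltjes_measure F) => x.
by have := cdf_lebesgue_stieltjes_id F x; rewrite /cdf /distribution /pushforward
  preimage_id /cdfR /= => ->.
Qed.

Lemma cdfR_mono mu : {homo cdfR mu : x y / x <= y}.
Proof.
move=> x y xy; apply: fine_le; rewrite ?fin_num_measure//.
apply: le_measure; rewrite ?inE//; exact: subset_itvl.
Qed.

Lemma cdfR_itv mu x : 0 <= cdfR mu x <= 1.
Proof.
rewrite fine_ge0//= -lee_fin fineK ?fin_num_measure//.
exact: probability_le1.
Qed.

Lemma exp_ray (mu : borelProb R) x :
  \int[mu]_v (ind `]-oo, x]%classic v) = cdfR mu x.
Proof. by rewrite /Rintegral integral_indic// setIT. Qed.

Variable mu_ : nat -> borelProb R.
Variable L : rat -> R.
Hypothesis cvgL : forall r, cdfR (mu_ n) (ratr r) @[n --> \oo] --> L r.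
Hypothesis tight : forall e : R, 0 < e -> exists A : R, forall n (x : R),
  (x <= - A -> cdfR (mu_ n) x <= e) /\ (A <= x -> 1 - e <= cdfR (mu_ n) x).

Let L_mono r s : ratr r <= ratr s :> R -> L r <= L s.
Proof.
move=> rs; apply: (cvg_le_lim (@cvgL r) (@cvgL s)) => n; exact: cdfR_mono.
Qed.

Let L_itv r : 0 <= L r <= 1.
Proof.
apply/andP; split.
- apply: (cvg_le_lim (cvg_cst (0 : R)) (@cvgL r)) => n.
  by case/andP : (cdfR_itv (mu_ n) (ratr r)).
- apply: (cvg_le_lim (@cvgL r) (cvg_cst (1 : R))) => n.
  by case/andP : (cdfR_itv (mu_ n) (ratr r)).
Qed.

(** The strict inequality makes the infimum of [S x] right-continuous in x, which the limits [L] at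
    rational points need not be. *)
Let S (x : R) : set R := [set y | exists2 r, x < ratr r & y = L r].

Let S_inf x : has_inf (S x).
Proof.
split; last by exists 0 => y [r _ ->]; case/andP : (L_itv r).
have [r] := @rat_in_itvoo R x (x + 1) ltac:(by rewrite ltrDl).
by rewrite in_itv/= => /andP[xr _]; exists (L r); exists r.
Qed.

Definition helly_cdf (x : R) : R := inf (S x).

Let G := helly_cdf.

Let G_le x r : x < ratr r -> G x <= L r.
Proof. by move=> xr; apply: ge_inf; [case: (S_inf x)|exists r]. Qed.

Let G_ge x y : (forall r, x < ratr r -> y <= L r) -> y <= G x.
Proof.
move=> H; apply: lb_le_inf; first by case: (S_inf x).
by move=> _ [r xr ->]; exact: H.
Qed.

Let L_le_G r : L r <= G (ratr r).
Proof. by apply: G_ge => s rs; apply: L_mono; exact: ltW. Qed.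

Let G_mono : {homo G : x y / x <= y}.
Proof. by move=> x y xy; apply: G_ge => r yr; apply: G_le; exact: le_lt_trans yr. Qed.

Let G_rc (x : R) : G y @[y --> x^'+] --> G x.
Proof.
apply/cvgrPdist_le => e e0.
have [_ [r xr ->] Lr] := inf_adherent e0 (S_inf x).
have h1 : \forall y \near x^'+, x < y by exact: nbhs_right_gt.
have h2 : \forall y \near x^'+, y < ratr r by exact: nbhs_right_lt.
suff : \forall y \near x^'+, `|G x - G y| <= e by [].
apply: filterS2 h1 h2 => y xy yr.
rewrite distrC ger0_norm ?subr_ge0 ?G_mono ?(ltW xy)//.
by rewrite lerBlDl (le_trans (G_le yr))// ltW.
Qed.

Let G_Ny : G x @[x --> -oo] --> (0 : R).
Proof.
apply/cvgrPdist_le => e e0; have [A HA] := tight e0.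
have h : \forall x \near (-oo : set_system R), x < - A.
  by apply: nbhs_ninfty_lt; exact: num_real.
suff : \forall x \near (-oo : set_system R), `|0 - G x| <= e by [].
apply: filterS h => x xA; rewrite sub0r normrN.
have G0 : 0 <= G x by apply: G_ge => r _; case/andP : (L_itv r).
rewrite ger0_norm//; have [r] := rat_in_itvoo xA.
rewrite in_itv/= => /andP[xr rA]; apply: (le_trans (G_le xr)).
apply: (cvg_le_lim (@cvgL r) (cvg_cst (e : R))) => n.
by have [H _] := HA n (ratr r); apply: H; exact: ltW.
Qed.

Let G_y : G x @[x --> +oo] --> (1 : R).
Proof.
apply/cvgrPdist_le => e e0; have [A HA] := tight e0.
have h : \forall x \near (+oo : set_system R), A < x.
  by apply: nbhs_pinfty_gt; exact: num_real.
suff : \forall x \near (+oo : set_system R), `|1 - G x| <= e by [].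
apply: filterS h => x xA.
have G1 : G x <= 1.
  have [r] := @rat_in_itvoo R x (x + 1) ltac:(by rewrite ltrDl).
  rewrite in_itv/= => /andP[xr _]; apply: (le_trans (G_le xr)).
  by case/andP : (L_itv r).
rewrite ger0_norm ?subr_ge0// lerBlDl -lerBlDr; apply: G_ge => r xr.
apply: (cvg_le_lim (cvg_cst (1 - e : R)) (@cvgL r)) => n.
by have [_ H] := HA n (ratr r); apply: H; rewrite ltW// (lt_trans xA).
Qed.

(* Only indicators of half-lines enter, whose integrals are values of the
   distribution function. *)
Lemma step_approx (psi : R -> R) (r : nat -> R) (e : R) (m : nat) : 0 <= e ->
  (forall i, r i <= r i.+1) ->
  (forall i v, r i <= v -> v <= r i.+1 -> `|psi v - psi (r i.+1)| <= e) ->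
  (forall v, v <= r 0%N -> psi v = 0) ->
  forall v, (v <= r m -> `|\sum_(i < m) (psi (r i) - psi (r i.+1)) *
      ind `]-oo, r i]%classic v - (psi v - psi (r m))| <= e) /\
   (r m < v -> \sum_(i < m) (psi (r i) - psi (r i.+1)) *
      ind `]-oo, r i]%classic v = 0).
Proof.
move=> e0 rr osc psi0 v; elim: m => [|m [IH1 IH2]].
  by rewrite big_ord0; split => // v0; rewrite !psi0// !subr0 normr0.
rewrite big_ord_recr /=; split => [vm|vm].
- have [vr|rv] := leP v (r m).
    have -> : ind `]-oo, r m]%classic v = 1 by rewrite /ind indicE mem_set//= in_itv.
    rewrite mulr1; have := IH1 vr; congr (`| _ | <= e); ring.
  have -> : ind `]-oo, r m]%classic v = 0.
    by rewrite /ind indicE memNset//= in_itv/= leNgt rv.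
  by rewrite IH2// mulr0 addr0 sub0r normrN; apply: osc => //; exact: ltW.
- have rv : r m < v by exact: le_lt_trans (rr m) vm.
  have -> : ind `]-oo, r m]%classic v = 0.
    by rewrite /ind indicE memNset//= in_itv/= leNgt rv.
  by rewrite IH2// mulr0 addr0.
Qed.

(** Continuity points of the limit are avoided. A step function on a rational mesh has coefficients
    at most e, and the limiting distribution function at a mesh point lies between [L] there and [L]
    at the next one, so that the errors telescope. *)
Lemma helly_limit : exists mu : borelProb R, forall psi : R -> R, continuous psi ->
  (exists A : R, forall v, A <= `|v| -> psi v = 0) ->
  \int[mu_ n]_v psi v @[n --> \oo] --> \int[mu]_v psi v.
Proof.
have [mu Hmu] := cdf_exists G_mono G_rc G_Ny G_y; exists mu => psi cpsi [A HA].
have mpsi : mR psi by exact: mR_continuous.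
apply/cvgrPdist_le => /= ee ee0; pose e : R := ee / 5; have e0 : 0 < e by rewrite divr_gt0.
pose B := (Num.truncn `|A|).+2; have AB : A <= B.-1%:R.
  apply: (le_trans (ler_norm _)); rewrite /B /=; apply: ltW; exact: truncnS_gt.
have [d d0 Hd] := heine (B.+3%:R) cpsi e0.
pose N := (Num.truncn d^-1).+1.
have N0 : 0 < N%:R :> R by rewrite ltr0n.
have Nd : N%:R^-1 < d by rewrite invf_plt ?posrE//; exact: truncnS_gt.
(* A rational mesh of width 1/N < d from -B to B; [psi] vanishes where |v| >= B, in particular at
   both ends. *)
pose rq (i : nat) : rat := i%:R / N%:R - B%:R.
pose r (i : nat) : R := ratr (rq i).
have rE i : r i = i%:R / N%:R - B%:R.
  by rewrite /r /rq rmorphB /= rmorphM /= fmorphV !rmorph_nat.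
have rS i : r i.+1 - r i = N%:R^-1.
  by rewrite !rE -natr1; field; rewrite gt_eqF.
have rr i : r i <= r i.+1 by rewrite -subr_ge0 rS invr_ge0 ltW.
have r0 : r 0%N = - B%:R by rewrite rE mul0r sub0r.
have BB : B.-1%:R <= B%:R :> R by rewrite ler_nat leq_pred.
have psi0 v : B%:R <= `|v| -> psi v = 0.
  by move=> Bv; apply: HA; exact: le_trans (le_trans AB BB) Bv.
have osc i v : r i <= v -> v <= r i.+1 -> `|psi v - psi (r i.+1)| <= e.
  move=> h1 h2; have [vB|Bv] := leP `|v| B.+3%:R.
    rewrite distrC; apply: Hd => //; rewrite ger0_norm ?subr_ge0//.
    by apply: le_lt_trans Nd; rewrite -(rS i); lra.
  have B3 : B%:R <= B.+3%:R :> R by rewrite ler_nat -addn3 leq_addr.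
  have [v0|v0] := leP 0 v.
    have pv : psi v = 0 by apply: psi0; exact: le_trans B3 (ltW Bv).
    have pr : psi (r i.+1) = 0.
      apply: psi0; rewrite ger0_norm ?(le_trans v0)//.
      by apply: le_trans h2; rewrite ger0_norm// in Bv; exact: le_trans B3 (ltW Bv).
    by rewrite pv pr subrr normr0 ltW.
  have ri : - B%:R <= r i by rewrite rE lerBrDl subrr divr_ge0// ltW.
  rewrite ltr0_norm// in Bv; have : B%:R <= B.+3%:R :> R := B3; lra.
pose m := (2 * B * N)%N.
have rm : r m = B%:R by rewrite rE /m !natrM; field; rewrite gt_eqF.
have psim : psi (r m) = 0 by rewrite rm psi0// ger0_norm.
pose c i := psi (r i) - psi (r i.+1).
have ce i : `|c i| <= e.
  by apply: osc => //; exact: rr.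
pose s (v : RM) : R := \sum_(i < m) c i * ind `]-oo, r i]%classic v.
have psiNy v : v <= r 0%N -> psi v = 0.
  move=> vB; rewrite r0 in vB; have B0 : 0 <= B%:R :> R by exact: ler0n.
  by apply: psi0; rewrite ler0_norm; lra.
have sB v : `|s v - psi v| <= e.
  have [H1 H2] := step_approx m (ltW e0) rr osc psiNy v.
  have [vm|mv] := leP v (r m).
    by have := H1 vm; rewrite psim subr0.
  rewrite /s H2// psi0 ?subrr ?normr0 ?(ltW e0)//.
  by rewrite -rm; apply: le_trans (ltW mv) (ler_norm _).
have mray (x : R) : mR (ind `]-oo, x]%classic).
  exact: measurable_indic.
have iray (la : borelProb R) x : intg la (ind `]-oo, x]%classic).
  apply: (intg_bounded 1) => [|v]; first exact: mray.
  by rewrite /ind indicE; case: (_ \in _); rewrite ?normr1 ?normr0.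
have Es (la : borelProb R) :
    intg la s /\ \int[la]_v s v = \sum_(i < m) c i * cdfR la (r i).
  rewrite /s; elim: m {rm psim sB s} => [|m' [IH1 IH2]].
    rewrite big_ord0; split.
      by have := intg_cst la 0; congr intg; apply/funext => v; rewrite big_ord0.
    rewrite -[RHS](exp_cst la 0); apply: eq_Rintegral => v _; by rewrite big_ord0.
  have E : (fun v : RM => \sum_(i < m'.+1) c i * ind `]-oo, r i]%classic v) =
    (fun v => \sum_(i < m') c i * ind `]-oo, r i]%classic v + c m' * ind `]-oo, r m']%classic v).
    by apply/funext => v; rewrite big_ord_recr.
  rewrite E; split; first by apply: intgD => //; exact: intgZ.
  by rewrite expD//; [rewrite expZ// exp_ray IH2 big_ord_recr|exact: intgZ].
have ipsi (la : borelProb R) : intg la psi.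
  apply: (intg_bounded (\sum_(i < m) `|c i| + e)) => // v.
  have -> : psi v = s v - (s v - psi v) by ring.
  apply: (le_trans (ler_normB _ _)); apply: lerD => //.
  apply: (le_trans (ler_norm_sum _ _ _)); apply: ler_sum => i _.
  rewrite normrM ler_piMr// /ind indicE.
  by case: (_ \in _); rewrite ?normr1 ?normr0.
have close (la : borelProb R) : `|\int[la]_v s v - \int[la]_v psi v| <= e.
  have [is_ _] := Es la; rewrite -expB//; apply: exp_bounded => //.
  by apply: (intg_measurable (P := la)); exact: intgB.
have lim : \int[mu_ n]_v s v @[n --> \oo] --> \sum_(i < m) c i * L (rq i).
  have -> : (fun n => \int[mu_ n]_v s v) =
      (fun n => \sum_(i < m) c i * cdfR (mu_ n) (r i)).
    by apply/funext => n; have [_ ->] := Es (mu_ n).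
  apply: cvg_big => [|i _]; first exact: add_continuous.
  by apply: cvgMr; exact: (@cvgL _).
have near_lim : `|\int[mu]_v s v - \sum_(i < m) c i * L (rq i)| <= e.
  have [_ ->] := Es mu; rewrite -sumrB.
  apply: (le_trans (ler_norm_sum _ _ _)).
  (* The sum telescopes to e times an increment of [L], whose values lie in [0, 1]. *)
  apply: (@le_trans _ _ (\sum_(i < m) e * (L (rq i.+1) - L (rq i)))).
    apply: ler_sum => i _; rewrite -mulrBr normrM.
    have h1 : L (rq i) <= G (r i) by exact: L_le_G.
    have h2 : G (r i) <= L (rq i.+1).
      by apply: G_le; rewrite -/(r i.+1) -subr_gt0 rS invr_gt0.
    rewrite Hmu -/G; apply: ler_pM => //; rewrite ger0_norm ?subr_ge0// lerD2r//.
  rewrite -mulr_sumr -(big_mkord xpredT (fun i => L (rq i.+1) - L (rq i))).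
  rewrite telescope_sumr// ler_piMr ?(ltW e0)//.
  by case/andP : (L_itv (rq m)) => _ ?; case/andP : (L_itv (rq 0%N)) => ? _; lra.
move/cvgrPdist_le : lim => /(_ e e0) [n0 _ Hn]; exists n0 => // n /= nn.
have h1 := Hn n nn; have h2 := close (mu_ n); have h3 := close mu.
move: h1 h2 h3 near_lim; rewrite !ler_norml => /andP[? ?] /andP[? ?] /andP[? ?] /andP[? ?].
have eE : ee = 5 * e by rewrite /e; field.
by apply/andP; split; lra.
Qed.

End Helly.

Lemma intg_fatou {d} {T : measurableType d} {R : realType} (P : probability T R)
    (f_ : nat -> T -> R) (f : T -> R) (M : R) :
  (forall n, intg P (f_ n)) -> (forall n x, 0 <= f_ n x) ->
  (forall x, f_ ^~ x @ \oo --> f x) -> (forall n, \int[P]_x f_ n x <= M) -> intg P f.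
Proof.
move=> jf f0 ff fM.
have mf : measurable_fun setT f.
  apply: (measurable_fun_cvg (h := f_)) => [n|x _]; [exact: intg_measurable (jf n)|exact: ff].
have pos x : 0 <= f x by apply: (cvg_le_lim (cvg_cst (0 : R)) (ff x)) => n; exact: f0.
apply/integrableP; split; first exact/measurable_EFinP.
have -> : (\int[P]_x `|(EFin \o f) x| = \int[P]_x limn_einf (fun n => (f_ n x)%:E))%E.
  apply: eq_integral => x _; have [-> _] : (limn_einf (fun n => (f_ n x)%:E) = (f x)%:E) *
      (limn_esup (fun n => (f_ n x)%:E) = (f x)%:E).
    by apply: cvg_limn_einf_sup; apply: cvg_EFin; [exact: nearW|exact: ff].
  by rewrite /= ger0_norm.
apply: (@le_lt_trans _ _ (M%:E)); last exact: ltry.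
apply: (le_trans (fatou P measurableT (f := fun n x => (f_ n x)%:E) _ _)).
- by move=> n; apply/measurable_EFinP; exact: intg_measurable (jf n).
- by move=> n x _; rewrite lee_fin.
rewrite limn_einf_lim; apply: lime_le; first exact: is_cvg_einfs.
apply: nearW => n; apply: (@le_trans _ _ (\int[P]_x (f_ n x)%:E)%E).
  by apply: ereal_inf_lbound; exists n => //=.
by have := fM n; rewrite /Rintegral -lee_fin fineK//; exact: integrable_fin_num (jf n).
Qed.

Section Cutoff.
Context {R : realType}.

(** A continuous cutoff: unlike a truncation by an indicator, it keeps the functions within reach of
    [helly_limit]. *)
Definition cut (N : nat) (v : R) : R := Num.max 0 (Num.min 1 (N.+1%:R - `|v|)).

Lemma cut_itv N v : 0 <= cut N v <= 1.
Proof. by rewrite /cut le_max lexx /= ge_max ler01 ge_min lexx. Qed.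

Lemma cut1 N v : `|v| <= N%:R -> cut N v = 1.
Proof.
move=> vN; rewrite /cut min_l ?max_r//.
by rewrite -natr1 lerBrDl lerD2r.
Qed.

Lemma cut0 N v : N.+1%:R <= `|v| -> cut N v = 0.
Proof.
move=> vN; rewrite /cut max_l// ge_min subr_le0 vN orbT//.
Qed.

Lemma cut_continuous N : continuous (cut N).
Proof.
move=> v; apply: (@continuous_max R R (fun=> 0) (Num.min 1 \o (fun v => N.+1%:R - `|v|))).
  exact: cvg_cst.
apply: (@continuous_min R R (fun=> 1) (fun v => N.+1%:R - `|v|)); first exact: cvg_cst.
by apply: cvgB; [exact: cvg_cst|exact: norm_continuous].
Qed.

Lemma cut_cvg (g : R -> R) v : cut N v * g v @[N --> \oo] --> g v.
Proof.
apply: cvg_near_cst; exists (Num.truncn `|v|).+1 => // N /= vN.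
rewrite cut1 ?mul1r//; apply: (@le_trans _ _ (Num.truncn `|v|).+1%:R); last by rewrite ler_nat.
exact: ltW (truncnS_gt _).
Qed.

End Cutoff.

(** * Sequential compactness of the class [tails] *)

Section Compactness.
Context {R : realType} (b lambda Q T : R) (f0 : borelProb R).
Hypothesis b1 : 1 < b.
Hypothesis iW0 : intg f0 (W b).
Local Notation RM := (measurableTypeR R).
Local Notation W := (W b).
Local Notation tail := (tail b).
Local Notation tails := (tails b lambda Q f0 T).
Local Notation Wbound := (Wbound b lambda Q f0 T).

Definition W_growth (psi : R -> R) : Prop :=
  continuous psi /\ exists D : R, forall v, `|psi v| <= D * W v.

Let W_pos v : 0 <= W v. Proof. exact: ltW (W_gt0 b v). Qed.

Lemma intg_growth psi (mu : borelProb R) : W_growth psi -> intg mu W -> intg mu psi.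
Proof. move=> [cpsi [D HD]]; apply: (intg_dom _ HD); exact: mR_continuous. Qed.

Lemma cut_growth psi N : W_growth psi -> W_growth (fun v => cut N v * psi v).
Proof.
move=> [cpsi [D HD]]; split; last exists D.
  by move=> v; apply: cvgM; [exact: cut_continuous|exact: cpsi].
move=> v; rewrite normrM; apply: le_trans (HD v); rewrite ler_piMl//.
by case/andP : (cut_itv N v) => h1 h2; rewrite ger0_norm.
Qed.

Lemma cut_limit_le psi (mu : borelProb R) M : W_growth psi -> intg mu psi -> (forall v, 0 <= psi v) ->
  (forall N, \int[mu]_v (cut N v * psi v) <= M) -> \int[mu]_v psi v <= M.
Proof.
move=> [cpsi _] ipsi pos HM.
have [||||] := exp_dominated (P := mu) (f_ := fun N v => cut N v * psi v) (f := psi) (g := psi).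
- move=> N; apply: mR_continuous => v.
  by apply: cvgM; [exact: cut_continuous|exact: cpsi].
- exact: ipsi.
- move=> N v; case/andP : (cut_itv N v) => h1 h2.
  by rewrite ger0_norm ?mulr_ge0// ler_piMl.
- exact: cut_cvg.
- by move=> _ c; apply: (cvg_le_lim c (cvg_cst M)).
Qed.

Lemma W_growthW : W_growth W.
Proof. by split; [exact: continuous_der (dW b1)|exists 1 => v; rewrite mul1r ger0_norm]. Qed.

Lemma W_growth_tail r : 1 <= r -> W_growth (tail r).
Proof.
move=> r1; split; first by apply: continuous_der => v; exact: dtail.
by exists 1 => v; rewrite mul1r ger0_norm ?tail_ge0// tail_le_W.
Qed.

Lemma cut_error psi (D : R) N (mu : borelProb R) : W_growth psi -> (forall v, `|psi v| <= D * W v) ->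
  intg mu W ->
  `|\int[mu]_v psi v - \int[mu]_v (cut N.+1 v * psi v)| <= 2 * D * \int[mu]_v tail N.+1%:R v.
Proof.
move=> gpsi HD iW; have N1 : 1 <= N.+1%:R :> R by rewrite ler1n.
have D0 : 0 <= D by have := le_trans (normr_ge0 _) (HD 0); rewrite pmulr_lge0// W_gt0.
have i1 := intg_growth gpsi iW; have i2 := intg_growth (cut_growth N.+1 gpsi) iW.
have it := intg_tail b1 N1 iW.
rewrite -expB// -expZ//; apply: exp_norm; [exact: intgB|exact: intgZ|move=> v].
have [vN|Nv] := leP `|v| N.+1%:R.
  rewrite cut1// mul1r subrr normr0.
  by apply: mulr_ge0; [exact: mulr_ge0|exact: tail_ge0].
have -> : psi v - cut N.+1 v * psi v = (1 - cut N.+1 v) * psi v by ring.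
rewrite normrM; apply: (@le_trans _ _ `|psi v|).
  rewrite ler_piMl//; case/andP : (cut_itv N.+1 v) => h1 h2.
  by rewrite ger0_norm ?subr_ge0// lerBlDr lerDl.
apply: (le_trans (HD v)); rewrite mulrAC mulrC ler_wpM2r//.
by rewrite W_le_tail// ltW.
Qed.

(** Chebyshev's inequality with weight [2 * tail N.+1%:R v], which is at least 1 where |v| >= N + 1
    since [W] is at least 1 everywhere. *)
Lemma tails_tight e : 0 < e -> exists A : R, forall mu, tails mu -> forall x : R,
  (x <= - A -> cdfR mu x <= e) /\ (A <= x -> 1 - e <= cdfR mu x).
Proof.
move=> e0; have e2 : 0 < e / 2 by rewrite divr_gt0.
have [N HN] := tails_small lambda Q b1 iW0 T e2; exists N.+2%:R => mu tmu x.
have N1 : 1 <= N.+1%:R :> R by rewrite ler1n.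
have NN : N.+1%:R < N.+2%:R :> R by rewrite ltr_nat.
have it := intg_tail b1 N1 tmu.1.
have iray : intg mu (ind `]-oo, x]%classic).
  apply: (intg_bounded 1) => [|v]; first exact: measurable_indic.
  by rewrite /ind indicE; case: (_ \in _); rewrite ?normr1 ?normr0.
have ray (v : R) : ind `]-oo, x]%classic v = (v <= x)%R%:R.
  by rewrite /ind indicE mem_setE in_itv.
have far (v : R) : N.+1%:R <= `|v| -> 1 <= 2 * tail N.+1%:R v.
  by move=> Nv; apply: le_trans (W_ge1 b1 v) _; exact: W_le_tail.
have pos v : 0 <= 2 * tail N.+1%:R v by rewrite mulr_ge0// tail_ge0.
have E2 : \int[mu]_v (2 * tail N.+1%:R v) <= e.
  by rewrite expZ// [leRHS](_ : e = 2 * (e / 2)) ?ler_wpM2l ?HN//; field.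
rewrite -exp_ray; split => xN.
  apply: le_trans E2; apply: exp_le => //; first exact: intgZ.
  move=> v; rewrite ray; have [vx|//] := leP v x; apply: far.
  rewrite ler0_norm; last by apply: (le_trans vx); apply: (le_trans xN); rewrite oppr_le0.
  by rewrite lerNr (le_trans vx)// (le_trans xN)// lerN2 ltW.
rewrite lerBlDl -lerBlDr; apply: le_trans E2.
rewrite -[X in X - _](exp_cst mu 1) -expB//; last exact: intg_cst.
apply: exp_le; [by apply: intgB => //; exact: intg_cst|exact: intgZ|].
move=> v; rewrite ray; have [vx|xv] := leP v x; first by rewrite subrr.
rewrite subr0; apply: far; apply: le_trans (ler_norm _).
by rewrite (le_trans (ltW NN))// (le_trans xN)// ltW.
Qed.

(** Helly's theorem gives the limit on compactly supported functions. Fatou's lemma puts [W] in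
    reach, the tail bounds pass to the limit under the cutoff, and with them the cutoff is removed
    uniformly in n. *)
Lemma tails_limit (mu_ : nat -> borelProb R) (L : rat -> R) :
  (forall n, tails (mu_ n)) ->
  (forall r, cdfR (mu_ n) (ratr r) @[n --> \oo] --> L r) ->
  exists2 mu, tails mu & forall psi, W_growth psi ->
    \int[mu_ n]_v psi v @[n --> \oo] --> \int[mu]_v psi v.
Proof.
move=> tmu cvgL; have [mu Hmu] : exists mu : borelProb R, forall psi : R -> R, continuous psi ->
  (exists A : R, forall v, A <= `|v| -> psi v = 0) ->
  \int[mu_ n]_v psi v @[n --> \oo] --> \int[mu]_v psi v.
  apply: helly_limit cvgL _ => e e0; have [A HA] := tails_tight e0.
  by exists A => n x; exact: HA.
have cutlim N psi : W_growth psi ->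
    \int[mu_ n]_v (cut N v * psi v) @[n --> \oo] --> \int[mu]_v (cut N v * psi v).
  move=> /(cut_growth N)[c _]; apply: Hmu c _; exists N.+1%:R => v Nv.
  by rewrite cut0// mul0r.
have cutle N psi M : W_growth psi -> (forall v, 0 <= psi v) ->
    (forall n, \int[mu_ n]_v psi v <= M) -> \int[mu]_v (cut N v * psi v) <= M.
  move=> gpsi pos HM; apply: (cvg_le_lim (cutlim N psi gpsi) (cvg_cst M)) => n.
  apply: le_trans (HM n); have [iW _] := tmu n.
  apply: exp_le; [exact: intg_growth (cut_growth N gpsi) iW|exact: intg_growth iW|].
  by move=> v; case/andP : (cut_itv N v) => _ h; rewrite ler_piMl.
have icut N psi : W_growth psi -> intg mu (fun v => cut N v * psi v).
  move=> gpsi; have [c _] := cut_growth N gpsi; have [_ [D HD]] := gpsi.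
  apply: (intg_bounded (`|D| * W N.+1%:R)); first exact: mR_continuous.
  move=> v; have [Nv|vN] := leP N.+1%:R `|v|.
    by rewrite cut0// mul0r normr0 mulr_ge0.
  case/andP : (cut_itv N v) => h1 h2; rewrite normrM (ger0_norm h1).
  apply: (le_trans (ler_piMl _ h2)) => //; apply: (le_trans (HD v)).
  apply: (@le_trans _ _ (`|D| * W v)); first by rewrite ler_wpM2r// ler_norm.
  by apply: ler_wpM2l => //; apply: W_mono => //; rewrite (ger0_norm (ler0n _ _)) ltW.
have iW : intg mu W.
  apply: (@intg_fatou _ RM R mu (fun N v => cut N v * W v) W Wbound).
  - by move=> N; apply: icut; exact: W_growthW.
  - by move=> N v; case/andP : (cut_itv N v) => h1 h2; rewrite mulr_ge0.
  - exact: cut_cvg.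
  - by move=> N; apply: cutle => // [|n]; [exact: W_growthW|exact: tails_W].
have tl : tails mu.
  split=> // r r1; apply: cut_limit_le => [||v|N].
  - exact: W_growth_tail.
  - exact: intg_tail.
  - exact: tail_ge0.
  - apply: cutle => [|v|n]; [exact: W_growth_tail|exact: tail_ge0|exact: (tmu n).2].
exists mu => // psi gpsi; have [cpsi [D HD]] := gpsi.
have D0 : 0 <= D by have := le_trans (normr_ge0 _) (HD 0); rewrite pmulr_lge0// W_gt0.
apply/cvgrPdist_le => /= e e0.
have e1 : 0 < e / (6 * (D + 1)) by rewrite divr_gt0// mulr_gt0// ltr_wpDl.
have [N HN] := tails_small lambda Q b1 iW0 T e1.
have err nu : tails nu ->
    `|\int[nu]_v psi v - \int[nu]_v (cut N.+1 v * psi v)| <= e / 3.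
  move=> tnu; apply: (le_trans (cut_error N gpsi HD tnu.1)).
  apply: (@le_trans _ _ (2 * D * (e / (6 * (D + 1))))).
    by apply: ler_wpM2l; [rewrite mulr_ge0|exact: HN].
  have D1 : 0 < D + 1 by rewrite ltr_wpDl.
  have -> : 2 * D * (e / (6 * (D + 1))) = e / 3 * (D / (D + 1)) by field; rewrite gt_eqF.
  by rewrite ler_piMr ?divr_ge0 ?(ltW e0)// ler_pdivrMr// mul1r lerDl.
have e3 : 0 < e / 3 by rewrite divr_gt0.
have /cvgrPdist_le /(_ _ e3) [n0 _ Hn] := cutlim N.+1 psi gpsi.
exists n0 => // n /= nn; have := Hn n nn; have := err _ (tmu n); have := err _ tl.
rewrite !ler_norml => /andP[? ?] /andP[? ?] /andP[? ?].
by apply/andP; split; lra.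
Qed.

Lemma tails_compact (mu_ : nat -> borelProb R) : (forall n, tails (mu_ n)) ->
  exists k mu, [/\ subseq_index k, tails mu & forall psi, W_growth psi ->
    \int[mu_ (k n)]_v psi v @[n --> \oo] --> \int[mu]_v psi v].
Proof.
move=> tmu; pose u i n := if unpickle i is Some r then cdfR (mu_ n) (ratr r) else 0.
have [|k ik Hk] := @diagonal R u 1.
  move=> i n; rewrite /u; case: (unpickle i) => [r|]; last by rewrite normr0.
  by case/andP : (cdfR_itv (mu_ n) (ratr r)) => h1 h2; rewrite ger0_norm.
pose L (r : rat) : R := limn (fun n => u (pickle r) (k n)).
have [r|mu tl Hmu] := tails_limit (L := L) (fun n => tmu (k n)).
  by have := Hk (pickle r); rewrite /L /u pickleK => c; exact: c.
by exists k, mu; split.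
Qed.

(** Compactness replaces the approximation of [psi] by tests. If the difference stayed above some e,
    joint limits along a subsequence would agree on all tests, hence be equal, and would agree on
    [psi] too. *)
Lemma test_determines (mu_ nu_ : nat -> borelProb R) psi :
  (forall n, tails (mu_ n)) -> (forall n, tails (nu_ n)) ->
  (forall phi, test_function phi ->
    \int[mu_ n]_v phi v - \int[nu_ n]_v phi v @[n --> \oo] --> (0 : R)) ->
  W_growth psi -> \int[mu_ n]_v psi v - \int[nu_ n]_v psi v @[n --> \oo] --> (0 : R).
Proof.
move=> tmu tnu test gpsi; apply: contrapT => H.
have [e e0 He] : exists2 e : R, 0 < e & forall N, exists2 n, (N <= n)%N &
    e < `|\int[mu_ n]_v psi v - \int[nu_ n]_v psi v|.
  apply: contrapT => K; apply: H; apply/cvgrPdist_le => /= e e0.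
  apply: contrapT => J; apply: K; exists e => // N; apply: contrapT => I; apply: J.
  exists N => // n /= Nn; rewrite sub0r normrN leNgt; apply/negP => L.
  by apply: I; exists n.
have [s0 Hs] := choice (fun N => (let: ex_intro2 n h1 h2 := He N in
   ex_intro (fun n => (N <= n)%N /\ e < `|\int[mu_ n]_v psi v - \int[nu_ n]_v psi v|) n
     (conj h1 h2))).
pose s := fix s n := if n is m.+1 then s0 (s m).+1 else s0 0%N.
have is_ : subseq_index s by move=> n /=; case: (Hs (s n).+1).
have es n : e < `|\int[mu_ (s n)]_v psi v - \int[nu_ (s n)]_v psi v|.
  by case: n => [|n] /=; [case: (Hs 0%N)|case: (Hs (s n).+1)].
have [k [mu [ik tm Hmu]]] := tails_compact (fun n => tmu (s n)).
have [j [nu [ij tn Hnu]]] := tails_compact (fun n => tnu (s (k n))).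
have gtest phi : test_function phi -> W_growth phi.
  move=> tphi; have [dphi [M HM]] := tphi 0%N; split.
    by move=> v; apply: differentiable_continuous; exact/derivable1_diffP/dphi.
  exists `|M| => v; apply: (le_trans (HM v)); apply: (le_trans (ler_norm _)).
  by rewrite ler_peMr// W_ge1.
have eq : forall phi, test_function phi -> \int[mu]_v phi v = \int[nu]_v phi v.
  move=> phi tphi; apply/eqP; rewrite -subr_eq0; apply/eqP.
  have c1 : \int[mu_ (s (k (j n)))]_v phi v - \int[nu_ (s (k (j n)))]_v phi v
      @[n --> \oo] --> \int[mu]_v phi v - \int[nu]_v phi v.
    by apply: cvgB (Hnu _ (gtest _ tphi)); exact: (cvg_subseq ij (Hmu _ (gtest _ tphi))).
  have c2 := cvg_subseq (subseq_comp is_ (subseq_comp ik ij)) (test _ tphi).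
  exact: (cvg_unique (@Rhausdorff R) c1 c2).
have c : \int[mu_ (s (k (j n)))]_v psi v - \int[nu_ (s (k (j n)))]_v psi v
    @[n --> \oo] --> \int[mu]_v psi v - \int[nu]_v psi v.
  by apply: cvgB (Hnu _ gpsi); exact: (cvg_subseq ij (Hmu _ gpsi)).
rewrite (test_function_unique eq psi) subrr in c.
move/cvgrPdist_le : c => /(_ _ e0) [N _ /(_ N (leqnn N))] /=.
by rewrite sub0r normrN leNgt => /negP; apply; exact: es.
Qed.

End Compactness.

(** * Passage to the limit *)

Section LimitProcess.
Context {R : realType} (b lambda Q : R) (f0 : borelProb R).
Hypothesis b1 : 1 < b.
Hypothesis Q0 : 0 <= Q.
Hypothesis iW0 : intg f0 (W b).
Local Notation evolution := (evolution b lambda).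
Local Notation admissible := (admissible lambda Q).
Local Notation tails := (tails b lambda Q f0).

Lemma test_C2 (phi : R -> R) : test_function phi ->
  exists C, C2 b phi (derive1 phi) (derive1n 2 phi) C.
Proof.
move=> tphi; have [_ [M HM]] := tphi 2%N; exists `|M|.
have der n (v : R) : is_derive v 1 (derive1n n phi) (derive1n n.+1 phi v).
  by have [d _] := tphi n; rewrite derive1nS derive1E; apply/derivableP/d.
split; [exact: (der 0%N)|exact: (der 1%N)|move=> v].
apply: (le_trans (HM v)); apply: (le_trans (ler_norm _)).
by rewrite ler_peMr// theta1_ge1.
Qed.

Lemma C2_W_growth phi phi1 phi2 C : C2 b phi phi1 phi2 C -> W_growth b phi.
Proof.
move=> c2; have [D _ HD] := C2_growth b1 c2; have [d1 _ _] := c2.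
by split; [exact: continuous_der d1|exists D => v; case: (HD v)].
Qed.

(** Here [psi] is merely continuous. A failure yields evolutions and pairs of times ever closer; on
    tests their integrals merge by the common Lipschitz bound, hence also on [psi] by
    [test_determines]. *)
Lemma evolution_equicontinuous psi T (e : R) : W_growth b psi -> 0 < e ->
  exists2 d : R, 0 < d & forall k q h, admissible k q -> evolution k q f0 h ->
    forall s t : R, 0 <= s <= T -> 0 <= t <= T -> `|t - s| <= d ->
    `|\int[h t]_v psi v - \int[h s]_v psi v| <= e.
Proof.
move=> gpsi e0; apply: contrapT => H.
pose bad (m : nat) (x : (R * R) * (R -> borelProb R) * (R * R)) :=
  [/\ admissible x.1.1.1 x.1.1.2, evolution x.1.1.1 x.1.1.2 f0 x.1.2,
      0 <= x.2.1 <= T /\ 0 <= x.2.2 <= T, `|x.2.2 - x.2.1| <= m.+1%:R^-1 &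
      e < `|\int[x.1.2 x.2.2]_v psi v - \int[x.1.2 x.2.1]_v psi v|].
have /choice[x Hx] m : exists x, bad m x.
  apply: contrapT => K; apply: H.
  exists (m.+1%:R^-1); first by rewrite invr_gt0.
  move=> k q h adm ev s t sT tT st; rewrite leNgt; apply/negP => L; apply: K.
  by exists ((k, q), h, (s, t)); split.
have := @test_determines R b lambda Q T f0 b1 iW0 (fun m => (x m).1.2 (x m).2.2)
  (fun m => (x m).1.2 (x m).2.1) psi.
have tl m (t : R) : 0 <= t <= T -> tails T ((x m).1.2 t).
  by have [adm ev _ _ _] := Hx m; exact: tails_evolution adm ev.
move=> /(_ _ _ _ gpsi) c; have {c} : \int[(x m).1.2 (x m).2.2]_v psi v -
    \int[(x m).1.2 (x m).2.1]_v psi v @[m --> \oo] --> (0 : R).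
  apply: c => [m|m|phi tphi].
  - by apply: tl; have [_ _ [_ ?] _ _] := Hx m.
  - by apply: tl; have [_ _ [? _] _ _] := Hx m.
  have [C c2] := test_C2 tphi.
  have [L L0 HL] := evolution_lip lambda f0 b1 Q0 T c2.
  apply/cvgrPdist_le => /= d d0.
  exists (Num.truncn (L / d)) => // m /= Nm; rewrite sub0r normrN.
  have [adm ev [sT tT] st _] := Hx m.
  apply: (le_trans (HL _ _ _ adm ev _ _ sT tT)).
  apply: (le_trans (ler_wpM2l L0 st)); rewrite ler_pdivrMr// -ler_pdivrMl// mulrC.
  by apply: ltW; apply: lt_le_trans (truncnS_gt _) _; rewrite ler_nat ltnS.
move/cvgrPdist_le => /(_ _ e0) [N _ /(_ N (leqnn N))] /=.
by have [_ _ _ _] := Hx N; rewrite sub0r normrN leNgt => ->.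
Qed.

Variables (k_ q_ : nat -> R) (h_ : nat -> R -> borelProb R).
Hypothesis adm : forall n, admissible (k_ n) (q_ n).
Hypothesis ev : forall n, evolution (k_ n) (q_ n) f0 (h_ n).
Hypothesis q_cvg0 : q_ @ \oo --> (0 : R).

(** The Lipschitz bound compares time t with a rational time slightly after it, where the whole
    sequence converges. The integrals at t therefore cluster, and the limit along one subsequence
    [j] is the limit of all. *)
Lemma test_limit (K : nat -> nat) phi (t : R) : subseq_index K -> test_function phi ->
  0 <= t ->
  (forall r : rat, 0 <= ratr r :> R -> cvgn (fun n => \int[h_ (K n) (ratr r)]_v phi v)) ->
  forall j (mu : borelProb R), subseq_index j ->
    \int[h_ (K (j n)) t]_v phi v @[n --> \oo] --> \int[mu]_v phi v ->
  \int[h_ (K n) t]_v phi v @[n --> \oo] --> (\int[mu]_v phi v : R).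
Proof.
move=> iK tphi t0 cr j mu ij cj; have [C c2] := test_C2 tphi.
have [L L0 HL] := evolution_lip lambda f0 b1 Q0 (t + 1) c2.
apply/cvgrPdist_le => /= e e0; have e4 : 0 < e / 4 by rewrite divr_gt0.
pose d := Num.min 1 (e / 4 / (L + 1)).
have d0 : 0 < d by rewrite lt_min ltr01 divr_gt0// ltr_wpDl.
have [r] := @rat_in_itvoo R t (t + d) ltac:(by rewrite ltrDl).
rewrite in_itv/= => /andP[tr rd]; have r0 : 0 <= ratr r :> R by rewrite (le_trans t0)// ltW.
have /cvg_ex[/= l /cvgrPdist_le /(_ _ e4)[N _ HN]] := cr r r0.
have near n : (N <= n)%N -> `|\int[h_ (K n) t]_v phi v - l| <= e / 2.
  move=> Nn; have h1 := HN n Nn.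
  have h2 : `|\int[h_ (K n) (ratr r)]_v phi v - \int[h_ (K n) t]_v phi v| <= e / 4.
    have d1 : d <= 1 by rewrite ge_min lexx.
    have dL : d <= e / 4 / (L + 1) by rewrite ge_min lexx orbT.
    apply: (le_trans (HL _ _ _ (adm _) (ev _) _ _ _ _)).
    - by rewrite t0 lerDl ler01.
    - by rewrite r0 (le_trans (ltW rd))// lerD2l.
    apply: (@le_trans _ _ ((L + 1) * d)).
      apply: ler_pM => //; first by rewrite lerDl.
      by rewrite ger0_norm ?subr_ge0 ?(ltW tr)// lerBlDl ltW.
    by rewrite mulrC -ler_pdivlMr// ltr_wpDl.
  by move: h1 h2; rewrite !ler_norml => /andP[? ?] /andP[? ?]; apply/andP; split; lra.
have lmu : `|\int[mu]_v phi v - l| <= e / 2.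
  apply: (cvg_norm_le (cvgB cj (cvg_cst l))); exists N => n Nn.
  by apply: near; exact: leq_trans Nn (subseq_ge n ij).
exists N => // n /= Nn; have := near n Nn.
by move: lmu; rewrite !ler_norml => /andP[? ?] /andP[? ?]; apply/andP; split; lra.
Qed.

Lemma limit_process : exists (K : nat -> nat) (h : R -> borelProb R), [/\ subseq_index K,
  forall t : R, 0 <= t -> intg (h t) (W b) &
  forall t : R, 0 <= t -> forall psi, W_growth b psi ->
    \int[h_ (K n) t]_v psi v @[n --> \oo] --> \int[h t]_v psi v].
Proof.
pose u i n : R := if unpickle i is Some sr then cdfR (h_ n (ratr sr.1)) (ratr sr.2) else 0.
have [|K iK HK] := @diagonal R u 1.
  move=> i n; rewrite /u; case: (unpickle i) => [[s r]|]; last by rewrite normr0.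
  by case/andP : (cdfR_itv (h_ n (ratr s)) (ratr r)) => h1 h2; rewrite ger0_norm.
have tl n (t T : R) : 0 <= t <= T -> tails T (h_ n t).
  by move=> tT; exact: (tails_evolution b1 Q0 (adm n) (ev n) tT).
have rat_cvg (s : rat) psi : 0 <= ratr s :> R -> W_growth b psi ->
    cvgn (fun n => \int[h_ (K n) (ratr s)]_v psi v).
  move=> s0 gpsi; pose L (r : rat) : R := limn (fun n => u (pickle (s, r)) (K n)).
  have sT : 0 <= (ratr s : R) <= ratr s by rewrite s0 lexx.
  have [r|mu _ Hmu] := tails_limit (L := L) b1 iW0 (fun n => tl (K n) _ _ sT).
    by have := HK (pickle (s, r)); rewrite /L /u pickleK => c; exact: c.
  by apply/cvg_ex; exists (\int[mu]_v psi v); exact: Hmu.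
have /choice[h Hh] (t : R) : exists mu : borelProb R, 0 <= t -> intg mu (W b) /\
    forall psi, W_growth b psi ->
      \int[h_ (K n) t]_v psi v @[n --> \oo] --> \int[mu]_v psi v.
  (* At negative times, on which nothing is claimed, [f0] is a filler. *)
  have [t0|t0] := leP 0 t; last by exists f0.
  have tT : 0 <= t <= t by rewrite t0 lexx.
  have [j [mu [ij tmu Hmu]]] := tails_compact b1 iW0 (fun n => tl (K n) _ _ tT).
  exists mu => _; split; first exact: tmu.1.
  move=> psi gpsi.
  have D := @test_determines R b lambda Q t f0 b1 iW0 (fun n => h_ (K n) t) (fun=> mu) psi
    (fun n => tl (K n) _ _ tT) (fun=> tmu) _ gpsi.
  have c : \int[h_ (K n) t]_v psi v - \int[mu]_v psi v @[n --> \oo] --> (0 : R).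
    apply: D => phi tphi; have [C c2] := test_C2 tphi.
    rewrite -(subrr (\int[mu]_v phi v)); apply: cvgB; last exact: cvg_cst.
    apply: (test_limit iK tphi t0 _ ij (Hmu _ (C2_W_growth c2))) => r r0.
    by apply: rat_cvg => //; exact: C2_W_growth c2.
  apply/cvgrPdist_le => /= e e0; move/cvgrPdist_le : c => /(_ e e0)[N _ HN].
  by exists N => // n /= /HN; rewrite /= sub0r opprB.
by exists K, h; split => // t t0; case: (Hh t t0).
Qed.

(** * The equation and the initial datum of the limit *)

Section LimitEquation.
Variables (K : nat -> nat) (h : R -> borelProb R).
Hypothesis iK : subseq_index K.
Hypothesis lim : forall t : R, 0 <= t -> forall psi, W_growth b psi ->
  \int[h_ (K n) t]_v psi v @[n --> \oo] --> \int[h t]_v psi v.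
Variables (phi phi1 phi2 : R -> R) (C : R).
Hypothesis c2 : C2 b phi phi1 phi2 C.
Hypothesis cphi2 : continuous phi2.

Let G := generator lambda phi1 phi2.

Let gG : W_growth b G.
Proof.
split; first exact: generator_continuous c2 cphi2.
exact: generator_growth c2.
Qed.

Let gphi : W_growth b phi := C2_W_growth c2.

Lemma limit_derive (t : R) : 0 < t ->
  is_derive t 1 (fun u : R => \int[h u]_v phi v) (\int[h t]_v G v).
Proof.
move=> t0; apply: is_derive_approx => e e0; have e2 : 0 < e / 2 by rewrite divr_gt0.
have [q1 q10 Hq] := evolution_error lambda b1 Q0 iW0 c2 cphi2 (t + 1) e2.
have [d d0 Hd] := evolution_equicontinuous (t + 1) gG e2.
exists (Num.min (Num.min 1 t) d); first by rewrite !lt_min ltr01 t0.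
move=> u; rewrite !lt_min => /andP[/andP[ut1 utt] utd].
have u0 : 0 < u by move: utt; rewrite ltr_norml => /andP[? _]; lra.
have u1 : u <= t + 1 by move: ut1; rewrite ltr_norml => /andP[_ ?]; lra.
have /cvgrPdist_lt /(_ _ q10) [N _ HN] := q_cvg0.
(* One endpoint is t, so the intermediate time is within d of t. Half of e pays for replacing the
   derivative by the generator there, the other half for moving the integral of the generator to
   time t. *)
have step n : (N <= n)%N -> forall x y : R, 0 < x -> x < y -> y <= t + 1 -> y - x <= d ->
   x = t \/ y = t ->
   `|\int[h_ n y]_v phi v - \int[h_ n x]_v phi v - (y - x) * \int[h_ n t]_v G v| <=
     e * (y - x).
  move=> Nn x y x0 xy yT yxd xyt.
  have [c /andP[xc cy] ->] := mvt_half (evo_derive (ev n) c2) (evo_cvg0 (ev n) c2) (ltW x0) xy.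
  set D := (X in X * (y - x)).
  have c0 : 0 < c by exact: lt_trans xc.
  have cT : c <= t + 1 by rewrite (le_trans (ltW cy)).
  have qn : q_ n <= q1.
    by have := HN n Nn; rewrite /= sub0r normrN => H; apply: le_trans (ltW H); exact: ler_norm.
  have h1 : `|D - \int[h_ n c]_v G v| <= e / 2.
    by apply: (Hq _ _ _ (adm n) (ev n) qn c); rewrite c0.
  have h2 : `|\int[h_ n c]_v G v - \int[h_ n t]_v G v| <= e / 2.
    apply: (Hd _ _ _ (adm n) (ev n)); [|by rewrite (ltW c0)|].
      by rewrite (ltW t0) lerDl ler01.
    by case: xyt => [<-|<-]; rewrite ler_norml; apply/andP; split; lra.
  have -> : D * (y - x) - (y - x) * \int[h_ n t]_v G v =
    ((D - \int[h_ n c]_v G v) + (\int[h_ n c]_v G v - \int[h_ n t]_v G v)) * (y - x) by ring.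
  rewrite normrM [X in _ * X]ger0_norm ?subr_ge0 ?(ltW xy)//.
  apply: ler_wpM2r; first by rewrite subr_ge0 ltW.
  by apply: (le_trans (ler_normD _ _)); rewrite [leRHS]splitr lerD.
have cv : \int[h_ (K n) u]_v phi v - \int[h_ (K n) t]_v phi v -
    (u - t) * \int[h_ (K n) t]_v G v @[n --> \oo] -->
    \int[h u]_v phi v - \int[h t]_v phi v - (u - t) * \int[h t]_v G v.
  apply: cvgB; first by apply: cvgB; apply: lim => //; exact: ltW.
  by apply: cvgMr; apply: lim => //; exact: ltW.
apply: (cvg_norm_le cv); exists N => n Nn.
have NK : (N <= K n)%N by exact: leq_trans Nn (subseq_ge n iK).
have [ut|tu|->] := ltgtP u t; last by rewrite !subrr mul0r subrr !normr0 mulr0.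
- have tud : t - u <= d by apply: le_trans (ltW utd); rewrite distrC; exact: ler_norm.
  have tT : t <= t + 1 by rewrite lerDl ler01.
  have := step _ NK u t u0 ut tT tud (or_intror erefl).
  rewrite [`|u - t|]distrC [`|t - u|]ger0_norm ?subr_ge0 ?(ltW ut)// => H.
  by rewrite -normrN; apply: le_trans H; rewrite le_eqVlt; apply/orP; left; apply/eqP;
    congr `| _ |; ring.
- have utd' : u - t <= d by apply: le_trans (ltW utd); exact: ler_norm.
  have := step _ NK t u t0 tu u1 utd' (or_introl erefl).
  by rewrite [`|u - t|]ger0_norm ?subr_ge0 ?(ltW tu).
Qed.

Lemma limit_init : \int[h t]_v phi v @[t --> 0^'+] --> \int[f0]_v phi v.
Proof.
have [L L0 HL] := evolution_lip lambda f0 b1 Q0 1 c2; have [_ [D HD]] := gphi.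
have close (t : R) : 0 <= t <= 1 -> `|\int[h t]_v phi v - \int[f0]_v phi v| <= L * t.
  move=> /andP[t0 t1]; have cv : \int[h_ (K n) t]_v phi v - \int[f0]_v phi v @[n --> \oo] -->
      \int[h t]_v phi v - \int[f0]_v phi v.
    by apply: cvgB; [exact: lim|exact: cvg_cst].
  apply: (cvg_norm_le cv); exists 0%N => n _.
  rewrite -(evo_init (ev (K n)) (mR_continuous (proj1 gphi)) HD).
  have z : 0 <= (0 : R) <= 1 by rewrite lexx ler01.
  have := HL _ _ _ (adm (K n)) (ev (K n)) 0 t z.
  by rewrite t0 t1 subr0 (ger0_norm t0); apply.
apply/cvgrPdist_le => /= e e0.
have eL : 0 < e / (L + 1) by rewrite divr_gt0// ltr_wpDl.
have H1 : \forall t \near (0 : R)^'+, t < Num.min 1 (e / (L + 1)).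
  by apply: nbhs_right_lt; rewrite lt_min ltr01.
have H2 : \forall t \near (0 : R)^'+, 0 < t by exact: nbhs_right_gt.
suff : \forall t \near (0 : R)^'+, `|\int[f0]_v phi v - \int[h t]_v phi v| <= e by [].
apply: filterS2 H1 H2 => t; rewrite lt_min => /andP[t1 te] t0; rewrite distrC.
apply: (le_trans (close t _)); first by rewrite (ltW t0) ltW.
apply: (@le_trans _ _ ((L + 1) * t)); first by rewrite ler_wpM2r ?(ltW t0)// lerDl.
by rewrite mulrC -ler_pdivlMr ?ltr_wpDl// ltW.
Qed.

End LimitEquation.
End LimitProcess.

(** * Test functions of the class F_s *)

Section Smoothness.
Context {R : realType}.

Lemma one_le_powR (a v : R) : 0 <= a -> 1 <= (1 + v ^+ 2) `^ a.
Proof.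
by move=> a0; rewrite -[leLHS](powRr0 (1 + v ^+ 2)) ler_powR// lerDl sqr_ge0.
Qed.

Lemma norm_powR2 (v : R) : `|v| `^ 2 = v ^+ 2.
Proof. by rewrite (powR_mulrn 2)// real_normK ?num_real. Qed.

Lemma norm_le_powR (a v : R) : 0 <= a -> `|v| `^ a <= (1 + v ^+ 2) `^ (a / 2).
Proof.
move=> a0; have -> : a = 2 * (a / 2) by field.
rewrite {1}powRrM; have -> : 2 * (a / 2) / 2 = a / 2 by field.
apply: ge0_ler_powR; rewrite ?nnegrE ?powR_ge0 ?addr_ge0 ?sqr_ge0 ?divr_ge0//.
by rewrite norm_powR2 lerDr.
Qed.

(** One integration from 0 raises the growth order from a to a + 1. *)
Lemma primitive_growth (F G : R -> R) (C a : R) : 0 <= a ->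
  (forall x : R, is_derive x 1 F (G x)) ->
  (forall v, `|G v| <= C * (1 + v ^+ 2) `^ (a / 2)) ->
  forall v, `|F v| <= (`|F 0| + C) * (1 + v ^+ 2) `^ ((a + 1) / 2).
Proof.
move=> a0 dF HG v.
have A1 x : 1 <= 1 + x ^+ 2 :> R by rewrite lerDl sqr_ge0.
have P1 : 1 <= (1 + v ^+ 2) `^ ((a + 1) / 2).
  by rewrite one_le_powR// divr_ge0// addr_ge0.
have C0 : 0 <= C.
  by have := le_trans (normr_ge0 _) (HG 0); rewrite expr0n addr0 powR1 mulr1.
have [th /andP[t0 t1]] := mvt_th 0 v dF; rewrite subr0 add0r => E.
have -> : F v = F 0 + (F v - F 0) by ring.
apply: (le_trans (ler_normD _ _)); rewrite mulrDl; apply: lerD; first by rewrite ler_peMr.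
rewrite E normrM; have -> : (a + 1) / 2 = a / 2 + 1 / 2 by field.
rewrite powRD; last by rewrite (gt_eqF (lt_le_trans ltr01 (A1 v))) implybT.
rewrite mulrA; apply: ler_pM => //.
- apply: (le_trans (HG _)); apply: ler_wpM2l => //.
  apply: ge0_ler_powR; rewrite ?nnegrE ?divr_ge0 ?(le_trans ler01 (A1 _))//.
  rewrite lerD2l exprMn ler_piMl ?sqr_ge0//.
  by rewrite expr_le1.
- by have := norm_le_powR v (@ler01 R); rewrite powRr1.
Qed.

Lemma hoelder_continuous (F : R -> R) (C d : R) : 0 < d ->
  (forall v w, `|F v - F w| <= C * `|v - w| `^ d) -> continuous F.
Proof.
move=> d0 H x; apply/cvgrPdist_le => /= e e0.
have C1 : 0 < `|C| + 1 by rewrite ltr_wpDl.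
pose r := (e / (`|C| + 1)) `^ d^-1.
have r0 : 0 < r by rewrite powR_gt0// divr_gt0.
apply/nbhs_ballP; exists r => //= y; rewrite /ball/= => xy.
apply: (le_trans (H x y)).
have rd : `|x - y| `^ d <= e / (`|C| + 1).
  have -> : e / (`|C| + 1) = r `^ d.
    by rewrite /r -powRrM mulVf ?gt_eqF// powRr1// divr_ge0// ltW.
  by apply: ge0_ler_powR; rewrite ?nnegrE ?(ltW d0) ?(ltW r0)// ltW.
apply: (@le_trans _ _ (`|C| * `|x - y| `^ d)).
  by rewrite ler_wpM2r ?powR_ge0 ?ler_norm.
apply: (le_trans (ler_wpM2l (normr_ge0 C) rd)).
by rewrite mulrA ler_pdivrMr// mulrC ler_wpM2l ?(ltW e0)// lerDl.
Qed.

Lemma hoelder_growth (F : R -> R) (C d : R) : 0 < d ->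
  (forall v w, `|F v - F w| <= C * `|v - w| `^ d) ->
  forall v, `|F v| <= (`|F 0| + `|C|) * (1 + v ^+ 2) `^ (d / 2).
Proof.
move=> d0 H v; have -> : F v = F 0 + (F v - F 0) by ring.
have P1 : 1 <= (1 + v ^+ 2) `^ (d / 2).
  by rewrite one_le_powR// divr_ge0// ltW.
apply: (le_trans (ler_normD _ _)); rewrite mulrDl; apply: lerD; first by rewrite ler_peMr.
apply: (le_trans (H v 0)); rewrite subr0; apply: (@le_trans _ _ (`|C| * `|v| `^ d)).
  by rewrite ler_wpM2r ?powR_ge0 ?ler_norm.
by rewrite ler_wpM2l// norm_le_powR// ltW.
Qed.

(** The Hölder bound gives the m-th derivative growth d, and m - 2 integrations give the second one
    growth d + m - 2 = 2 (b - 1), that of [theta 1]. For m = 2 its continuity is the Hölder bound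
    itself. *)
Lemma class_F_C2 (b : R) phi : 1 < b -> class_F (2 * b) phi ->
  continuous (derive1n 2 phi) /\ exists C, C2 b phi (derive1 phi) (derive1n 2 phi) C.
Proof.
move=> b1 [m [d [sE d0 d1 dphi [C HC]]]].
(* Since m + d = 2 b > 2 and d <= 1, two derivatives exist. *)
have m2 : (1 < m)%N by rewrite -(ltr_nat R); lra.
have der n (v : R) : (n < m)%N -> is_derive v 1 (derive1n n phi) (derive1n n.+1 phi v).
  by move=> nm; rewrite derive1nS derive1E; apply/derivableP/dphi.
have growth j : (j <= m - 2)%N -> exists K, forall v,
    `|derive1n (m - j) phi v| <= K * (1 + v ^+ 2) `^ ((d + j%:R) / 2).
  elim: j => [_|j IH jm].
    by exists (`|derive1n m phi 0| + `|C|) => v; rewrite subn0 addr0; exact: hoelder_growth.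
  have [K HK] := IH (ltnW jm).
  have mj : (m - j = (m - j.+1).+1)%N by rewrite subnSK// (leq_trans jm)// leq_subr.
  exists (`|derive1n (m - j.+1) phi 0| + K) => v.
  rewrite -natr1 addrA; apply: (primitive_growth (G := derive1n (m - j) phi)) => //.
    by rewrite addr_ge0// ltW.
  by move=> x; rewrite mj; apply: der; rewrite -mj leq_subr.
have [K HK] := growth (m - 2)%N (leqnn _).
have m22 : (m - (m - 2) = 2)%N by exact: subKn.
rewrite m22 in HK; split.
  have [mE|m3] := eqVneq m 2%N; first by rewrite mE in HC; exact: hoelder_continuous HC.
  by apply: continuous_der => v; apply: der; rewrite ltn_neqAle eq_sym m3.
exists K; split; [by move=> v; exact: (der 0%N v (ltnW m2))|by move=> v; exact: (der 1%N)|].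
move=> v; apply: (le_trans (HK v)); rewrite le_eqVlt; apply/orP; left; apply/eqP; congr (K * _).
have A0 : 0 < 1 + v ^+ 2 by rewrite ltr_pwDl// sqr_ge0.
have -> : (d + (m - 2)%:R) / 2 = b - 1.
  by rewrite natrB//; lra.
rewrite /theta /W expr1n; apply: (mulIf (lt0r_neq0 A0)).
by rewrite divfK ?gt_eqF// mulrC mulr_powRB1// ?(ltW A0)// (lt_trans ltr01).
Qed.

Lemma finite_momentP (b : R) (mu : borelProb R) : 1 < b ->
  finite_moment (2 * b) mu <-> intg mu (W b).
Proof.
move=> b1; have b0 : 0 <= b by rewrite ltW// (lt_trans ltr01).
have mp : mR (fun v : R => `|v| `^ (2 * b)).
  by apply: (measurableT_comp (measurable_powR _)); apply: mR_continuous; exact: norm_continuous.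
have pos (v : R) : 0 <= `|v| `^ (2 * b) by exact: powR_ge0.
split=> H.
- have ip : intg mu (fun v : R => `|v| `^ (2 * b)).
    apply/integrableP; split; first exact/measurable_EFinP.
    apply: le_lt_trans H; rewrite le_eqVlt; apply/orP; left; apply/eqP.
    by apply: eq_integral => v _ /=; rewrite ger0_norm.
  apply: (intg_le (mR_W b1) (intgZ (2 `^ b) (intgD (intg_cst mu 1) ip))) => v.
  rewrite ger0_norm ?(ltW (W_gt0 _ _))// /W.
  have [v1|v1] := leP `|v| 1.
    apply: (@le_trans _ _ (2 `^ b)); last by rewrite ler_peMr ?powR_ge0// lerDl.
    apply: ge0_ler_powR => //; rewrite ?nnegrE ?addr_ge0 ?sqr_ge0//.
    by rewrite -[2]/(1 + 1) lerD2l -[v ^+ 2]real_normK ?num_real// expr_le1.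
  apply: (@le_trans _ _ (2 `^ b * `|v| `^ (2 * b))); last first.
    by rewrite ler_wpM2l ?powR_ge0// lerDr.
  rewrite powRrM norm_powR2 -powRM ?sqr_ge0//.
  have vv : 1 <= v ^+ 2 by rewrite -[v ^+ 2]real_normK ?num_real// exprn_ege1// ltW.
  by apply: ge0_ler_powR => //; rewrite ?nnegrE; lra.
- have ip : intg mu (fun v : R => `|v| `^ (2 * b)).
    apply: (intg_le mp H) => v; rewrite ger0_norm//.
    by apply: (le_trans (norm_le_powR v _)); rewrite ?mulr_ge0// [2 * b]mulrC mulfK.
  have := integrable_lty measurableT ip; exact.
Qed.

End Smoothness.

(** * The Fokker-Planck form of the limit equation and the conclusion *)

Lemma generator_exp {R : realType} (b lambda : R) (mu : borelProb R) phi phi1 phi2 C :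
  1 < b -> C2 b phi phi1 phi2 C -> continuous phi2 -> intg mu (W b) ->
  \int[mu]_v generator lambda phi1 phi2 v + 2^-1 * (lambda ^+ 2 + 1) * \int[mu]_v (phi1 v * v) =
  2^-1 * \int[mu]_v ((lambda ^+ 2 * v ^+ 2 + 1) * phi2 v).
Proof.
move=> b1 c2 cphi2 iW; have [D D0 HD] := C2_growth b1 c2; have [_ d2 _] := c2.
have iG : intg mu (generator lambda phi1 phi2).
  by apply: intg_growth iW; split; [exact: generator_continuous c2 cphi2|exact: generator_growth c2].
have i1 : intg mu (fun v => phi1 v * v).
  apply: intg_dom _ _ iW.
    by apply: mR_continuous; exact: (continuous_der (fun v => dMul (d2 v) (dId v))).
  by move=> v; rewrite mulrC; case: (HD v) => _ _ + _; exact.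
have eG : (fun v => (lambda ^+ 2 * v ^+ 2 + 1) * phi2 v) =
    (fun v => 2 * (generator lambda phi1 phi2 v + 2^-1 * (lambda ^+ 2 + 1) * (phi1 v * v))).
  by apply/funext => v; rewrite /generator; field.
have i2 := intgZ (2^-1 * (lambda ^+ 2 + 1)) i1.
rewrite eG expZ; last exact: intgD.
by rewrite expD// expZ// mulrA mulVf// mul1r.
Qed.

(** As q tends to 0 along an arbitrary sequence, extraction is the choice of [k], made once for all
    times and all test functions. *)
Theorem theorem3p7 (R : realType) (delta lambda : R) (f0 : borelProb R)
  (p q : nat -> R) (f : nat -> R -> borelProb R) :
  0 < delta ->
  finite_moment (2 + delta) f0 ->
  \int[f0]_v v = 0 ->
  \int[f0]_v (v ^+ 2) = 1 ->
  (forall n, 0 < q n /\ q n < p n) ->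
  (forall n, (p n - 1) ^+ 2 / q n ^+ 2 = lambda ^+ 2) ->
  q @ \oo --> (0 : R) ->
  (forall n, boltzmann_weak_solution (p n) (q n) (2 + delta) f0 (f n)) ->
  exists (k : nat -> nat) (h : R -> borelProb R),
    [/\ {homo k : i j / (i < j)%N},
        forall tau : R, 0 <= tau -> forall phi, class_F (2 + delta) phi ->
          (\int[scaled_solution (p (k n)) (q (k n)) (f (k n))
                  (tau / q (k n) ^+ 2)]_v phi v) @[n --> \oo]
            --> \int[h tau]_v phi v &
        fokker_planck_weak_solution lambda (2 + delta) f0 h].
Proof.
move=> delta0 mom0 mean0 var0 qp plam q0 sol.
(* With this b the weight [W] has order 2 b = 2 + delta, so that [finite_momentP] reads the moment
   assumption as integrability of [W]. *)
pose b := 1 + delta / 2; have b1 : 1 < b by rewrite ltrDl divr_gt0.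
have bE : 2 + delta = 2 * b by rewrite /b; field.
have iW0 : intg f0 (W b) by apply/finite_momentP => //; rewrite -bE.
have kk n : (p n - 1) ^+ 2 = lambda ^+ 2 * q n ^+ 2.
  by have [qn _] := qp n; rewrite -(plam n) divfK// expf_neq0// gt_eqF.
have [Q Q0 HQ] : exists2 Q : R, 0 <= Q & forall n, q n <= Q.
  have /cvg_ex/cvg_seq_bounded[M [_ HM]] : exists l : R, q @ \oo --> l by exists 0.
  exists (`|M| + 1); first by rewrite addr_ge0.
  move=> n; apply: (le_trans (ler_norm _)); apply: HM => //.
  by apply: (le_lt_trans (ler_norm M)); rewrite ltrDl.
have adm n : admissible lambda Q (p n - 1) (q n).
  have [qn qpn] := qp n; split => //.
  by rewrite addrC subrK ltW// (lt_trans qn).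
have ev n : evolution b lambda (p n - 1) (q n) f0
    (fun t => scaled_solution (p n) (q n) (f n) (t / q n ^+ 2)).
  have [qn qpn] := qp n; have [mom _ _ _] := sol n.
  apply: evolution_scaled => //.
    by move=> t t0; apply/finite_momentP => //; rewrite -bE; exact: mom.
  by move=> phi tphi; exact: boltz_test (sol n) tphi.
have [k [h [ik ih lim]]] := limit_process b1 Q0 iW0 adm ev.
have C2F phi : class_F (2 + delta) phi -> continuous (derive1n 2 phi) /\
    exists C, C2 b phi (derive1 phi) (derive1n 2 phi) C.
  by rewrite bE; exact: class_F_C2.
exists k, h; split; first exact: subseq_homo.
  by move=> tau tau0 phi /C2F[_ [C c2]]; apply: lim => //; exact: C2_W_growth c2.
split.
- by move=> tau tau0; rewrite bE; apply/finite_momentP => //; exact: ih.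
- move=> phi /C2F[cphi2 [C c2]] tau tau0.
  have dF := limit_derive b1 Q0 iW0 adm ev q0 ik lim c2 cphi2 tau0.
  split; first by case: dF.
  have -> : derive1 (fun u : R => \int[h u]_v phi v) tau =
      \int[h tau]_v generator lambda (derive1 phi) (derive1n 2 phi) v.
    by rewrite derive1E; case: dF.
  exact: (generator_exp lambda b1 c2 cphi2 (ih _ (ltW tau0))).
- move=> phi /C2F[_ [C c2]]; have := limit_init b1 Q0 adm ev lim c2; exact.
Qed.
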